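(* Let $\kappa\in\mathbb Z_+$, let $X=X_{1,\kappa}$ and $\phi=\phi_{1,\kappa}$ be the set and self-map described in the context, and let $\mu$ be a discrete measure on $X$. Then $\mathcal D^\infty(C_\phi)$ is dense in $L^2(\mu)$, $\{\mathsf h_{\phi^n}(x)\}_{n=0}^\infty\subseteq(0,\infty)$ for every $x\in X$, and the following conditions are equivalent: (i) there exists a family $\{P(x,\cdot)\}_{x\in X}$ of Borel probability measures on $\mathbb R_+$ that satisfies the consistency condition (CC), (ii) $\{\mathsf h_{\phi^n}(x_0)\}_{n=0}^\infty$ is a Stieltjes moment sequence which has an S-representing measure $\rho$ vanishing on $[0,1)$, (iii) $0\le\sum_{i,j=0}^n\mathsf h_{\phi^{i+j}}(x_0)\lambda_i\bar\lambda_j\le\sum_{i,j=0}^n\mathsf h_{\phi^{i+j+1}}(x_0)\lambda_i\bar\lambda_j$ for all finite sequences $\{\lambda_i\}_{i=0}^n$ of complex numbers. Moreover, if any of the conditions (i), (ii), (iii) holds, then $C_\phi$ is subnormal.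
   Context: Notation: $\mathbb N=\{1,2,\ldots\}$, $\mathbb Z_+=\{0,1,2,\ldots\}$, $\mathbb R_+=[0,\infty)$; $0^0=1$. All measures are positive. The set and the symbol. $X=X_{1,\kappa}=\{x_0,\ldots,x_\kappa\}\cup\{x_{1,j}:j\in\mathbb N\}$, all listed points being distinct, and $\phi=\phi_{1,\kappa}\colon X\to X$ is given by $\phi(x_{1,j})=x_{1,j-1}$ for $j\ge2$; $\phi(x_{1,1})=x_\kappa$; $\phi(x_0)=x_\kappa$; $\phi(x_r)=x_{r-1}$ for $1\le r\le\kappa$. Operators. A discrete measure on $X$ is a $\sigma$-finite measure $\mu$ on $2^X$ with $\mu(x):=\mu(\{x\})>0$ for all $x\in X$ (so $\mu(x)<\infty$ as well). The composition operator $C_\phi$ in $L^2(\mu)$ has domain $\{f\in L^2(\mu):f\circ\phi\in L^2(\mu)\}$ and $C_\phi f=f\circ\phi$. For $n\in\mathbb Z_+$, $\mathsf h_{\phi^n}(x)=\mu((\phi^n)^{-1}(\{x\}))/\mu(x)\in[0,\infty]$. $\mathcal D^\infty(A)=\bigcap_{n\ge0}\mathcal D(A^n)$. An operator $A$ in a complex Hilbert space $\mathcal H$ is subnormal if it is densely defined and there is a (possibly unbounded) normal operator $N$ in a complex Hilbert space $\mathcal K\supseteq\mathcal H$ (isometric embedding) with $\mathcal D(A)\subseteq\mathcal D(N)$ and $Af=Nf$ for $f\in\mathcal D(A)$. Consistency condition. A family $\{P(x,\cdot)\}_{x\in X}$ of Borel probability measures on $\mathbb R_+$ satisfies (CC)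 if $\frac1{\mu(x)}\sum_{y\in\phi^{-1}(\{x\})}\mu(y)P(y,\sigma)=\int_\sigma t\,P(x,dt)$ for every Borel $\sigma\subseteq\mathbb R_+$ and every $x\in\phi(X)$. Moments. A real sequence $\{\gamma_n\}_{n=0}^\infty$ is a Stieltjes moment sequence if there is a Borel measure $\nu$ on $\mathbb R_+$ (an S-representing measure) with all moments finite and $\gamma_n=\int_{[0,\infty)}t^n\,d\nu(t)$ for all $n\in\mathbb Z_+$. *)

(* Defs.v *)
From HB Require Import structures.
From mathcomp Require Import all_boot all_order all_algebra.
From mathcomp Require Import all_classical all_reals all_analysis measurable_realfun.
From mathcomp Require Import complex ring lra.

Set Implicit Arguments.
Unset Strict Implicit.
Unset Printing Implicit Defensive.

Import Order.TTheory GRing.Theory Num.Theory.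
Import numFieldNormedType.Exports.

Local Open Scope classical_set_scope.
Local Open Scope ring_scope.
Local Open Scope complex_scope.

Section inner_product_norm.
Variables (R : realType) (V : lmodType R[i]) (dot : V -> V -> R[i]).
Hypothesis dotDl : forall x y z, dot (x + y) z = dot x z + dot y z.
Hypothesis dotZl : forall a x y, dot (a *: x) y = a * dot x y.
Hypothesis dotC : forall x y, dot y x = (dot x y)^*%R.
Hypothesis dot_ge0 : forall x, 0 <= dot x x.
Hypothesis dot_eq0 : forall x, dot x x = 0 -> x = 0.

Let dotDr x y z : dot x (y + z) = dot x y + dot x z.
Proof. by rewrite dotC dotDl rmorphD /= -!dotC. Qed.

Let dotZr a x y : dot x (a *: y) = a^*%R * dot x y.
Proof. by rewrite dotC dotZl rmorphM /= -!dotC. Qed.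

Let nrm (x : V) : R[i] := sqrtC (dot x x).

Let nrm_ge0 x : 0 <= nrm x. Proof. by rewrite sqrtC_ge0 dot_ge0. Qed.

Let nrmK x : nrm x ^+ 2 = dot x x. Proof. exact: sqrtCK. Qed.

Lemma inner_product_CauchySchwarz x y :
  `|dot x y| <= sqrtC (dot x x) * sqrtC (dot y y).
Proof.
rewrite -!/(nrm _).
have [y0|y0] := eqVneq y 0.
  have -> : dot x y = 0 by rewrite y0 -(scale0r y) dotZr rmorph0 mul0r.
  by rewrite normr0 mulr_ge0.
have yy0 : 0 < dot y y.
  by rewrite lt_def dot_ge0 andbT; apply: contra_neq y0; exact: dot_eq0.
rewrite -(@ler_pXn2r _ 2)// ?nnegrE ?mulr_ge0//.
rewrite exprMn !nrmK normCK -dotC -ler_pdivrMr//.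
rewrite -subr_ge0; pose a := dot x y / dot y y.
have ac : a^*%R = dot y x / dot y y.
  by rewrite /a rmorphM /= fmorphV /= -!dotC.
have -> : dot x x - dot x y * dot y x / dot y y
        = dot (x - a *: y) (x - a *: y).
  rewrite -(scaleNr a y) !(dotDl, dotDr) !(dotZl, dotZr) rmorphN /= ac /a.
  by field; rewrite gt_eqF.
exact: dot_ge0.
Qed.

Lemma inner_product_normD x y :
  sqrtC (dot (x + y) (x + y)) <= sqrtC (dot x x) + sqrtC (dot y y).
Proof.
rewrite -!/(nrm _).
rewrite -(@ler_pXn2r _ 2)// ?nnegrE ?addr_ge0//.
rewrite nrmK sqrrD !nrmK dotDl !dotDr.
rewrite addrA -[X in X + _ <= _]addrA lerD2r lerD2l.
rewrite [dot y x]dotC.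
have -> : dot x y + (dot x y)^*%R = 'Re (dot x y) *+ 2.
  by rewrite ReE -mulr_natr mulfVK // pnatr_eq0.
rewrite lerMn2r /=.
apply: le_trans (inner_product_CauchySchwarz x y).
apply: le_trans (leif_normC_Re_Creal _).1.
by apply: real_ler_norm; exact: Creal_Re.
Qed.

Lemma inner_product_normZ (a : R[i]) x :
  sqrtC (dot (a *: x) (a *: x)) = `|a| * sqrtC (dot x x).
Proof.
rewrite dotZl dotZr mulrA -normCK sqrtCM ?nnegrE ?exprn_ge0 ?dot_ge0//.
by rewrite sqrCK.
Qed.

Lemma inner_product_norm_eq0 x : sqrtC (dot x x) = 0 -> x = 0.
Proof. by move=> /eqP; rewrite sqrtC_eq0 => /eqP /dot_eq0. Qed.

End inner_product_norm.

(* The inner product is linear in its first argument; the last field ties it to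
   the norm of the underlying Banach space, whence its positive definiteness. *)
HB.mixin Record NormedModule_isHilbert (R : realType) V
    & CompleteNormedModule R[i] V := {
  dotv : V -> V -> R[i];
  dotvDl : forall x y z, dotv (x + y) z = dotv x z + dotv y z;
  dotvZl : forall a x y, dotv (a *: x) y = a * dotv x y;
  dotvC : forall x y, dotv y x = (dotv x y)^*%R;
  sqr_normv : forall x, `|x| ^+ 2 = dotv x x
}.

#[short(type="hilbertType")]
HB.structure Definition Hilbert (R : realType) :=
  {V of CompleteNormedModule R[i] V & NormedModule_isHilbert R V}.

(* Completeness is only required for sequences here. *)
HB.factory Record Lmodule_isHilbert (R : realType) V
    & GRing.Lmodule R[i] V := {
  dotv : V -> V -> R[i];
  dotvDl : forall x y z, dotv (x + y) z = dotv x z + dotv y z;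
  dotvZl : forall a x y, dotv (a *: x) y = a * dotv x y;
  dotvC : forall x y, dotv y x = (dotv x y)^*%R;
  dotv_ge0 : forall x, 0 <= dotv x x;
  dotv_eq0 : forall x, dotv x x = 0 -> x = 0;
  dotv_complete : forall u : nat -> V,
    (forall e : R, 0 < e -> exists N : nat, forall m n : nat,
       (N <= m)%N -> (N <= n)%N -> dotv (u m - u n) (u m - u n) <= e%:C) ->
    exists l : V, forall e : R, 0 < e -> exists N : nat, forall n : nat,
       (N <= n)%N -> dotv (u n - l) (u n - l) <= e%:C
}.

HB.builders Context R V & Lmodule_isHilbert R V.

HB.instance Definition _ := @Lmodule_isNormed.Build R[i] V
  (fun x => sqrtC (dotv x x))
  (inner_product_normD dotvDl dotvZl dotvC dotv_ge0 dotv_eq0)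
  (inner_product_normZ dotvZl dotvC dotv_ge0)
  (inner_product_norm_eq0 dotv_eq0).

Let normE (x : V) : `|x| ^+ 2 = dotv x x. Proof. exact: sqrtCK. Qed.

Let V_complete (F : set_system V) : ProperFilter F -> cauchy F -> cvg F.
Proof.
move=> FF Fc.
have cex n : exists x : V, F (ball x (n.+1%:R^-1 : R[i])).
  have /cauchyP := Fc => /(_ (n.+1%:R^-1)).
  by apply; rewrite invr_gt0 ltr0n.
have [u uF] := choice cex.
have near_u m n : `|u m - u n| < m.+1%:R^-1 + n.+1%:R^-1 :> R[i].
  have [z []] := @filter_ex _ F FF _ (filterI (uF m) (uF n)).
  rewrite -!ball_normE /= => um un.
  rewrite (_ : u m - u n = (u m - z) - (u n - z)); last first.
    by rewrite opprB addrA subrK.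
  by rewrite (le_lt_trans (ler_normB _ _))// ltrD.
have smalln (e : R) : 0 < e -> exists N : nat, forall n, (N <= n)%N -> n.+1%:R^-1 < e.
  move=> e0; exists (Num.bound e^-1) => n Nn.
  have eb : e^-1 < (Num.bound e^-1)%:R by rewrite archi_boundP// invr_ge0 ltW.
  have bn : (Num.bound e^-1)%:R <= n.+1%:R :> R by rewrite ler_nat (leq_trans Nn).
  by rewrite invf_plt ?posrE// (lt_le_trans eb bn).
have castV n : (n.+1%:R^-1 : R[i]) = (n.+1%:R^-1)%:C.
  by rewrite fmorphV /= rmorph_nat.
have [l lP] : exists l : V, forall e : R, 0 < e -> exists N : nat, forall n : nat,
       (N <= n)%N -> dotv (u n - l) (u n - l) <= e%:C.
  apply: dotv_complete => e e0.
  have s0 : 0 < Num.sqrt e / 2 by rewrite divr_gt0// sqrtr_gt0.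
  have [N NP] := smalln _ s0; exists N => m n Nm Nn.
  rewrite -normE.
  have -> : e%:C = ((Num.sqrt e / 2)%:C + (Num.sqrt e / 2)%:C) ^+ 2.
    by rewrite -rmorphD /= -splitr -rmorphXn /= sqr_sqrtr// ltW.
  rewrite ler_pXn2r// ?nnegrE ?addr_ge0// ?lecR ?ltW//.
  by rewrite (lt_trans (near_u _ _))// !castV ltrD// ltcR NP.
apply/cvg_ex; exists l; apply/cvgrPdist_lt => /= eps eps0.
have epsE : eps = (complex.Re eps)%:C.
  by move: eps0; case: eps => a b; rewrite ltcE /= => /andP[/eqP -> _].
have e0 : 0 < complex.Re eps by move: eps0; rewrite epsE ltcR.
have h0 : 0 < complex.Re eps / 2 by rewrite divr_gt0.
have [N1 N1P] := smalln _ h0.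
have [N2 N2P] := lP _ (exprn_gt0 2 (divr_gt0 h0 (ltr0Sn R 1))).
pose n := maxn N1 N2.
have ul : `|u n - l| < (complex.Re eps / 2)%:C.
  rewrite -(@ltr_pXn2r _ 2)// ?nnegrE// ?lecR ?ltW// normE -rmorphXn/=.
  apply: (le_lt_trans (N2P n (leq_maxr _ _))).
  rewrite ltcR ltr_pXn2r// ?nnegrE ?ltW ?divr_gt0//.
  by rewrite gtr_pMr// invf_lt1// ltr1n.
apply: filterS (uF n) => z; rewrite -ball_normE /= => uz.
rewrite (_ : l - z = (u n - z) - (u n - l)); last first.
  by rewrite opprB [RHS]addrC subrKA.
rewrite (le_lt_trans (ler_normB _ _))// epsE [complex.Re eps]splitr rmorphD /= ltrD//.
by rewrite (lt_trans uz)// castV ltcR N1P// leq_maxl.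
Qed.

HB.instance Definition _ := Uniform_isComplete.Build V V_complete.

HB.instance Definition _ := NormedModule_isHilbert.Build R V
  dotvDl dotvZl dotvC normE.

HB.end.

(* Finiteness of the point masses follows from sigma-finiteness. *)
Record discrete_measure d (T : measurableType d) (R : realType) :=
  DiscreteMeasure {
    discrete_measure_fun :> {sigma_finite_measure set T -> \bar R};
    discrete_measure_all : forall A : set T, measurable A;
    discrete_measure_gt0 : forall x : T, (0 < discrete_measure_fun [set x])%E
  }.

Section L2_space.
Context d (T : measurableType d) (R : realType) (mu : discrete_measure T R).

(* Every function is measurable and no nonempty set is negligible, so L2 needs
   neither a measurability requirement nor a quotient. *)
Definition square_integrable : {pred T -> R[i]} :=
  [pred f : T -> R[i] | (\int[mu]_x ((Normc.normc (f x)) ^+ 2)%:E < +oo)%E].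

Record L2 := MkL2 { L2_fun :> T -> R[i]; _ : L2_fun \in square_integrable }.

HB.instance Definition _ := [isSub for L2_fun].
HB.instance Definition _ := [Choice of L2 by <:].

Let sqr_normcE (z : R[i]) : (Normc.normc z) ^+ 2 = complex.Re z ^+ 2 + complex.Im z ^+ 2.
Proof. by case: z => a b; rewrite /Normc.normc sqr_sqrtr ?addr_ge0 ?sqr_ge0. Qed.

Let measurable_any d' (T' : measurableType d') (D : set T) (g : T -> T') :
  measurable_fun D g.
Proof. by move=> _ Y _; exact: discrete_measure_all mu _. Qed.

Let sqi_integrable (f : T -> R[i]) : f \in square_integrable ->
  mu.-integrable setT (EFin \o (fun x => (Normc.normc (f x)) ^+ 2)).
Proof.
rewrite inE => fi; apply/integrableP; split; first exact: measurable_any.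
rewrite (eq_integral (fun x => ((Normc.normc (f x)) ^+ 2)%:E))// => x _ /=.
by rewrite ger0_norm// sqr_ge0.
Qed.

Let integrable_sqi (f : T -> R[i]) :
  mu.-integrable setT (EFin \o (fun x => (Normc.normc (f x)) ^+ 2)) ->
  f \in square_integrable.
Proof.
move=> /integrableP[_]; rewrite inE.
rewrite (eq_integral (fun x => ((Normc.normc (f x)) ^+ 2)%:E))// => x _ /=.
by rewrite ger0_norm// sqr_ge0.
Qed.

Let dominated (h : T -> R) (f g : T -> R[i]) (c : R) : 
  f \in square_integrable -> g \in square_integrable ->
  (forall x, `|h x| <= c * ((Normc.normc (f x)) ^+ 2 + (Normc.normc (g x)) ^+ 2)) ->
  mu.-integrable setT (EFin \o h).
Proof.
move=> /sqi_integrable fi /sqi_integrable gi hle.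
have := integrableZl measurableT c (integrableD measurableT fi gi).
apply: le_integrable => //; first exact: measurable_any.
move=> x _; rewrite /= lee_fin (le_trans (hle x))// ler_norm//.
Qed.

Let square_integrable_submod : submod_closed square_integrable.
Proof.
split.
  rewrite inE integral0_eq ?ltry// => x _ /=.
  by rewrite -[LHS]/((Normc.normc (0 : R[i]) ^+ 2)%:E) Normc.normc0 expr0n.
move=> a f g fi gi; apply: integrable_sqi.
apply: (dominated (c := 2 * (1 + (Normc.normc a) ^+ 2)) fi gi) => x /=.
rewrite ger0_norm ?sqr_ge0// fctE /= -[(a *: f) x]/(a * f x).
rewrite !sqr_normcE.
case: a (f x) (g x) => [a1 a2] [f1 f2] [g1 g2] /=.
rewrite -subr_ge0 [X in 0 <= X](_ : _ =
  (a1 * f1 - a2 * f2 - g1) ^+ 2 + (a1 * f2 + a2 * f1 - g2) ^+ 2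
  + 2 * (f1 ^+ 2 + f2 ^+ 2) + 2 * (a1 ^+ 2 + a2 ^+ 2) * (g1 ^+ 2 + g2 ^+ 2));
  last by ring.
by do !(apply: sqr_ge0 || apply: addr_ge0 || apply: mulr_ge0 || apply: ler0n).
Qed.

HB.instance Definition _ :=
  GRing.isSubmodClosed.Build R[i] (T -> R[i]) square_integrable
    square_integrable_submod.
HB.instance Definition _ := [SubChoice_isSubLmodule of L2 by <:].

Definition L2_dot (f g : L2) : R[i] :=
  (\int[mu]_x complex.Re (f x * (g x)^*%R))
    +i* (\int[mu]_x complex.Im (f x * (g x)^*%R)).

Let L2P (f : L2) : (f : T -> R[i]) \in square_integrable. Proof. exact: valP. Qed.

Let dotRe (z w : R[i]) : complex.Re (z * w^*%R) =
  complex.Re z * complex.Re w + complex.Im z * complex.Im w.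
Proof. by case: z w => a b [c e]; rewrite -[_^*%R]/(c -i* e) /= mulrN opprK. Qed.

Let dotIm (z w : R[i]) : complex.Im (z * w^*%R) =
  complex.Im z * complex.Re w - complex.Re z * complex.Im w.
Proof. by case: z w => a b [c e]; rewrite -[_^*%R]/(c -i* e) /= mulrN addrC. Qed.

Let integrable_Re (f g : L2) :
  mu.-integrable setT (EFin \o (fun x => complex.Re (f x * (g x)^*%R))).
Proof.
apply: (dominated (c := 1) (L2P f) (L2P g)) => x.
rewrite mul1r !sqr_normcE dotRe ler_norml.
case: (f x) (g x) => [a b] [c e] /=.
have := sqr_ge0 (a - c); have := sqr_ge0 (b - e).
have := sqr_ge0 (a + c); have := sqr_ge0 (b + e).
have := sqr_ge0 a; have := sqr_ge0 b; have := sqr_ge0 c; have := sqr_ge0 e.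
by move=> *; apply/andP; split; nra.
Qed.

Let integrable_Im (f g : L2) :
  mu.-integrable setT (EFin \o (fun x => complex.Im (f x * (g x)^*%R))).
Proof.
apply: (dominated (c := 1) (L2P f) (L2P g)) => x.
rewrite mul1r !sqr_normcE dotIm ler_norml.
case: (f x) (g x) => [a b] [c e] /=.
have := sqr_ge0 (b - c); have := sqr_ge0 (a - e).
have := sqr_ge0 (b + c); have := sqr_ge0 (a + e).
have := sqr_ge0 a; have := sqr_ge0 b; have := sqr_ge0 c; have := sqr_ge0 e.
by move=> *; apply/andP; split; nra.
Qed.

Let L2_dotDl f g h : L2_dot (f + g) h = L2_dot f h + L2_dot g h.
Proof.
rewrite /L2_dot; simpc; congr (_ +i* _).
  rewrite -RintegralD//; apply: eq_Rintegral => x _.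
  by rewrite -[(f + g) x]/(f x + g x) !dotRe raddfD /= raddfD /=; ring.
rewrite -RintegralD//; apply: eq_Rintegral => x _.
by rewrite -[(f + g) x]/(f x + g x) !dotIm raddfD /= raddfD /=; ring.
Qed.

Let L2_dotZl a f g : L2_dot (a *: f) g = a * L2_dot f g.
Proof.
case: a => a b; rewrite /L2_dot; simpc; congr (_ +i* _).
  rewrite -!RintegralZl// -RintegralB//; last 2 first.
  - exact: (integrableZl measurableT a (integrable_Re f g)).
  - exact: (integrableZl measurableT b (integrable_Im f g)).
  apply: eq_Rintegral => x _.
  rewrite -[(_ *: f) x]/((a +i* b) * f x) !dotRe !dotIm.
  by case: (f x) => c e /=; ring.
rewrite -!RintegralZl// -RintegralD//; last 2 first.
- exact: (integrableZl measurableT a (integrable_Im f g)).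
- exact: (integrableZl measurableT b (integrable_Re f g)).
apply: eq_Rintegral => x _.
rewrite -[(_ *: f) x]/((a +i* b) * f x) !dotRe !dotIm.
by case: (f x) => c e /=; ring.
Qed.

Let L2_dotC f g : L2_dot g f = (L2_dot f g)^*%R.
Proof.
rewrite /L2_dot -[RHS]/(_ +i* - _); congr (_ +i* _).
  by apply: eq_Rintegral => x _; rewrite !dotRe; ring.
rewrite -[RHS]mulN1r -RintegralZl//.
by apply: eq_Rintegral => x _; rewrite !dotIm; ring.
Qed.

Let L2_dotE f : L2_dot f f = (\int[mu]_x (Normc.normc (f x)) ^+ 2)%:C.
Proof.
rewrite /L2_dot; congr (_ +i* _).
  by apply: eq_Rintegral => x _; rewrite dotRe sqr_normcE !expr2.
rewrite (@eq_Rintegral _ _ _ _ _ (cst 0)) ?Rintegral_cst ?mul0r// => x _.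
by rewrite dotIm mulrC subrr.
Qed.

Let L2_dot_ge0 f : 0 <= L2_dot f f.
Proof. by rewrite L2_dotE lecR Rintegral_ge0// => x _; rewrite sqr_ge0. Qed.

Let L2_dotEFin (f : L2) : (\int[mu]_x ((Normc.normc (f x)) ^+ 2)%:E
  = (complex.Re (L2_dot f f))%:E)%E.
Proof.
rewrite L2_dotE /= fineK//.
exact: (integrable_fin_num measurableT (sqi_integrable (L2P f))).
Qed.

Let weight x : exists2 c : R, 0 < c & forall f : L2,
  (Normc.normc (f x)) ^+ 2 * c <= complex.Re (L2_dot f f).
Proof.
have [c c0 cle] : exists2 c : R, 0 < c & (c%:E <= mu [set x])%E.
  have := discrete_measure_gt0 mu x.
  case: (discrete_measure_fun mu [set x]) => [r||] //= r0; last first.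
    by exists 1 => //; rewrite leey.
  by exists r.
exists c => // f; rewrite -lee_fin -L2_dotEFin EFinM.
apply: (@le_trans _ _ (((Normc.normc (f x)) ^+ 2)%:E * mu [set x])%E).
  by rewrite lee_wpmul2l// lee_fin sqr_ge0.
rewrite -integral_cst; last exact: discrete_measure_all mu _.
rewrite (eq_integral (fun y => ((Normc.normc (f y)) ^+ 2)%:E)); last first.
  by move=> y; rewrite inE /= => ->.
apply: ge0_subset_integral => //; first exact: discrete_measure_all mu _.
- exact: measurable_any.
- by move=> y _; rewrite lee_fin sqr_ge0.
Qed.

Let L2_dot_eq0 (f : L2) : L2_dot f f = 0 -> f = 0.
Proof.
move=> f0; apply/val_inj/funext => x.
have [c c0 /(_ f)] := weight x.
rewrite f0 /= pmulr_lle0// => fx0.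
apply/Normc.eq0_normc/eqP; rewrite -sqrf_eq0; apply/eqP/le_anti.
by rewrite fx0 sqr_ge0.
Qed.

Let cauchy_real (r : nat -> R) :
  (forall e, 0 < e -> exists N : nat, forall n : nat,
     (N <= n)%N -> `|r N - r n| <= e) -> cvgn r.
Proof.
move=> rc; apply/cauchy_cvgP/cauchy_exP => /= e e0.
have [N NP] := rc (e / 2) (divr_gt0 e0 (ltr0Sn R 1)).
exists (r N), N => // n /= Nn; rewrite -ball_normE /=.
by rewrite (le_lt_trans (NP _ Nn))// gtr_pMr// invf_lt1// ltr1n.
Qed.

Let L2_dot_complete (u : nat -> L2) :
  (forall e : R, 0 < e -> exists N : nat, forall m n : nat,
     (N <= m)%N -> (N <= n)%N -> L2_dot (u m - u n) (u m - u n) <= e%:C) ->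
  exists l : L2, forall e : R, 0 < e -> exists N : nat, forall n : nat,
     (N <= n)%N -> L2_dot (u n - l) (u n - l) <= e%:C.
Proof.
move=> uc.
have dotC_le (f : L2) (e : R) :
    (L2_dot f f <= e%:C) = (complex.Re (L2_dot f f) <= e).
  by rewrite L2_dotE lecR.
have pointwise x (e : R) : 0 < e -> exists N : nat, forall n : nat,
    (N <= n)%N -> Normc.normc (u N x - u n x) ^+ 2 <= e ^+ 2.
  move=> e0; have [c c0 cP] := weight x.
  have [N NP] := uc _ (mulr_gt0 (exprn_gt0 2 e0) c0).
  exists N => n Nn; rewrite -(ler_pM2r c0).
  rewrite (le_trans (cP (u N - u n)))// -dotC_le.
  exact: NP.
have cvg_re x : cvgn (fun n => complex.Re (u n x)).
  apply: cauchy_real => e e0; have [N NP] := pointwise x e e0.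
  exists N => n /NP; rewrite sqr_normcE -!raddfB /= => le2.
  rewrite -(@ler_pXn2r _ 2)// ?nnegrE ?(ltW e0)// -normrX ger0_norm ?sqr_ge0//.
  by rewrite (le_trans _ le2)// lerDl sqr_ge0.
have cvg_im x : cvgn (fun n => complex.Im (u n x)).
  apply: cauchy_real => e e0; have [N NP] := pointwise x e e0.
  exists N => n /NP; rewrite sqr_normcE -!raddfB /= => le2.
  rewrite -(@ler_pXn2r _ 2)// ?nnegrE ?(ltW e0)// -normrX ger0_norm ?sqr_ge0//.
  by rewrite (le_trans _ le2)// lerDr sqr_ge0.
pose l x := limn (fun n => complex.Re (u n x))
  +i* limn (fun n => complex.Im (u n x)).
have ul n x : (fun m => (Normc.normc (u n x - u m x) ^+ 2)%:E) @ \oo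
    --> (Normc.normc (u n x - l x) ^+ 2)%:E.
  apply: cvg_EFin; first exact: nearW.
  rewrite (_ : fine \o _ = fun m =>
      (complex.Re (u n x) - complex.Re (u m x)) ^+ 2
      + (complex.Im (u n x) - complex.Im (u m x)) ^+ 2); last first.
    by apply/funext => m /=; rewrite sqr_normcE !raddfB.
  rewrite sqr_normcE !raddfB /=.
  apply: cvgD; rewrite expr2; under eq_fun do rewrite expr2;
    by apply: cvgM; apply: cvgB => //; exact: cvg_cst.
have main e : 0 < e -> exists N : nat, forall n : nat, (N <= n)%N ->
    (\int[mu]_x ((Normc.normc (u n x - l x)) ^+ 2)%:E <= e%:E)%E.
  move=> e0; have [N NP] := uc _ e0; exists N => n Nn.
  rewrite (eq_integral (fun x =>
    limn_einf (fun m => (Normc.normc (u n x - u m x) ^+ 2)%:E))); last first.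
    by move=> x _; rewrite (cvg_limn_einf_sup (ul n x)).1.
  apply: (le_trans (fatou mu measurableT _ _)).
  - by move=> m; exact: measurable_any.
  - by move=> m x _; rewrite lee_fin sqr_ge0.
  rewrite limn_einf_lim; apply: lime_le; first exact: is_cvg_einfs.
  apply: nearW => m.
  apply: (@le_trans _ _ (\int[mu]_x (Normc.normc (u n x - u (maxn m N) x) ^+ 2)%:E)%E).
    by apply: ereal_inf_lbound; exists (maxn m N) => //=; exact: leq_maxl.
  have := L2_dotEFin (u n - u (maxn m N)) => ->.
  by rewrite lee_fin -dotC_le; apply: NP => //; exact: leq_maxr.
have lL2 : l \in square_integrable.
  have [N NP] := main 1 ltr01.
  have dL2 : (u N : T -> R[i]) - l \in square_integrable.
    by rewrite inE; apply: le_lt_trans (NP N (leqnn N)) _; rewrite ltry.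
  by rewrite -(subKr (u N : T -> R[i]) l) rpredB// L2P.
exists (MkL2 lL2) => e e0; have [N NP] := main e e0.
exists N => n /NP nle.
by rewrite dotC_le -lee_fin -L2_dotEFin.
Qed.

HB.instance Definition _ := Lmodule_isHilbert.Build R L2
  L2_dotDl L2_dotZl L2_dotC L2_dot_ge0 L2_dot_eq0 L2_dot_complete.

End L2_space.

(* A partially defined linear operator is represented by its graph, so that
   [A (f, g)] reads "f is in the domain of A and A f = g". *)
Section operators.
Context (R : realType) (H : hilbertType R).

Record linop := LinOp {
  graph : set (H * H);
  graph0 : graph (0, 0);
  graph_linear : forall (a : R[i]) (p q : H * H),
    graph p -> graph q -> graph (a *: p.1 + q.1, a *: p.2 + q.2);
  graph_functional : forall f g h : H, graph (f, g) -> graph (f, h) -> g = h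
}.

Definition dom (A : set (H * H)) : set H := [set f | exists g, A (f, g)].

Definition opow (A : set (H * H)) (n : nat) : set (H * H) :=
  iter n (fun B => (A \; B)%relation) [set p | p.1 = p.2].

Definition dom_infty (A : set (H * H)) : set H := \bigcap_n dom (opow A n).

(* It is the graph of an operator exactly when [dom A] is dense. *)
Definition adjoint (A : set (H * H)) : set (H * H) :=
  [set p | forall q, A q -> dotv q.2 p.1 = dotv q.1 p.2].

Definition normal_op (N : linop) : Prop :=
  [/\ dense (dom (graph N)), closed (graph N) &
      (adjoint (graph N) \; graph N = graph N \; adjoint (graph N))%relation].

End operators.

Definition subnormal (R : realType) (H : hilbertType R) (A : linop H) : Prop :=
  dense (dom (graph A)) /\
  exists (K : hilbertType R) (J : {linear H -> K}) (N : linop K),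
    [/\ forall f, `|J f| = `|f|, normal_op N &
        forall f g, graph A (f, g) -> graph N (J f, J g)].

Section composition_operator.
Context d (T : measurableType d) (R : realType) (mu : discrete_measure T R).
Variable phi : T -> T.

Definition composition_graph : set (L2 mu * L2 mu) :=
  [set p | L2_fun p.2 = L2_fun p.1 \o phi].

Let composition_graph0 : composition_graph (0, 0).
Proof. by []. Qed.

Let composition_graph_linear (a : R[i]) (p q : L2 mu * L2 mu) :
  composition_graph p -> composition_graph q ->
  composition_graph (a *: p.1 + q.1, a *: p.2 + q.2).
Proof.
rewrite /composition_graph /= => pE qE; apply/funext => x /=.
rewrite -[LHS]/(a * p.2 x + q.2 x) -[RHS]/(a * p.1 (phi x) + q.1 (phi x)).
by rewrite pE qE.
Qed.

Let composition_graph_functional (f g h : L2 mu) :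
  composition_graph (f, g) -> composition_graph (f, h) -> g = h.
Proof. by rewrite /composition_graph /= => gE hE; apply/val_inj; rewrite /= gE hE. Qed.

Definition composition_op : linop (L2 mu) :=
  LinOp composition_graph0 composition_graph_linear composition_graph_functional.

Definition radon_nikodym_pow (n : nat) (x : T) : \bar R :=
  (mu (iter n phi @^-1` [set x]) / mu [set x])%E.

Definition consistency_condition (P : T -> probability R R) : Prop :=
  forall x, range phi x -> forall s : set R, measurable s -> s `<=` `[0, +oo[ ->
  ((\esum_(y in phi @^-1` [set x]) (mu [set y] * P y s)) / mu [set x]
    = \int[P x]_(t in s) t%:E)%E.

End composition_operator.

Section Stieltjes.
Context (R : realType).

(* A Borel measure on [0, +oo[ is a Borel measure on the line that is carried
   by [0, +oo[. *)
Definition S_representing (nu : {measure set R -> \bar R}) (gamma : nat -> R) : Prop :=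
  nu `]-oo, 0[%classic = 0%E /\
  forall n, nu.-integrable `[0, +oo[ (fun t => (t ^+ n)%:E) /\
    (\int[nu]_(t in `[0%R, +oo[) (t ^+ n)%:E = (gamma n)%:E)%E.

Definition Stieltjes_moment_sequence (gamma : nat -> R) : Prop :=
  exists nu : {measure set R -> \bar R}, S_representing nu gamma.

End Stieltjes.

(* [xtrunk r] is x_r and [xbranch j] is x_{1,j+1}. *)
Inductive X1 (kappa : nat) : Type := xtrunk of 'I_kappa.+1 | xbranch of nat.
Arguments xtrunk {kappa}.
Arguments xbranch {kappa}.

Section X1_instances.
Context (kappa : nat).

Definition X1_sum (x : X1 kappa) : 'I_kappa.+1 + nat :=
  match x with xtrunk r => inl r | xbranch j => inr j end.

Definition sum_X1 (s : 'I_kappa.+1 + nat) : X1 kappa :=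
  match s with inl r => xtrunk r | inr j => xbranch j end.

Lemma X1_sumK : cancel X1_sum sum_X1. Proof. by case. Qed.

HB.instance Definition _ := Countable.copy (X1 kappa) (can_type X1_sumK).
HB.instance Definition _ := isPointed.Build (X1 kappa) (xtrunk ord0).
HB.instance Definition _ := @isMeasurable.Build default_measure_display
  (X1 kappa) discrete_measurable discrete_measurable0
  discrete_measurableC discrete_measurableU.

End X1_instances.

Definition phi1 (kappa : nat) (x : X1 kappa) : X1 kappa :=
  match x with
  | xbranch j.+1 => xbranch j
  | xbranch 0 => xtrunk ord_max
  | xtrunk r => if r == ord0 then xtrunk ord_max else xtrunk (inord r.-1)
  end.

(* Main.v *)
Require Import Defs.
From HB Require Import structures.
From mathcomp Require Import all_boot all_order all_algebra.
From mathcomp Require Import all_classical all_reals all_analysis measurable_realfun.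
From mathcomp Require Import complex ring lra.

Set Implicit Arguments.
Unset Strict Implicit.
Unset Printing Implicit Defensive.

Import Order.TTheory GRing.Theory Num.Theory.
Import numFieldNormedType.Exports.

Local Open Scope classical_set_scope.
Local Open Scope ring_scope.
Local Open Scope complex_scope.

(** The set [X1 kappa] is a cycle of [L = kappa + 1] points, the trunk, with an
    infinite branch attached to it, and the symbol moves each point one step
    towards or around the cycle. All fibres of its iterates are finite and
    nonempty, so the Radon-Nikodym derivatives are positive and finite, and
    finitely supported functions are smooth vectors
    ([composition_dom_infty_dense]).

    Conditions (i) and (ii). The consistency condition says that the sum of
    [mu y * P y] over the fibre of [x] has density [mu x * t] with respect to
    [P x]. Iterating it shows that the moments of [P x] are the numbers
    [h n x] ([consistency_moment]), and going once around the cycle from the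
    root shows that [t^L P] dominates [P] at the root, whence [P] has no mass
    on [0, 1[ ([consistency_vanish]). Conversely, if [rho] represents the
    moments of the root and vanishes on [0, 1[, the measures with densities
    proportional to [t^r] on the trunk and [t^j (t^L - 1)] on the branch are
    consistent; these densities are nonnegative because [t >= 1], and have the
    right mass by the moments of [rho] ([weight_integral],
    [measure_consistency]).

    Conditions (ii) and (iii). For a measure on [1, +oo[ the inequalities of (iii)
    are those between the integrals of 0, [|p|^2] and [t |p|^2]. Conversely (iii)
    says that the moment functional, translated by 1, is nonnegative on the
    polynomials [q^2] and [X q^2]. Every polynomial that is nonnegative
    on the half-line is a sum of such ones ([sos_halflineP]), so the
    translated functional is positive and is represented by a measure by the
    theorem of Stieltjes ([Stieltjes_existence]). That theorem is proved here
    by extending the functional to the indicator functions of half-lines by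
    the Hahn-Banach theorem ([positive_functional_extension]), which yields a
    distribution function, and by comparing powers with staircases.

    Subnormality. The symbol is lifted to a bijection of its backward orbits,
    which form a cycle and a two-sided infinite line. Over each of these sheets
    lies a copy of the line with the measure [rho], and [f] is sent to
    [w (y, t) * f (point y)], where the squares of the weights [w] over a point [x]
    add up to the density of the consistent measure at [x], so that the map is
    isometric. The weights decrease by the factor [sqrt t] along the lifted
    symbol, so the map intertwines the composition operator with the operator
    [g |-> sqrt t * (g \o flow)]. This one is normal, since its adjoint is given by
    the inverse flow with the same weight ([weighted_op_normal]). *)


(** * Nonnegative polynomials on the half-line *)

Inductive sos_halfline (R : realType) : {poly R} -> Prop :=
| sos_sqr q : sos_halfline (q ^+ 2)
| sos_Xsqr q : sos_halfline ('X * q ^+ 2)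
| sos_add p q : sos_halfline p -> sos_halfline q -> sos_halfline (p + q).

(** The only product that is not already of one of the two square shapes is
    that of two polynomials of the form [X q^2], where the square of [X] is
    absorbed into the square. *)
Lemma sos_halflineM (R : realType) (p q : {poly R}) :
  sos_halfline p -> sos_halfline q -> sos_halfline (p * q).
Proof.
move=> + sq; elim=> {p} [p|p|p1 p2 _ s1 _ s2]; last first.
- by rewrite mulrDl; exact: sos_add.
- elim: sq => {q} [q|q|q1 q2 _ s1 _ s2]; last by rewrite mulrDr; exact: sos_add.
  + rewrite (_ : _ * _ = 'X * (p * q) ^+ 2); [exact: sos_Xsqr|ring].
  + rewrite (_ : _ * _ = ('X * p * q) ^+ 2); [exact: sos_sqr|ring].
- elim: sq => {q} [q|q|q1 q2 _ s1 _ s2]; last by rewrite mulrDr; exact: sos_add.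
  + rewrite (_ : _ * _ = (p * q) ^+ 2); [exact: sos_sqr|ring].
  + rewrite (_ : _ * _ = 'X * (p * q) ^+ 2); [exact: sos_Xsqr|ring].
Qed.

Lemma horner_lt0_near (R : realType) (q : {poly R}) (a : R) :
  q.[a] < 0 -> exists2 e : R, 0 < e & forall t, `|t - a| < e -> q.[t] < 0.
Proof.
move=> qa; have qc : {for a, continuous (horner q)} by exact: continuous_horner.
have : \forall t \near a, q.[t] < 0 by exact: (cvgr_lt _ qc).
move=> /nbhs_ballP[e /= e0 he]; exists e => // t ta; apply: he.
by rewrite /ball /= distrC.
Qed.

(** If [q] were negative at [a] it would be negative at a nearby point to the
    right of [a], which is another point of the half-line. *)
Lemma horner_ge0_punctured (R : realType) (q : {poly R}) (a : R) :
  (forall t, 0 <= t -> t != a -> 0 <= q.[t]) -> forall t, 0 <= t -> 0 <= q.[t].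
Proof.
move=> q0 t t0; have [ta|] := eqVneq t a; last exact: q0.
rewrite leNgt; apply/negP => /horner_lt0_near[e e0 he].
have := he (t + e / 2); rewrite addrAC subrr add0r ger0_norm ?divr_ge0 ?ltW//.
rewrite ltr_pdivrMr// ltr_pMr// ltr1n => /(_ isT).
have e2 : 0 < e / 2 by rewrite divr_gt0.
rewrite ltNge q0 ?addr_ge0 ?(ltW e2)//.
by rewrite -subr_eq0 -ta addrAC subrr add0r gt_eqF.
Qed.

Lemma horner_sign_change (R : realType) (q : {poly R}) (a : R) : 0 < a ->
  (forall t, 0 <= t -> 0 <= q.[t] * (t - a)) -> q.[a] = 0.
Proof.
move=> a0 qa; apply/eqP; rewrite eq_le !leNgt; apply/andP; split; apply/negP.
- rewrite -oppr_lt0 -hornerN => /horner_lt0_near[e e0 he].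
  pose d := Num.min (e / 2) a.
  have d0 : 0 < d by rewrite lt_min divr_gt0.
  have da : d <= a by rewrite ge_min lexx orbT.
  have de : d < e by rewrite gt_min ltr_pdivrMr// ltr_pMr// ltr1n.
  have := he (a - d); rewrite addrAC subrr add0r normrN gtr0_norm// => /(_ de).
  rewrite hornerN oppr_lt0; have := qa (a - d); rewrite subr_ge0 => /(_ da).
  by rewrite addrAC subrr add0r mulrN oppr_ge0 pmulr_lle0// leNgt => /negbTE ->.
- move=> /horner_lt0_near[e e0 he].
  have := he (a + e / 2); rewrite addrAC subrr add0r gtr0_norm ?divr_gt0//.
  rewrite ltr_pdivrMr// ltr_pMr// ltr1n => /(_ isT).
  have e2 : 0 < e / 2 by rewrite divr_gt0.
  have := qa (a + e / 2); rewrite addr_ge0 ?(ltW e2) ?(ltW a0)// => /(_ isT).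
  by rewrite addrAC subrr add0r pmulr_lge0 ?divr_gt0// leNgt => /negbTE ->.
Qed.

(** The remainder modulo the real quadratic polynomial has degree at most one,
    and a real polynomial of degree at most one that vanishes at a nonreal
    point is zero. *)
Lemma nonreal_root_dvdp (R : realType) (p : {poly R}) (a b : R) : b != 0 ->
  root (map_poly (real_complex R) p) (a +i* b) ->
  ('X - a%:P) ^+ 2 + (b ^+ 2)%:P %| p.
Proof.
move=> b0; set d := _ + _ => /rootP pz.
have sd : size d = 3%N.
  rewrite size_polyDl; first by rewrite size_exp_XsubC.
  by rewrite size_exp_XsubC (leq_ltn_trans (size_polyC_leq1 _)).
have dz : (map_poly (real_complex R) d).[a +i* b] = 0.
  rewrite /d rmorphD /= rmorphXn /= map_polyXsubC map_polyC /= !hornerE.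
  by apply/eqP; rewrite eq_complex /= !expr2 /=; apply/andP; split; apply/eqP; ring.
have d0 : d != 0 by rewrite -size_poly_gt0 sd.
rewrite /dvdp -size_poly_eq0 -leqn0.
have : (size (p %% d)%R <= 2)%N by rewrite -ltnS -sd ltn_modp.
move: pz; rewrite {1}(divp_eq p d) rmorphD rmorphM /= hornerD hornerM dz mulr0 add0r.
set r := p %% d => rz sr.
have rE : r = (r`_0)%:P + r`_1 *: 'X.
  apply/polyP => i; rewrite coefD coefC coefZ coefX.
  case: i => [|[|i]] /=; rewrite ?mulr0 ?addr0 ?mulr1 ?add0r//.
  by rewrite nth_default// (leq_trans sr).
move: rz; rewrite rE rmorphD /= map_polyC /= map_polyZ /= map_polyX !hornerE /=.
move/eqP; rewrite eq_complex /= !mul0r subr0 addr0 add0r => /andP[/eqP h1 /eqP h2].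
have r1 : r`_1 = 0.
  by move/eqP: h2; rewrite mulf_eq0 (negbTE b0) orbF => /eqP.
have r0 : r`_0 = 0 by move: h1; rewrite r1 mul0r addr0.
by rewrite r0 r1 scale0r addr0 size_poly0.
Qed.

(** Induction on the degree: split off one factor at a complex root. A nonreal
    root gives a factor that is a sum of two squares, a root [a <= 0] gives
    [X - a = X + (sqrt (-a))^2], and at a root [a > 0] the polynomial cannot
    change sign, so that the root is double and gives the factor [(X - a)^2].
    The cofactor is again nonnegative on the half-line. *)
Theorem sos_halflineP (R : realType) (p : {poly R}) :
  (forall t, 0 <= t -> 0 <= p.[t]) -> sos_halfline p.
Proof.
have [n] := ubnP (size p); elim: n p => // n IH p; rewrite ltnS => sp p0.
have [s1|s1] := leqP (size p) 1.
  rewrite (size1_polyC s1); have := p0 0 (lexx _).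
  rewrite {1}(size1_polyC s1) hornerC => c0.
  by rewrite -(sqr_sqrtr c0) polyC_exp; exact: sos_sqr.
have [z rz] : exists z, root (map_poly (real_complex R) p) z.
  by apply/closed_rootP; rewrite size_map_poly; case: size s1 => [|[]].
case: z rz => a b rz.
have pn0 : p != 0 by rewrite -size_poly_gt0 (ltn_trans _ s1).
have descent d q : p = q * d -> (1 < size d)%N -> sos_halfline d ->
    (forall t, 0 <= t -> 0 <= q.[t]) -> sos_halfline p.
  move=> pE sd dsos q0; rewrite pE; apply: sos_halflineM => //; apply: IH => //.
  have qn0 : q != 0 by apply: contra_neq pn0 => q00; rewrite pE q00 mul0r.
  have dn0 : d != 0 by rewrite -size_poly_gt0 (ltn_trans _ sd).
  apply: leq_trans sp; rewrite pE size_mul//.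
  rewrite -ltnS prednK ?addn_gt0 ?size_poly_gt0 ?qn0//.
  by rewrite -addn2 leq_add2l.
have [b0|b0] := eqVneq b 0; last first.
  have /dvdpP[q pE] := nonreal_root_dvdp b0 rz.
  apply: (descent _ _ pE).
  - rewrite size_polyDl; first by rewrite size_exp_XsubC.
    by rewrite size_exp_XsubC (leq_ltn_trans (size_polyC_leq1 _)).
  - by apply: sos_add; rewrite ?polyC_exp; exact: sos_sqr.
  - move=> t t0; have := p0 t t0.
    rewrite pE !hornerE pmulr_lge0// ltr_wpDl ?sqr_ge0//.
    by rewrite lt_def sqr_ge0 sqrf_eq0 b0.
have ra : root p a.
  move: rz; rewrite b0 -[a +i* 0]/(a%:C) /root horner_map /=.
  by rewrite fmorph_eq0.
have /factor_theorem[q pE] := ra.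
have [a0|a0] := leP a 0.
  apply: (descent _ _ pE); first by rewrite size_XsubC.
    rewrite (_ : 'X - _ = 'X * 1 ^+ 2 + (Num.sqrt (- a))%:P ^+ 2).
      by apply: sos_add; [exact: sos_Xsqr|exact: sos_sqr].
    by rewrite -polyC_exp sqr_sqrtr ?oppr_ge0// polyCN expr1n mulr1.
  apply: (@horner_ge0_punctured _ _ a) => t t0 ta.
  have := p0 t t0; rewrite pE !hornerE pmulr_lge0// subr_gt0 lt_neqAle eq_sym ta.
  exact: le_trans a0 t0.
have /eqP qa : q.[a] = 0.
  apply: horner_sign_change => // t t0.
  by have := p0 t t0; rewrite pE !hornerE.
have /factor_theorem[r qE] := qa.
have pE2 : p = r * ('X - a%:P) ^+ 2 by rewrite pE qE expr2 mulrA.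
apply: (descent _ _ pE2); [by rewrite size_exp_XsubC|exact: sos_sqr|].
apply: (@horner_ge0_punctured _ _ a) => t t0 ta.
have := p0 t t0; rewrite pE2 hornerM horner_exp hornerXsubC pmulr_lge0//.
by rewrite lt_def sqr_ge0 sqrf_eq0 subr_eq0 ta.
Qed.


(** * Extension of positive functionals *)

Definition sublinear (R : realType) (V : lmodType R) (p : V -> R) :=
  (forall x y, p (x + y) <= p x + p y) /\
  (forall a x, 0 <= a -> p (a *: x) = a * p x).

(** Common form of the three infima taken below: the auxiliary functional that
    shows a minimal sublinear functional to be additive, the lower bound of a
    chain, and the upper integral of a positive functional. *)
Lemma inf_sublinear (R : realType) (V : lmodType R) (S : V -> set R) :
  (forall x, S x !=set0) -> (forall x, has_lbound (S x)) ->
  (forall x y s t, S x s -> S y t -> exists2 u, S (x + y) u & u <= s + t) ->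
  (forall a x s, 0 < a -> S x s -> exists2 u, S (a *: x) u & u <= a * s) ->
  S 0 0 -> lbound (S 0) 0 ->
  sublinear (fun x => inf (S x)).
Proof.
move=> S0 Sb SD SZ S00 lb0; split=> [x y|a x].
  rewrite -lerBlDr; apply: lb_le_inf => // s Ss.
  rewrite lerBlDr -lerBlDl; apply: lb_le_inf => // t St.
  have [u Su us] := SD _ _ _ _ Ss St.
  by rewrite lerBlDl; apply: le_trans us; exact: ge_inf.
rewrite le_eqVlt => /predU1P[<-|a0].
  rewrite scale0r mul0r; apply/eqP; rewrite eq_le; apply/andP; split.
    exact: ge_inf.
  exact: lb_le_inf.
apply/eqP; rewrite eq_le; apply/andP; split.
  rewrite -ler_pdivrMl//; apply: lb_le_inf => // s Ss.
  rewrite ler_pdivrMl//; have [u Su us] := SZ _ _ _ a0 Ss.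
  by apply: le_trans us; exact: ge_inf.
apply: lb_le_inf => // s Ss; rewrite -ler_pdivlMl//.
have ai : 0 < a^-1 by rewrite invr_gt0.
have [u + us] := SZ _ _ _ ai Ss; rewrite scalerA mulVf ?gt_eqF// scale1r => Su.
by apply: le_trans us; exact: ge_inf.
Qed.

Lemma sublinear0 (R : realType) (V : lmodType R) (p : V -> R) :
  sublinear p -> p 0 = 0.
Proof. by move=> [_ pZ]; rewrite -(scale0r 0) pZ// mul0r. Qed.

Lemma sublinearN (R : realType) (V : lmodType R) (p : V -> R) x :
  sublinear p -> - p (- x) <= p x.
Proof.
move=> psub; have [pD _] := psub.
by rewrite -subr_ge0 opprK -(sublinear0 psub) -(subrr x) pD.
Qed.

(** The infimum over [t >= 0] of [q (z + t y) - t q y] is a sublinear functional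
    below [q]. By minimality it equals [q], and its value at [z = x] is at most
    the term for [t = 1], whence [q x <= q (x + y) - q y]. *)
Lemma minimal_sublinear_additive (R : realType) (V : lmodType R) (q : V -> R) :
  sublinear q ->
  (forall r, sublinear r -> (forall x, r x <= q x) -> r = q) ->
  forall x y, q (x + y) = q x + q y.
Proof.
move=> qsub qmin x y; have [qD qZ] := qsub.
pose S z := [set q (z + t *: y) - t * q y | t in [set t : R | 0 <= t]].
have Sb z : lbound (S z) (- q (- z)).
  move=> _ [t /= t0 <-]; rewrite lerBrDl -qZ//.
  by rewrite lerBlDr (le_trans _ (qD _ _))// addrAC subrr add0r.
have rsub : sublinear (fun z => inf (S z)).
  apply: inf_sublinear.
  - by move=> z; exists (q (z + 0 *: y) - 0 * q y), 0 => /=.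
  - by move=> z; exists (- q (- z)).
  - move=> z w _ _ [t /= t0 <-] [u /= u0 <-].
    exists (q (z + w + (t + u) *: y) - (t + u) * q y).
      by exists (t + u) => //=; rewrite addr_ge0.
    rewrite addrACA -opprD -mulrDl lerD2r scalerDl addrACA; exact: qD.
  - move=> a z _ a0 [t /= t0 <-].
    exists (q (a *: z + (a * t) *: y) - (a * t) * q y).
      by exists (a * t) => //=; rewrite mulr_ge0// ltW.
    by rewrite -scalerA -scalerDr qZ ?(ltW a0)// mulrBr mulrA.
  - by exists 0 => //=; rewrite scale0r addr0 mul0r subr0 sublinear0.
  - by have := Sb 0; rewrite oppr0 sublinear0// oppr0.
have rq z : inf (S z) <= q z.
  apply: ge_inf; first by exists (- q (- z)).
  by exists 0 => //=; rewrite scale0r addr0 mul0r subr0.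
apply/eqP; rewrite eq_le qD /= -lerBrDr.
rewrite -{1}(qmin _ rsub rq); apply: ge_inf; first by exists (- q (- x)).
by exists 1 => //=; rewrite scale1r mul1r.
Qed.

(** A minimal sublinear functional below [p] exists by Zorn's lemma, since the
    pointwise infimum of a chain is sublinear; it is additive, hence odd, hence
    linear. *)
Theorem Hahn_Banach (R : realType) (V : lmodType R) (p : V -> R) :
  sublinear p -> exists f : V -> R, [/\ forall x, f x <= p x,
    forall x y, f (x + y) = f x + f y & forall a x, f (a *: x) = a * f x].
Proof.
move=> psub.
pose T := {q : V -> R | sublinear q /\ forall x, q x <= p x}.
pose le (q r : T) := `[< forall x, sval r x <= sval q x >].
have [||||q qmin] := @Zorn T le.
- by move=> q; apply/asboolP.
- move=> q r s /asboolP qr /asboolP rs; apply/asboolP => x.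
  exact: le_trans (rs x) (qr x).
- move=> [q q1] [r r1] /asboolP /= rq /asboolP /= qr.
  by apply: eq_exist; apply/funext => x; apply/eqP; rewrite eq_le rq qr.
- move=> A Atot.
  have [[s As]|A0] := pselect (exists s, A s); last first.
    by exists (exist _ p (conj psub (fun=> lexx _))) => s As; case: A0; exists s.
  pose S x := [set sval q x | q in A].
  have Sb x : lbound (S x) (- p (- x)).
    move=> _ [[q [qsub qp]] _ <-] /=; apply: le_trans (sublinearN _ qsub).
    by rewrite lerN2.
  have rsub : sublinear (fun x => inf (S x)).
    apply: inf_sublinear.
    - by move=> x; exists (sval s x), s.
    - by move=> x; exists (- p (- x)).
    - move=> x y _ _ [q Aq <-] [r Ar <-].
      have [/asboolP qr|/asboolP rq] := Atot q r Aq Ar.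
        exists (sval r (x + y)); first by exists r.
        by case: (svalP r) => [[rD _] _]; rewrite (le_trans (rD _ _))// lerD2r.
      exists (sval q (x + y)); first by exists q.
      by case: (svalP q) => [[qD _] _]; rewrite (le_trans (qD _ _))// lerD2l.
    - move=> a x _ a0 [q Aq <-]; exists (sval q (a *: x)); first by exists q.
      by case: (svalP q) => [[_ qZ] _]; rewrite qZ// ltW.
    - by exists s => //; case: (svalP s) => /sublinear0.
    - by move=> _ [q Aq <-]; case: (svalP q) => /sublinear0 ->.
  have rp x : inf (S x) <= p x.
    apply: le_trans (_ : sval s x <= _); last by case: (svalP s) => _ /(_ x).
    by apply: ge_inf; [exists (- p (- x))|exists s].
  exists (exist _ (fun x => inf (S x)) (conj rsub rp)) => q Aq; apply/asboolP => x /=.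
  by apply: ge_inf; [exists (- p (- x))|exists q].
case: q qmin => q [qsub qp] qmin.
have qD : forall x y, q (x + y) = q x + q y.
  apply: minimal_sublinear_additive => // r rsub rq.
  have rp x : r x <= p x := le_trans (rq x) (qp x).
  pose r' : T := exist _ r (conj rsub rp).
  suff r'q : r' = exist _ q (conj qsub qp) by exact: (congr1 sval r'q).
  by apply: qmin; apply/asboolP.
have qN x : q (- x) = - q x.
  apply/eqP; rewrite -subr_eq0 opprK addrC -qD subrr; apply/eqP; exact: sublinear0.
exists q; split=> // a x; have [_ qZ] := qsub.
have [a0|a0] := leP 0 a; first exact: qZ.
have := qZ (- a) x; rewrite oppr_ge0 ltW// => /(_ isT).
by rewrite scaleNr qN mulNr => /oppr_inj.
Qed.

(** Functions with a polynomial bound on the half-line: the vector space on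
    which a functional on polynomials has a finite upper integral, and that
    contains the indicator functions of the half-lines below a point. *)
Section dominated_functions.
Context (R : realType).

Definition dominated : {pred R -> R} := [pred f : R -> R |
  `[< exists q : {poly R}, forall t, 0 <= t -> `|f t| <= q.[t] >]].

Record dominated_fun := DominatedFun {
  dominated_val :> R -> R; _ : dominated_val \in dominated }.

HB.instance Definition _ := [isSub for dominated_val].
HB.instance Definition _ := [Choice of dominated_fun by <:].

Let dominated_submod : submod_closed dominated.
Proof.
split.
  by apply/asboolP; exists 0 => t _; rewrite normr0 horner0.
move=> a f g /asboolP[p hp] /asboolP[q hq]; apply/asboolP.
exists (`|a| *: p + q) => t t0; rewrite hornerD hornerZ.
by rewrite (le_trans (ler_normD _ _))// lerD ?hq// normrM ler_wpM2l// hp.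
Qed.

HB.instance Definition _ :=
  GRing.isSubmodClosed.Build R (R -> R) dominated dominated_submod.
HB.instance Definition _ := [SubChoice_isSubLmodule of dominated_fun by <:].

(* [|y| <= 1 + y^2] gives a polynomial bound for a polynomial. *)
Let horner_dominated (p : {poly R}) : horner p \in dominated.
Proof.
apply/asboolP; exists (1 + p ^+ 2) => t t0.
rewrite !hornerE ler_norml; apply/andP; split.
  have := sqr_ge0 (p.[t] + 1); have := sqr_ge0 p.[t]; lra.
have := sqr_ge0 (p.[t] - 1); have := sqr_ge0 p.[t]; lra.
Qed.

Let step_dominated (x : R) : (fun t => (t <= x)%R%:R) \in dominated.
Proof.
apply/asboolP; exists 1 => t t0.
by rewrite hornerC; case: (t <= x); rewrite ?normr1// normr0.
Qed.

Definition horner_dom p : dominated_fun := DominatedFun (horner_dominated p).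
Definition step_dom x : dominated_fun := DominatedFun (step_dominated x).

(** The upper integral, which sends [f] to the infimum of [L q] over the
    polynomials [q >= f], is sublinear; a linear functional below it extends [L]
    and is positive. The function [F] collects the values of the extension at
    the indicator functions of [t <= x]: it will be the distribution function
    of the representing measure. Only the inequalities between polynomials and
    step functions are retained of the extension. *)
Theorem positive_functional_extension (L : {scalar {poly R}}) :
  (forall p, (forall t, 0 <= t -> 0 <= p.[t]) -> 0 <= L p) ->
  exists F : R -> R, forall (p : {poly R}) (s : seq (R * R)),
    (forall t, 0 <= t -> 0 <= p.[t] + \sum_(u <- s) u.1 * (t <= u.2)%R%:R) ->
    0 <= L p + \sum_(u <- s) u.1 * F u.2.
Proof.
move=> L0.
have Lle (p q : {poly R}) :
    (forall t, 0 <= t -> p.[t] <= q.[t]) -> L p <= L q.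
  move=> pq; rewrite -subr_ge0 -linearB; apply: L0 => t t0.
  by rewrite hornerD hornerN subr_ge0 pq.
pose S (f : dominated_fun) :=
  [set L q | q in [set q : {poly R} | forall t, 0 <= t -> f t <= q.[t]]].
have Sb f : has_lbound (S f).
  have := valP f => /asboolP[r hr].
  exists (L (- r)) => _ [q /= fq <-]; apply: Lle => t t0.
  by rewrite hornerN (le_trans _ (fq t t0))// lerNl (le_trans _ (hr t t0))// ler_normr lexx orbT.
have Ssub : sublinear (fun f => inf (S f)).
  apply: inf_sublinear => //.
  - move=> f; have := valP f => /asboolP[r hr].
    by exists (L r), r => // t t0; rewrite (le_trans _ (hr t t0))// ler_norm.
  - move=> f g _ _ [p /= fp <-] [q /= gq <-]; exists (L p + L q) => //.
    exists (p + q); rewrite ?linearD// => t t0.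
    by rewrite hornerD lerD ?fp ?gq.
  - move=> a f _ a0 [p /= fp <-]; exists (a * L p) => //.
    exists (a *: p); rewrite ?linearZ// => t t0.
    by rewrite hornerZ ler_pM2l// fp.
  - by exists 0; rewrite ?linear0// => t t0; rewrite horner0.
  - by move=> _ [p /= fp <-]; apply: L0.
have [Lam [Lamp LamD LamZ]] := Hahn_Banach Ssub.
have Lam0 : Lam 0 = 0 by rewrite -(scale0r 0) LamZ mul0r.
have LamN f : Lam (- f) = - Lam f by rewrite -scaleN1r LamZ mulN1r.
have Lam_ge0 (f : dominated_fun) : (forall t, 0 <= t -> 0 <= f t) -> 0 <= Lam f.
  move=> f0; rewrite -oppr_le0 -LamN (le_trans (Lamp _))//.
  rewrite -(linear0 L); apply: ge_inf => //; exists 0 => // t t0.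
  by rewrite horner0 oppr_le0 f0.
have Lam_le p : Lam (horner_dom p) <= L p.
  by rewrite (le_trans (Lamp _))//; apply: ge_inf => //; exists p => //= t t0.
have LamL p : Lam (horner_dom p) = L p.
  apply/eqP; rewrite eq_le Lam_le /= -lerN2 -LamN -linearN.
  rewrite (_ : - _ = horner_dom (- p)) ?Lam_le//.
  by apply/val_inj/funext => t /=; rewrite hornerN.
exists (fun x => Lam (step_dom x)) => p s ps.
rewrite -LamL.
have -> : \sum_(u <- s) u.1 * Lam (step_dom u.2) =
    Lam (\sum_(u <- s) u.1 *: step_dom u.2).
  rewrite (big_morph Lam LamD Lam0); apply: eq_bigr => u _; exact/esym/LamZ.
rewrite -LamD; apply: Lam_ge0 => t t0.
have -> : (horner_dom p + \sum_(u <- s) u.1 *: step_dom u.2) t =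
  p.[t] + (\sum_(u <- s) u.1 *: step_dom u.2) t by [].
have ev : {morph (fun f : dominated_fun => f t) : x y / x + y} by [].
have ev0 : (0 : dominated_fun) t = 0 by [].
rewrite (big_morph _ ev ev0).
exact: ps.
Qed.

End dominated_functions.


(** * Probabilities with a given distribution function *)

Lemma distribution_function_probability (R : realType) (G : R -> R) :
  {homo G : x y / x <= y} -> right_continuous G ->
  G x @[x --> -oo] --> (0 : R) -> G x @[x --> +oo] --> (1 : R) ->
  exists nu : probability R R, forall x, nu `]-oo, x]%classic = (G x)%:E.
Proof.
move=> Gnd Grc GNy Gy.
pose g : cumulativeBounded (0 : R) (1 : R) := HB.pack G
  (isCumulative.Build R _ R G Gnd Grc) (isCumulativeBounded.Build R 0 1 G GNy Gy).
pose nu : probability (measurableTypeR R) R := lebesgue_stieltjes_measure g.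
pose X : {RV nu >-> R} := HB.pack (idfun : measurableTypeR R -> R)
  (isMeasurableFun.Build _ _ (measurableTypeR R) R
     (idfun : measurableTypeR R -> R) (@measurable_id _ _ setT)).
exists (distribution nu X : probability R R) => x.
exact: (cdf_lebesgue_stieltjes_id g x).
Qed.

(** [F] need not be right-continuous, so the measure is built from its right
    limits [G]; the interlacing of [F] and [G] is what is left of the relation
    between the two. The bound [C / x] on the tail forces the limit 1 at
    infinity. *)
Lemma right_limit_nondecreasing (R : realType) (F : R -> R) :
  {homo F : x y / x <= y} -> (forall x, 0 <= F x <= 1) ->
  (forall x, x < 0 -> F x = 0) ->
  (exists C, forall x, 0 < x -> 1 - F x <= C / x) ->
  exists nu : probability R R, exists2 G : R -> R,
    (forall x, nu `]-oo, x]%classic = (G x)%:E) &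
    (forall x, F x <= G x) /\ (forall x y, x < y -> G x <= F y).
Proof.
move=> Fnd F01 Fneg [C FC].
pose S x := [set F y | y in [set y | x < y]].
have Sn x : S x !=set0 by exists (F (x + 1)), (x + 1) => //=; rewrite ltrDl.
have Sb x : has_lbound (S x).
  by exists 0 => _ [y _ <-]; case/andP: (F01 y).
pose G x := inf (S x).
have FG x : F x <= G x.
  by apply: lb_le_inf => // _ [y /= xy <-]; rewrite Fnd// ltW.
have GF x y : x < y -> G x <= F y by move=> xy; apply: ge_inf => //; exists y.
have Gnd : {homo G : x y / x <= y}.
  move=> x y; rewrite le_eqVlt => /predU1P[->//|xy].
  exact: le_trans (GF _ _ xy) (FG y).
have G1 x : G x <= 1.
  have /GF/le_trans : x < x + 1 by rewrite ltrDl.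
  by apply; case/andP: (F01 (x + 1)).
have Gneg x : x < 0 -> G x = 0.
  move=> x0; apply/eqP; rewrite eq_le; apply/andP; split; last first.
    by rewrite (le_trans _ (FG x))// Fneg.
  rewrite -(Fneg (x / 2)); first by rewrite GF//; lra.
  by lra.
have Grc : right_continuous G.
  move=> x; apply/cvgrPdist_le => /= e e0.
  have [_ [y /= xy <-] Fy] := inf_adherent e0 (conj (Sn x) (Sb x)).
  near=> z.
  have xz : x < z by near: z; exact: nbhs_right_gt.
  have zy : z < y by near: z; exact: nbhs_right_lt.
  rewrite ler0_norm ?subr_le0 ?Gnd ?(ltW xz)//.
  rewrite opprB lerBlDl (le_trans (GF _ _ zy))// ltW//.
have GNy : G x @[x --> -oo] --> (0 : R).
  apply: (@cvg_trans _ ((fun=> 0 : R) x @[x --> -oo])); last exact: cvg_cst.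
  apply: near_eq_cvg; near=> x.
  have x0 : x < 0 by near: x; exact: nbhs_ninfty_lt.
  by rewrite Gneg.
have Gy : G x @[x --> +oo] --> (1 : R).
  apply/cvgrPdist_le => /= e e0; near=> x.
  have x0 : 0 < x by near: x; exact: nbhs_pinfty_gt.
  rewrite ger0_norm ?subr_ge0//.
  apply: (@le_trans _ _ (1 - F x)); first by rewrite lerB.
  apply: le_trans (FC _ x0) _; rewrite ler_pdivrMr//.
  rewrite -ler_pdivrMl//.
have [nu nuE] := distribution_function_probability Gnd Grc GNy Gy.
by exists nu, G.
Unshelve. all: end_near. Qed.

(** * Approximation of powers by step functions *)

Section step_functions.
Context (R : realType) (k : nat) (d : R) (d0 : 0 < d).

Definition step_incr (i : nat) : R := (i.+1%:R * d) ^+ k - (i%:R * d) ^+ k.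

(** The staircase approximation from above of [t^k] with steps of width [d], the
    number of steps being [n]. The value [0^k] is the height of the staircase
    at the origin, which is 1 for [k = 0]. *)
Definition step_power (n : nat) (t : R) : R :=
  0 ^+ k + \sum_(0 <= i < n) step_incr i * (i%:R * d < t)%R%:R.

Lemma step_incr_ge0 i : 0 <= step_incr i.
Proof.
rewrite subr_ge0 lerXn2r// ?nnegrE ?mulr_ge0 ?(ltW d0)//.
by rewrite ler_pM2r// ler_nat.
Qed.

Lemma step_power_ge0 n t : 0 <= step_power n t.
Proof. by rewrite addr_ge0 ?exprn_ge0// sumr_ge0// => i _; rewrite mulr_ge0 ?step_incr_ge0. Qed.

Lemma step_powerS n t :
  step_power n.+1 t = step_power n t + step_incr n * (n%:R * d < t)%R%:R.
Proof. by rewrite /step_power big_nat_recr//= addrA. Qed.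

Lemma step_power_top n t : (0 < n)%N -> n.-1%:R * d < t -> step_power n t = (n%:R * d) ^+ k.
Proof.
case: n => // n _ /=; elim: n => [|n IH] nt.
  rewrite step_powerS /step_power big_geq// addr0 nt mulr1 /step_incr.
  by rewrite mul0r addrC subrK.
rewrite step_powerS nt mulr1 IH; first by rewrite /step_incr addrC subrK.
by apply: le_lt_trans nt; rewrite ler_pM2r// ler_nat.
Qed.

Lemma step_power_le n t : 0 <= t -> step_power n t <= (t + d) ^+ k.
Proof.
move=> t0; elim: n => [|n IH].
  rewrite /step_power big_geq// addr0 lerXn2r ?nnegrE ?addr_ge0 ?(ltW d0)//.
have [nt|nt] := ltP (n%:R * d) t; last first.
  by rewrite step_powerS ltNge nt mulr0 addr0.
rewrite step_power_top// lerXn2r ?nnegrE ?mulr_ge0 ?addr_ge0 ?(ltW d0)//.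
by rewrite -natr1 mulrDl mul1r lerD2r ltW.
Qed.

Lemma le_step_power n t : 0 <= t -> t <= n%:R * d -> t ^+ k <= step_power n t.
Proof.
move=> t0; elim: n => [|n IH] tn.
  rewrite mul0r in tn; rewrite /step_power big_geq// addr0.
  by rewrite (_ : t = 0)//; apply/eqP; rewrite eq_le tn.
have [nt|nt] := ltP (n%:R * d) t.
  by rewrite step_power_top// lerXn2r ?nnegrE ?mulr_ge0 ?(ltW d0).
by rewrite step_powerS ltNge nt mulr0 addr0 IH.
Qed.

Lemma step_power_integral (nu : probability R R) (G : R -> R) n c :
  (forall x, nu `]-oo, x]%classic = (G x)%:E) ->
  (\int[nu]_t (step_power n (t + c))%:E =
    (0 ^+ k + \sum_(0 <= i < n) step_incr i * (1 - G (i%:R * d - c)))%:E)%E.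
Proof.
move=> nuG.
have stepE i t : (i%:R * d < t + c)%R%:R = \1_(~` `]-oo, i%:R * d - c]%classic) t :> R.
  rewrite indicE; congr ((nat_of_bool _)%:R); rewrite in_setC; apply/idP/idP.
    by move=> it; apply/negP; rewrite inE/= in_itv/= lerBrDr leNgt it.
  by apply: contraNT => it; rewrite inE/= in_itv/= lerBrDr leNgt.
pose f i (t : R) := ((step_incr i)%:E * (\1_(~` `]-oo, i%:R * d - c]%classic) t)%:E)%E.
have mset i : measurable (~` `]-oo, i%:R * d - c]%classic : set R) by exact: measurableC.
have mind i : measurable_fun (setT : set R) (fun t : R => (\1_(~` `]-oo, i%:R * d - c]%classic) t)%:E).
  by apply/measurable_EFinP; exact: measurable_indic.
transitivity (\int[nu]_t ((0 ^+ k)%:E + \sum_(i <- index_iota 0 n) f i t))%E.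
  apply: eq_integral => t _; rewrite EFinD -sumEFin; congr (_ + _)%E.
  by apply: eq_bigr => i _; rewrite /f -EFinM stepE.
rewrite ge0_integralD//; last 2 first.
- by move=> t _; apply: sume_ge0 => i _; rewrite mule_ge0// lee_fin step_incr_ge0.
- apply: emeasurable_sum => i; exact: measurable_funeM.
have -> : (\int[nu]__ (0 ^+ k)%:E = (0 ^+ k)%:E)%E.
  have := integral_cst nu measurableT ((0 ^+ k)%:E : \bar R).
  by rewrite [X in (_ * X)%E](probability_setT nu) mule1.
rewrite ge0_integral_sum//; last 2 first.
- by move=> i; exact: measurable_funeM.
- by move=> i t _; rewrite mule_ge0// lee_fin step_incr_ge0.
rewrite EFinD -sumEFin; congr (_ + _)%E; apply: eq_bigr => i _.
rewrite ge0_integralZl//; last by rewrite lee_fin step_incr_ge0.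
rewrite integral_indic// setIT.
by rewrite [X in (_ * X)%E = _](probability_setC nu (measurable_itv _)) nuG -EFinB -EFinM.
Qed.

End step_functions.

Lemma exprn_shift_le (R : realType) (k : nat) (t d : R) : 0 <= t -> 0 <= d <= 1 ->
  (t + d) ^+ k <= t ^+ k + d * (t + 1) ^+ k.
Proof.
move=> t0 /andP[d0 d1].
suff : (t + d) ^+ k <= t ^+ k + d * ((t + 1) ^+ k - t ^+ k).
  move=> /le_trans; apply; rewrite lerD2l ler_wpM2l// lerBlDr lerDl.
  exact: exprn_ge0.
elim: k => [|k IH]; first by rewrite !expr0 subrr mulr0 addr0.
have D0 : 0 <= (t + 1) ^+ k - t ^+ k.
  by rewrite subr_ge0 lerXn2r ?nnegrE ?addr_ge0// lerDl.
rewrite !exprS; apply: (@le_trans _ _ ((t + d) * (t ^+ k + d * ((t + 1) ^+ k - t ^+ k)))).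
  by rewrite ler_wpM2l// addr_ge0.
rewrite -subr_ge0 (_ : _ - _ = d * ((t + 1) ^+ k - t ^+ k) * (1 - d)); last by ring.
by rewrite !mulr_ge0// subr_ge0.
Qed.

Lemma exprn_shift1_le (R : realType) (k : nat) (t : R) : 0 <= t ->
  (t + 1) ^+ k <= 2 ^+ k + 2 ^+ k * t ^+ k.
Proof.
move=> t0; have [t1|t1] := leP t 1.
  apply: (@le_trans _ _ (2 ^+ k)); last by rewrite lerDl mulr_ge0 ?exprn_ge0.
  by rewrite lerXn2r ?nnegrE ?addr_ge0//; lra.
apply: (@le_trans _ _ (2 ^+ k * t ^+ k)); last by rewrite lerDr exprn_ge0.
by rewrite -exprMn lerXn2r ?nnegrE ?addr_ge0 ?mulr_ge0//; lra.
Qed.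


(** * The representation theorem of Stieltjes *)

(** Turns the strict indicators of the staircase into the indicators of
    [t <= x] on which the extended functional is known. *)
Lemma step_powerC (R : realType) k (d : R) n t :
  step_power k d n t + \sum_(0 <= i < n) step_incr k d i * (t <= i%:R * d)%R%:R =
  0 ^+ k + \sum_(0 <= i < n) step_incr k d i.
Proof.
rewrite /step_power -addrA; congr (_ + _); rewrite -big_split /=.
by apply: eq_bigr => i _; rewrite ltNge -mulrDr; case: leP; rewrite ?addr0 ?add0r mulr1.
Qed.

Section Stieltjes_existence.
Context (R : realType) (L : {scalar {poly R}}).
Hypothesis L_ge0 : forall p : {poly R}, (forall t, 0 <= t -> 0 <= p.[t]) -> 0 <= L p.
Hypothesis L1 : L 1 = 1.

Let LC c : L c%:P = c.
Proof. by rewrite -alg_polyC linearZ /= L1 mulr1. Qed.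

Let L_le (p q : {poly R}) :
  (forall t, 0 <= t -> p.[t] <= q.[t]) -> L p <= L q.
Proof.
move=> pq; rewrite -subr_ge0 -linearB; apply: L_ge0 => t t0.
by rewrite hornerD hornerN subr_ge0 pq.
Qed.

Let LX_ge0 k : 0 <= L 'X^k.
Proof. by apply: L_ge0 => t t0; rewrite hornerXn exprn_ge0. Qed.

(** Write [F] for the values of the extension of [L] at the indicators of
    [t <= x], and [nu] for the measure with distribution function the right
    limits of [F]. Integrating a staircase against [nu] and applying the
    extension of [L] to it give sums that only differ in [F] against its right
    limits. The staircase lies between [t^k] and [(t + d)^k], the upper bound
    being affordable as [d] tends to 0. So the [k]-th moment of [nu] is at most
    [L X^k], as is first seen on bounded intervals. Conversely the staircase falls below [t^k] only beyond
    [n d], where [t^k <= t^(k+1) / (n d)]; shifting the argument by [d]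
    absorbs the passage from [F] to its right limits. *)
Theorem Stieltjes_existence :
  exists nu : probability R R, S_representing nu (fun n => L 'X^n).
Proof.
have [F hF] := positive_functional_extension L_ge0.
have hFn (p : {poly R}) n (c : nat -> R) (d : R) :
    (forall t, 0 <= t -> 0 <= p.[t] + \sum_(0 <= i < n) c i * (t <= i%:R * d)%R%:R) ->
    0 <= L p + \sum_(0 <= i < n) c i * F (i%:R * d).
  move=> h; have := hF p [seq (c i, i%:R * d) | i <- index_iota 0 n].
  by rewrite big_map /=; apply=> t t0; rewrite big_map /=; exact: h.
have F_nd : {homo F : x y / x <= y}.
  move=> x y xy; have := hF 0 [:: (1, y); (-1, x)].
  rewrite linear0 !big_cons big_nil /= add0r addr0 mul1r mulN1r subr_ge0; apply=> t t0.
  rewrite horner0 !big_cons big_nil /= add0r addr0 mul1r mulN1r subr_ge0.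
  by rewrite ler_nat; case: (leP t x) => // /le_trans -> .
have F_ge0 x : 0 <= F x.
  have := hF 0 [:: (1, x)].
  rewrite linear0 !big_cons big_nil /= add0r addr0 mul1r; apply=> t t0.
  by rewrite horner0 !big_cons big_nil /= add0r addr0 mul1r.
have F_le1 x : F x <= 1.
  have := hF 1 [:: (-1, x)].
  rewrite L1 !big_cons big_nil /= addr0 mulN1r subr_ge0; apply=> t t0.
  rewrite hornerC !big_cons big_nil /= addr0 mulN1r subr_ge0.
  by case: (t <= x).
have F_neg x : x < 0 -> F x = 0.
  move=> x0; apply/eqP; rewrite eq_le F_ge0 andbT.
  have := hF 0 [:: (-1, x)].
  rewrite linear0 !big_cons big_nil /= add0r addr0 mulN1r oppr_ge0; apply=> t t0.
  rewrite horner0 !big_cons big_nil /= add0r addr0 mulN1r oppr_ge0.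
  by rewrite (leNgt t x) (lt_le_trans x0 t0).
have F_tail : exists C, forall x, 0 < x -> 1 - F x <= C / x.
  exists (L 'X) => x x0; rewrite lerBlDr -subr_ge0 addrAC.
  have := hF (x^-1 *: 'X - 1) [:: (1, x)].
  rewrite linearB linearZ /= L1 big_cons big_nil /= addr0 mul1r [x^-1 * _]mulrC; apply=> t t0.
  rewrite !hornerE big_cons big_nil /= addr0 mul1r.
  have [tx|tx] := leP t x; first by rewrite subrK mulr_ge0 ?invr_ge0 ?(ltW x0).
  by rewrite addr0 subr_ge0 ler_pdivlMl// mulr1 ltW.
have F01 x : 0 <= F x <= 1 by rewrite F_ge0 F_le1.
have [nu [G nuG [FG GF]]] := right_limit_nondecreasing F_nd F01 F_neg F_tail.
pose D : set R := `[0, +oo[%classic.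
have nu_neg : nu `]-oo, 0[%classic = 0%E.
  have -> : `]-oo, 0[%classic = \bigcup_n `]-oo, (- n.+1%:R^-1 : R)]%classic.
    apply/seteqP; split=> x /=.
      rewrite in_itv /= => x0; exists (Num.bound (- x)^-1) => //=.
      rewrite in_itv /= lerNr -[leRHS]invrK lef_pV2 ?posrE ?invr_gt0 ?oppr_gt0//.
      apply: le_trans (_ : (Num.bound (- x)^-1)%:R <= _); last by rewrite ler_nat.
      by rewrite ltW// archi_boundP// invr_ge0 oppr_ge0 ltW.
    by move=> [n _] /=; rewrite !in_itv /= => /le_lt_trans; apply; rewrite oppr_lt0 invr_gt0.
  apply: measure_negligible; first exact: bigcup_measurable.
  apply: negligible_bigcup => n; apply/negligibleP => //.
  have n0 : (n.+1%:R : R)^-1 / 2 > 0 by rewrite divr_gt0.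
  apply: etrans (nuG _) _; congr (_%:E); apply/eqP; rewrite eq_le (le_trans (F_ge0 _) (FG _)) andbT.
  rewrite -(F_neg (- (n.+1%:R^-1 / 2))) ?oppr_lt0// GF// ltrN2 ltr_pdivrMr// ltr_pMr ?invr_gt0//.
  by rewrite ltr1n.
have mD : measurable D by exact: measurable_itv.
have intTD (f : R -> R) : measurable_fun setT f -> (forall t, 0 <= f t) ->
    (\int[nu]_t (f t)%:E = \int[nu]_(t in D) (f t)%:E)%E.
  move=> mf f0; rewrite (@ge0_negligible_integral _ _ _ nu setT `]-oo, 0[%classic)//.
  - by rewrite setTD setCitvl.
  - exact/measurable_EFinP.
  - by move=> t _; rewrite lee_fin.
have mX k (E : set R) : measurable_fun E (fun t : R => (t ^+ k)%:E).
  by apply/measurable_EFinP; apply: measurable_funX; exact: measurable_id.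
have mXD k c (E : set R) : measurable_fun E (fun t : R => ((t + c) ^+ k)%:E).
  by apply/measurable_EFinP; apply: measurable_funX; exact: measurable_funD.
have mstep k d n c : measurable_fun setT (fun t : R => step_power k d n (t + c)).
  apply: measurable_funD => //; apply: measurable_sum => i.
  apply: measurable_funM => //.
  rewrite (_ : (fun _ => _) = \1_(`](i%:R * d - c), +oo[%classic : set R)).
    exact: measurable_indic.
  apply/funext => t; rewrite indicE; congr ((nat_of_bool _)%:R).
  by apply/idP/idP; rewrite inE /= in_itv /= andbT ltrBlDr.
pose M k := (\int[nu]_(t in D) (t ^+ k)%:E)%E.
(* The truncation to [0, N] makes finitely many steps suffice. *)
have upper k (N : nat) (e : R) : 0 < e ->
    (\int[nu]_(t in `[0%R, N%:R]%classic) (t ^+ k)%:E <= (L 'X^k + e)%:E)%E.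
  move=> e0; pose C := L (('X + 1) ^+ k).
  have C0 : 0 <= C.
    by apply: L_ge0 => t t0; rewrite horner_exp hornerD hornerX hornerC exprn_ge0 ?addr_ge0.
  (* [(X + d)^k <= X^k + d (X + 1)^k] costs at most [d C <= e]. *)
  pose d := Num.min 1 (e / (C + 1)).
  have C1 : 0 < C + 1 by rewrite ltr_wpDl.
  have d0 : 0 < d by rewrite lt_min ltr01 divr_gt0.
  have d1 : d <= 1 by rewrite ge_min lexx.
  have dC : d * C <= e.
    have de : d * (C + 1) <= e by rewrite -ler_pdivlMr// ge_min lexx orbT.
    by rewrite (le_trans _ de)// ler_pM2l// lerDl.
  pose n := Num.bound (N%:R / d).
  have Nn : N%:R <= n%:R * d.
    by rewrite -ler_pdivrMr// ltW// archi_boundP// divr_ge0 ?(ltW d0).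
  apply: (@le_trans _ _ (\int[nu]_(t in `[0%R, N%:R]%classic) (step_power k d n (t + 0))%:E)%E).
    apply: ge0_le_integral => //.
    - by move=> t; rewrite /= in_itv /= => /andP[t0 _]; rewrite lee_fin exprn_ge0.
    - apply/measurable_EFinP; apply: measurable_funTS; exact: mstep.
    - move=> t; rewrite /= in_itv /= => /andP[t0 tN]; rewrite lee_fin addr0.
      by rewrite le_step_power// (le_trans tN).
  apply: (@le_trans _ _ (\int[nu]_t (step_power k d n (t + 0))%:E)%E).
    apply: ge0_subset_integral => //.
    - apply/measurable_EFinP; exact: mstep.
    - by move=> t _; rewrite lee_fin step_power_ge0.
  rewrite (step_power_integral _ d0 _ _ nuG) lee_fin.
  apply: (@le_trans _ _ (L (('X + d%:P) ^+ k))).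
    pose c := 0 ^+ k + \sum_(0 <= i < n) step_incr k d i.
    apply: (@le_trans _ _ (0 ^+ k + \sum_(0 <= i < n) step_incr k d i * (1 - F (i%:R * d)))).
      rewrite lerD2l; apply: ler_sum => i _; rewrite ler_wpM2l ?step_incr_ge0//.
      by rewrite subr0 lerB.
    have := hFn (('X + d%:P) ^+ k - c%:P) n (step_incr k d) d.
    rewrite linearB /= LC.
    have -> : \sum_(0 <= i < n) step_incr k d i * (1 - F (i%:R * d)) =
       \sum_(0 <= i < n) step_incr k d i - \sum_(0 <= i < n) step_incr k d i * F (i%:R * d).
      by rewrite -sumrB; apply: eq_bigr => i _; rewrite mulrBr mulr1.
    move=> h; suff : 0 <= L (('X + d%:P) ^+ k) - c +
      \sum_(0 <= i < n) step_incr k d i * F (i%:R * d) by rewrite /c; lra.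
    apply: h => t t0.
    rewrite hornerD hornerN hornerC horner_exp hornerD hornerX hornerC.
    have := step_power_le k d0 n t0; rewrite -subr_ge0.
    by rewrite /c -(step_powerC k d n t); lra.
  apply: (@le_trans _ _ (L ('X^k + d *: ('X + 1) ^+ k))).
    apply: L_le => t t0; rewrite hornerD hornerZ !horner_exp !hornerD !hornerX !hornerC.
    by apply: exprn_shift_le => //; rewrite (ltW d0).
  by rewrite linearD linearZ /= lerD2l.
have M_le k : (M k <= (L 'X^k)%:E)%E.
  apply/lee_addgt0Pr => e e0; rewrite -EFinD.
  have D_bigcup : D = \bigcup_N `[0, N%:R]%classic.
    apply/seteqP; split=> t; rewrite /D /=.
      rewrite in_itv /= andbT => t0; exists (Num.bound t) => //=.
      by rewrite in_itv /= t0 ltW// archi_boundP.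
    by move=> [N _]; rewrite /= !in_itv /= andbT => /andP[].
  have : (\int[nu]_(t in `[0%R, N%:R]%classic) (t ^+ k)%:E @[N --> \oo] --> M k)%E.
    rewrite /M D_bigcup; apply: ge0_nondecreasing_set_cvg_integral => //.
    - move=> m n mn; rewrite subsetEset; apply: subset_itvl.
      by rewrite bnd_simp ler_nat.
    - by move=> N t; rewrite /= in_itv /= => /andP[t0 _]; rewrite lee_fin exprn_ge0.
  move=> cv; rewrite -(cvg_lim _ cv)//; apply: lime_le; first by apply/cvg_ex; exists (M k).
  by apply: nearW => N; exact: upper.
have nuD : (nu D = 1)%E.
  have := probability_setC nu (measurable_itv `]-oo, (0:R)[).
  by rewrite setCitvl => ->; rewrite nu_neg sube0.
have M_ge k : ((L 'X^k)%:E <= M k)%E.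
  apply/lee_addgt0Pr => e e0.
  (* [K] bounds the integral of [(t + 1)^k], and half of the error [e] is spent
     on the width of the steps, the other half on the tail beyond [n d]. *)
  pose K := 2 ^+ k + 2 ^+ k * L 'X^k.
  have K0 : 0 <= K by rewrite addr_ge0 ?mulr_ge0 ?exprn_ge0.
  have K1 : 0 < K + 1 by rewrite ltr_wpDl.
  pose d := Num.min 2^-1 (e / (4 * (K + 1))).
  have d0 : 0 < d by rewrite lt_min invr_gt0 ltr0n divr_gt0// mulr_gt0.
  have d1 : d <= 2^-1 by rewrite ge_min lexx.
  have dK : 2 * d * K <= e / 2.
    have de : d * (4 * (K + 1)) <= e.
      by rewrite -ler_pdivlMr ?mulr_gt0// ge_min lexx orbT.
    by rewrite ler_pdivlMr// (le_trans _ de)//; nra.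
  pose n := (Num.bound (L 'X^(k.+1) * 2 / e / d)).+1.
  have n0 : 0 < n%:R * d by rewrite mulr_gt0.
  have tail : L 'X^(k.+1) / (n%:R * d) <= e / 2.
    rewrite ler_pdivrMr// -ler_pdivrMl ?divr_gt0// invf_div mulrC mulrA -ler_pdivrMr//.
    apply: le_trans (_ : (Num.bound (L 'X^(k.+1) * 2 / e / d))%:R <= _); last by rewrite ler_nat.
    by rewrite ltW// archi_boundP// !mulr_ge0 ?invr_ge0 ?(ltW e0) ?(ltW d0).
  pose s := 0 ^+ k + \sum_(0 <= i < n) step_incr k d i * (1 - F (i%:R * d)).
  have Ls : L 'X^k <= s + L 'X^(k.+1) / (n%:R * d).
    pose c := 0 ^+ k + \sum_(0 <= i < n) step_incr k d i.
    have := hFn ((n%:R * d)^-1 *: 'X^(k.+1) + c%:P - 'X^k) n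
      (fun i => - step_incr k d i) d.
    rewrite linearB linearD /= LC linearZ /=.
    have -> : s = c - \sum_(0 <= i < n) step_incr k d i * F (i%:R * d).
      rewrite /s /c -addrA -sumrB; congr (_ + _).
      by apply: eq_bigr => i _; rewrite mulrBr mulr1.
    under eq_bigr do rewrite mulNr.
    rewrite sumrN [_^-1 * _]mulrC => h.
    suff : 0 <= L 'X^(k.+1) / (n%:R * d) + c - L 'X^k -
      \sum_(0 <= i < n) step_incr k d i * F (i%:R * d) by lra.
    apply: h => t t0.
    rewrite hornerD hornerN hornerD hornerZ hornerC !hornerXn.
    under eq_bigr do rewrite mulNr.
    rewrite sumrN.
    rewrite /c -(step_powerC k d n t).
    suff : t ^+ k <= (n%:R * d)^-1 * t ^+ k.+1 + step_power k d n t by lra.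
    have [tn|tn] := leP t (n%:R * d).
      rewrite (le_trans (le_step_power k d0 t0 tn))// lerDr mulr_ge0 ?exprn_ge0// invr_ge0 ltW//.
    rewrite (@le_trans _ _ ((n%:R * d)^-1 * t ^+ k.+1))//; last by rewrite lerDl step_power_ge0.
    by rewrite ler_pdivlMl// exprS ler_wpM2r ?exprn_ge0// ltW.
  have s_le : (s%:E <= M k + (2 * d * K)%:E)%E.
    apply: (@le_trans _ _ (\int[nu]_t (step_power k d n (t + d))%:E)%E).
      rewrite (step_power_integral _ d0 _ _ nuG) lee_fin lerD2l; apply: ler_sum => i _.
      by rewrite ler_wpM2l ?step_incr_ge0// lerB// GF// ltrBlDr ltrDl.
    rewrite intTD//; last by move=> t; rewrite step_power_ge0.
    apply: (@le_trans _ _ (\int[nu]_(t in D) ((t ^+ k)%:E + (2 * d)%:E * ((t + 1) ^+ k)%:E))%E).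
      apply: ge0_le_integral => //.
      - by move=> t _; rewrite lee_fin step_power_ge0.
      - by apply/measurable_EFinP; apply: measurable_funTS; exact: mstep.
      - by apply: emeasurable_funD => //; exact: measurable_funeM.
      - move=> t; rewrite /D /= in_itv /= andbT => t0; rewrite -EFinM -EFinD lee_fin.
        rewrite (le_trans (step_power_le _ _ _ _))// ?addr_ge0 ?(ltW d0)//.
        rewrite -addrA -mulr2n -[d *+ 2]mulr_natl exprn_shift_le//.
        by rewrite mulr_ge0 ?(ltW d0)//=; lra.
    have pos1 t : D t -> (0 <= ((t + 1) ^+ k)%:E)%E.
      by rewrite /D /= in_itv /= andbT => t0; rewrite lee_fin exprn_ge0 ?addr_ge0.
    have posX t : D t -> (0 <= (t ^+ k)%:E)%E.
      by rewrite /D /= in_itv /= andbT => t0; rewrite lee_fin exprn_ge0.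
    rewrite ge0_integralD//; last 2 first.
    - by move=> t Dt; rewrite mule_ge0 ?pos1// lee_fin mulr_ge0 ?(ltW d0).
    - exact: measurable_funeM.
    rewrite leeD2l// ge0_integralZl//; last by rewrite lee_fin mulr_ge0 ?(ltW d0).
    rewrite (EFinM (2 * d) K) lee_wpmul2l ?lee_fin ?mulr_ge0 ?(ltW d0)//.
    apply: (@le_trans _ _ (\int[nu]_(t in D) ((2 ^+ k)%:E + (2 ^+ k)%:E * (t ^+ k)%:E))%E).
      apply: ge0_le_integral => //.
      - by apply: emeasurable_funD => //; exact: measurable_funeM.
      - move=> t; rewrite /D /= in_itv /= andbT => t0.
        by rewrite -EFinM -EFinD lee_fin exprn_shift1_le.
    rewrite ge0_integralD//; last 2 first.
    - by move=> t Dt; apply: mule_ge0; [rewrite lee_fin exprn_ge0|exact: posX].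
    - exact: measurable_funeM.
    rewrite ge0_integralZl ?lee_fin ?exprn_ge0//.
    have -> : (\int[nu]_(x in D) (2 ^+ k)%:E = (2 ^+ k)%:E)%E.
      by apply: etrans (integral_cst nu mD _) _; rewrite [X in (_ * X)%E]nuD mule1.
    rewrite /K EFinD leeD2l// (EFinM (2 ^+ k)) lee_wpmul2l ?lee_fin ?exprn_ge0//.
    exact: M_le.
  apply: (@le_trans _ _ (s%:E + (L 'X^(k.+1) / (n%:R * d))%:E)%E).
    by rewrite -EFinD lee_fin.
  apply: (@le_trans _ _ ((M k + (2 * d * K)%:E) + (e / 2)%:E)%E).
    by apply: leeD => //; rewrite lee_fin.
  by rewrite -addeA leeD2l// -EFinD lee_fin; lra.
exists nu; split=> // n.
have MnE : M n = (L 'X^n)%:E by apply/eqP; rewrite eq_le M_le M_ge.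
split=> //; apply/integrableP; split => //.
rewrite (eq_integral (fun t : R => (t ^+ n)%:E)).
  by rewrite -/(M n) MnE ltry.
by move=> t; rewrite inE /= in_itv /= andbT => t0; rewrite ger0_norm// exprn_ge0.
Qed.

End Stieltjes_existence.


(** * The Hilbert space of a complete semi-inner product *)

Record semi_inner_product (R : realType) (V : lmodType R[i]) := SemiInnerProduct {
  sdot :> V -> V -> R[i];
  sdotDl : forall x y z, sdot (x + y) z = sdot x z + sdot y z;
  sdotZl : forall a x y, sdot (a *: x) y = a * sdot x y;
  sdotC : forall x y, sdot y x = (sdot x y)^*%R;
  sdot_ge0 : forall x, 0 <= sdot x x;
  sdot_complete : forall u : nat -> V,
    (forall e : R, 0 < e -> exists N : nat, forall m n : nat,
       (N <= m)%N -> (N <= n)%N -> sdot (u m - u n) (u m - u n) <= e%:C) ->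
    exists l : V, forall e : R, 0 < e -> exists N : nat, forall n : nat,
       (N <= n)%N -> sdot (u n - l) (u n - l) <= e%:C
}.

Section separated_quotient.
Context (R : realType) (V : lmodType R[i]) (S : semi_inner_product V).

Lemma sdot0l w : S 0 w = 0.
Proof. by rewrite -(scale0r 0) sdotZl mul0r. Qed.

Lemma sdotDr v w z : S v (w + z) = S v w + S v z.
Proof. by rewrite sdotC sdotDl rmorphD /= -!sdotC. Qed.

Lemma sdotZr a v w : S v (a *: w) = a^*%R * S v w.
Proof. by rewrite sdotC sdotZl rmorphM /= -!sdotC. Qed.

(** Otherwise [S (w - t v) (w - t v)] would be an affine function of [t] that
    takes negative values. *)
Lemma sdot_null v w : S v v = 0 -> S v w = 0.
Proof.
move=> v0; apply/eqP; apply: contraT => vw0.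
have ww_real : S w w = (complex.Re (S w w))%:C.
  by have := sdot_ge0 S w; case: (S w w) => a b; rewrite lecE /= => /andP[/eqP -> _].
pose r := complex.Re (S w w); pose q := complex.Re (S v w * (S v w)^*%R).
have qE : S v w * (S v w)^*%R = q%:C.
  rewrite /q -[_^*%R]/(conjc (S v w)); case: (S v w) => a b /=.
  by apply/eqP; rewrite eq_complex /=; apply/andP; split=> //; apply/eqP; ring.
have q0 : 0 < q.
  by rewrite -ltcR -qE -normCK exprn_gt0// normr_gt0.
have ge0 (t : R) : 0 <= r - 2 * t * q.
  have := sdot_ge0 S (w - (t%:C * (S v w)^*%R) *: v).
  rewrite -scaleNr !(sdotDl, sdotDr, sdotZl, sdotZr) v0 !mulr0 addr0.
  rewrite ww_real [S w v]sdotC rmorphN rmorphM /= conjCK.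
  have -> : (t%:C)^*%R = t%:C :> R[i] by rewrite -[LHS]/(t -i* 0) oppr0.
  rewrite !mulNr -!mulrA [(S v w)^*%R * _]mulrC qE -!rmorphM /= -!rmorphN -!rmorphD /= lecR.
  by rewrite /r; lra.
have := ge0 ((r + 1) / (2 * q)).
rewrite (_ : 2 * _ * q = r + 1); last by field; rewrite gt_eqF.
by rewrite opprD addrA subrr add0r oppr_ge0 ler10.
Qed.

(** The class of [v] modulo the null vectors is encoded by the functional [S v],
    so that equality of classes is equality of functions. *)
Definition represented : {pred V -> R[i]} :=
  [pred F : V -> R[i] | `[< exists v, F = S v >]].

Record quotient_space := QuotientSpace {
  quotient_val :> V -> R[i]; _ : quotient_val \in represented }.

HB.instance Definition _ := [isSub for quotient_val].
HB.instance Definition _ := [Choice of quotient_space by <:].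

Let represented_submod : submod_closed represented.
Proof.
split.
  by apply/asboolP; exists 0; apply/funext => w; rewrite sdot0l.
move=> a _ _ /asboolP[u ->] /asboolP[v ->]; apply/asboolP; exists (a *: u + v).
by apply/funext => w; rewrite sdotDl sdotZl.
Qed.

HB.instance Definition _ :=
  GRing.isSubmodClosed.Build R[i] (V -> R[i]) represented represented_submod.
HB.instance Definition _ := [SubChoice_isSubLmodule of quotient_space by <:].

Let classP v : (S v : V -> R[i]) \in represented.
Proof. by apply/asboolP; exists v. Qed.

Definition class (v : V) : quotient_space := QuotientSpace (classP v).

Let reprP (F : quotient_space) : exists v, F = class v.
Proof.
by case: F => F FP; have /asboolP[v Fv] := FP; exists v; apply/val_inj.
Qed.

Definition representative (F : quotient_space) : V := sval (cid (reprP F)).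

Lemma representativeK : cancel representative class.
Proof. by move=> F; rewrite /representative; case: cid. Qed.

Lemma class_linear : linear class.
Proof.
by move=> a u v; apply/val_inj/funext => w /=; rewrite sdotDl sdotZl.
Qed.

HB.instance Definition _ := GRing.isLinear.Build R[i] V quotient_space _ class class_linear.

Definition quotient_dot (F G : quotient_space) : R[i] :=
  S (representative F) (representative G).

Lemma quotient_dotE v w : quotient_dot (class v) (class w) = S v w.
Proof.
have repr u z : S (representative (class u)) z = S u z.
  by rewrite -[LHS]/(quotient_val (class _) z) representativeK.
by rewrite /quotient_dot repr sdotC repr -sdotC.
Qed.

Lemma class_eq0 v : class v = 0 <-> S v v = 0.
Proof.
split=> [v0|v0]; last by apply/val_inj/funext => w; exact: sdot_null.
by rewrite -[LHS]/(quotient_val (class v) v) v0.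
Qed.

Let quotient_dotDl F G H : quotient_dot (F + G) H = quotient_dot F H + quotient_dot G H.
Proof.
rewrite -(representativeK F) -(representativeK G) -(representativeK H) -raddfD.
by rewrite !quotient_dotE sdotDl.
Qed.

Let quotient_dotZl a F G : quotient_dot (a *: F) G = a * quotient_dot F G.
Proof.
rewrite -(representativeK F) -(representativeK G) -linearZ.
by rewrite !quotient_dotE sdotZl.
Qed.

Let quotient_dotC F G : quotient_dot G F = (quotient_dot F G)^*%R.
Proof. exact: sdotC. Qed.

Let quotient_dot_ge0 F : 0 <= quotient_dot F F.
Proof. exact: sdot_ge0. Qed.

Let quotient_dot_eq0 F : quotient_dot F F = 0 -> F = 0.
Proof. by rewrite -(representativeK F) quotient_dotE => /class_eq0. Qed.

Let quotient_dot_complete (u : nat -> quotient_space) :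
  (forall e : R, 0 < e -> exists N : nat, forall m n : nat,
     (N <= m)%N -> (N <= n)%N -> quotient_dot (u m - u n) (u m - u n) <= e%:C) ->
  exists l : quotient_space, forall e : R, 0 < e -> exists N : nat, forall n : nat,
     (N <= n)%N -> quotient_dot (u n - l) (u n - l) <= e%:C.
Proof.
move=> uC; pose v n := representative (u n).
have uE n : u n = class (v n) by rewrite representativeK.
have [|l vl] := @sdot_complete _ _ S v.
  move=> e /uC[N NP]; exists N => m n Nm Nn.
  by have := NP m n Nm Nn; rewrite !uE -raddfB quotient_dotE.
exists (class l) => e /vl[N NP]; exists N => n /NP.
by rewrite uE -raddfB quotient_dotE.
Qed.

HB.instance Definition _ := Lmodule_isHilbert.Build R quotient_space
  quotient_dotDl quotient_dotZl quotient_dotC quotient_dot_ge0 quotient_dot_eq0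
  quotient_dot_complete.

Lemma dotv_class v w : dotv (class v) (class w) = S v w.
Proof. exact: quotient_dotE. Qed.

End separated_quotient.


(** * Square-integrable complex functions *)

Section sqnorm.
Context (R : realType).
Implicit Types z w : R[i].

Definition sqn z : R := complex.Re z ^+ 2 + complex.Im z ^+ 2.

Lemma sqn_ge0 z : 0 <= sqn z.
Proof. by rewrite addr_ge0// sqr_ge0. Qed.

Lemma sqnN z : sqn (- z) = sqn z.
Proof. by case: z => a b; rewrite /sqn /= !sqrrN. Qed.

Lemma sqnM z w : sqn (z * w) = sqn z * sqn w.
Proof. by case: z w => a b [c d]; rewrite /sqn /=; ring. Qed.

Lemma sqn_real (r : R) : sqn r%:C = r ^+ 2.
Proof. by rewrite /sqn /= expr0n addr0. Qed.

Lemma sqnD_le z w : sqn (z + w) <= 2 * (sqn z + sqn w).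
Proof.
case: z w => a b [c d]; rewrite /sqn /=.
by have := sqr_ge0 (a - c); have := sqr_ge0 (b - d); nra.
Qed.

Lemma sqn_eq0 z : sqn z = 0 -> z = 0.
Proof.
case: z => a b /eqP; rewrite /sqn /= paddr_eq0 ?sqr_ge0// !sqrf_eq0.
by move=> /andP[/eqP -> /eqP ->].
Qed.

Lemma sqn_normc z : sqn z = Normc.normc z ^+ 2.
Proof. by case: z => a b; rewrite /sqn /Normc.normc sqr_sqrtr ?addr_ge0 ?sqr_ge0. Qed.

End sqnorm.

(** The increments beyond the index [N] sum to at most [2 s / 2^N]. *)
Lemma cvg_geometric_increments (R : realType) (r : nat -> R) (s : R) :
  (forall k, `|r k.+1 - r k| <= s / 2 ^+ k) -> cvgn r.
Proof.
move=> rs.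
have s0 : 0 <= s by have := rs 0%N; rewrite expr0 divr1; apply: le_trans.
have inc N j : `|r (N + j)%N - r N| <= s * 2 * (2 ^- N - 2 ^- (N + j)).
  elim: j => [|j IH]; first by rewrite addn0 !subrr normr0 mulr0.
  rewrite addnS -(subrK (r (N + j)%N) (r _)) -addrA.
  apply: (le_trans (ler_normD _ _)).
  apply: (le_trans (lerD (rs _) IH)).
  rewrite exprS invfM; have : 0 <= s / 2 ^+ (N + j) by rewrite mulr_ge0// invr_ge0 exprn_ge0.
  lra.
apply/cauchy_cvgP/cauchy_exP => /= e e0.
have [N NP] : exists N : nat, s * 2 / 2 ^+ N < e.
  exists (Num.bound (e^-1 * (s * 2))).
  rewrite ltr_pdivrMr ?exprn_gt0// -ltr_pdivrMl//.
  apply: lt_trans (archi_boundP _) _; first by rewrite !mulr_ge0// invr_ge0 ltW.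
  by rewrite -natrX ltr_nat ltn_expl.
exists (r N), N => // n /= Nn; rewrite -ball_normE /= distrC.
apply: le_lt_trans NP; rewrite -(subnKC Nn) (le_trans (inc _ _))//.
by rewrite ler_wpM2l ?mulr_ge0// lerBlDr lerDl invr_ge0 exprn_ge0.
Qed.

Section L2_semi_inner_product.
Context d (T : measurableType d) (R : realType) (m : {measure set T -> \bar R}).

Definition cmeasurable (f : T -> R[i]) :=
  measurable_fun setT (fun x => complex.Re (f x)) /\
  measurable_fun setT (fun x => complex.Im (f x)).

Lemma cmeasurable_sqn f : cmeasurable f ->
  measurable_fun setT (fun x => sqn (f x)).
Proof. by move=> [mre mim]; apply: measurable_funD; apply: measurable_funX. Qed.

Lemma cmeasurableZ a f : cmeasurable f -> cmeasurable (a *: f).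
Proof.
move=> [mre mim]; split.
  rewrite (_ : (fun x => _) = (fun x => complex.Re a * complex.Re (f x)
      - complex.Im a * complex.Im (f x))); last first.
    by apply/funext => x; rewrite -[(a *: f) x]/(a * f x); case: a (f x) => ? ? [].
  by apply: measurable_funB; apply: measurable_funM.
rewrite (_ : (fun x => _) = (fun x => complex.Re a * complex.Im (f x)
    + complex.Im a * complex.Re (f x))); last first.
  by apply/funext => x; rewrite -[(a *: f) x]/(a * f x); case: a (f x) => ? ? [].
by apply: measurable_funD; apply: measurable_funM.
Qed.

Lemma cmeasurableD f g : cmeasurable f -> cmeasurable g -> cmeasurable (f + g).
Proof.
move=> [fre fim] [gre gim]; split.
  rewrite (_ : (fun x => _) = (fun x => complex.Re (f x) + complex.Re (g x))).
    exact: measurable_funD.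
  by apply/funext => x; rewrite -raddfD.
rewrite (_ : (fun x => _) = (fun x => complex.Im (f x) + complex.Im (g x))).
  exact: measurable_funD.
by apply/funext => x; rewrite -raddfD.
Qed.

Lemma cmeasurableM_real (c : T -> R) (f : T -> R[i]) :
  measurable_fun setT c -> cmeasurable f ->
  cmeasurable (fun x => (c x)%:C * f x).
Proof.
move=> mc [fre fim]; split.
  rewrite (_ : (fun x => _) = (fun x => c x * complex.Re (f x))).
    exact: measurable_funM.
  by apply/funext => x; case: (f x) => a b /=; rewrite mul0r subr0.
rewrite (_ : (fun x => _) = (fun x => c x * complex.Im (f x))).
  exact: measurable_funM.
by apply/funext => x; case: (f x) => a b /=; rewrite mul0r addr0.
Qed.

(** The underlying measure is arbitrary here, in contrast with a discrete
    measure: measurability must be required, and functions are identified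
    almost everywhere only later, in the quotient. *)
Definition L2_pred : {pred T -> R[i]} := [pred f : T -> R[i] |
  `[< cmeasurable f /\ (\int[m]_x (sqn (f x))%:E < +oo)%E >]].

Lemma L2_predP f : reflect
  (cmeasurable f /\ (\int[m]_x (sqn (f x))%:E < +oo)%E) (f \in L2_pred).
Proof. exact: asboolP. Qed.

Lemma L2_pred_integrable f : f \in L2_pred ->
  m.-integrable setT (fun x => (sqn (f x))%:E).
Proof.
move=> /L2_predP[mf fi]; apply/integrableP; split.
  by apply/measurable_EFinP; exact: cmeasurable_sqn.
rewrite (eq_integral (fun x => (sqn (f x))%:E))// => x _.
by rewrite /= ger0_norm ?sqn_ge0.
Qed.

Lemma L2_pred_dominated (f : T -> R[i]) (h : T -> R) :
  cmeasurable f -> m.-integrable setT (EFin \o h) ->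
  (forall x, sqn (f x) <= h x) -> f \in L2_pred.
Proof.
move=> mf hi fh; apply/L2_predP; split=> //.
apply: (@le_lt_trans _ _ (\int[m]_x (h x)%:E)%E).
  apply: ge0_le_integral => //.
  - by move=> x _; rewrite lee_fin sqn_ge0.
  - by apply/measurable_EFinP; exact: cmeasurable_sqn.
  - exact: (measurable_int m).
  - by move=> x _; rewrite lee_fin.
have /integrableP[_] := hi; apply: le_lt_trans; apply: ge0_le_integral => //.
- by move=> x _; rewrite lee_fin (le_trans (sqn_ge0 _) (fh x)).
- exact: (measurable_int m).
- by apply: measurableT_comp => //; exact: (measurable_int m).
- by move=> x _; rewrite /= lee_fin ler_norm.
Qed.

(** For the real and imaginary parts of [f conj g]. *)
Lemma L2_product_integrable (h : T -> R) (f g : T -> R[i]) (c : R) :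
  f \in L2_pred -> g \in L2_pred -> measurable_fun setT h ->
  (forall x, `|h x| <= c * (sqn (f x) + sqn (g x))) ->
  m.-integrable setT (EFin \o h).
Proof.
move=> /L2_pred_integrable fi /L2_pred_integrable gi mh hle.
have := integrableZl measurableT c (integrableD measurableT fi gi).
apply: le_integrable => //; first exact/measurable_EFinP.
move=> x _; rewrite /= lee_fin (le_trans (hle x))// ler_norm//.
Qed.

Record L2_function := L2Function { L2_val :> T -> R[i]; _ : L2_val \in L2_pred }.

HB.instance Definition _ := [isSub for L2_val].
HB.instance Definition _ := [Choice of L2_function by <:].

Let L2_submod : submod_closed L2_pred.
Proof.
split.
  apply/L2_predP; split; first by split; exact: measurable_cst.
  rewrite integral0_eq ?ltry// => x _.
  by rewrite -[LHS]/((0 ^+ 2 + 0 ^+ 2)%:E) expr0n addr0.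
move=> a f g fL gL.
have /L2_predP[mf _] := fL; have /L2_predP[mg _] := gL.
have mh : cmeasurable (a *: f + g) by apply: cmeasurableD => //; exact: cmeasurableZ.
apply: (L2_pred_dominated mh (h := fun x => 2 * (sqn a * sqn (f x) + sqn (g x)))).
  have := integrableZl measurableT 2 (integrableD measurableT
    (integrableZl measurableT (sqn a) (L2_pred_integrable fL)) (L2_pred_integrable gL)).
  by [].
move=> x; rewrite -sqnM; exact: sqnD_le.
Qed.

HB.instance Definition _ :=
  GRing.isSubmodClosed.Build R[i] (T -> R[i]) L2_pred L2_submod.
HB.instance Definition _ := [SubChoice_isSubLmodule of L2_function by <:].

Definition dot_re (z w : R[i]) : R :=
  complex.Re z * complex.Re w + complex.Im z * complex.Im w.

Definition dot_im (z w : R[i]) : R :=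
  complex.Im z * complex.Re w - complex.Re z * complex.Im w.

Definition L2_semidot (f g : L2_function) : R[i] :=
  (\int[m]_x dot_re (f x) (g x)) +i* (\int[m]_x dot_im (f x) (g x)).

Lemma L2_functionP (f : L2_function) : (f : T -> R[i]) \in L2_pred.
Proof. exact: valP. Qed.

Lemma L2_function_measurable (f : L2_function) : cmeasurable f.
Proof. by have /L2_predP[] := L2_functionP f. Qed.

Lemma L2_function_lt (f : L2_function) : (\int[m]_x (sqn (f x))%:E < +oo)%E.
Proof. by have /L2_predP[] := L2_functionP f. Qed.

Lemma dot_re_integrable (f g : L2_function) :
  m.-integrable setT (EFin \o (fun x => dot_re (f x) (g x))).
Proof.
apply: (L2_product_integrable (c := 1) (L2_functionP f) (L2_functionP g)).
  have [fre fim] := L2_function_measurable f; have [gre gim] := L2_function_measurable g.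
  by apply: measurable_funD; apply: measurable_funM.
move=> x; rewrite mul1r /dot_re /sqn ler_norml.
case: (f x) (g x) => [a b] [c e] /=.
have := sqr_ge0 (a - c); have := sqr_ge0 (b - e).
have := sqr_ge0 (a + c); have := sqr_ge0 (b + e).
have := sqr_ge0 a; have := sqr_ge0 b; have := sqr_ge0 c; have := sqr_ge0 e.
by move=> *; apply/andP; split; nra.
Qed.

Lemma dot_im_integrable (f g : L2_function) :
  m.-integrable setT (EFin \o (fun x => dot_im (f x) (g x))).
Proof.
apply: (L2_product_integrable (c := 1) (L2_functionP f) (L2_functionP g)).
  have [fre fim] := L2_function_measurable f; have [gre gim] := L2_function_measurable g.
  by apply: measurable_funB; apply: measurable_funM.
move=> x; rewrite mul1r /dot_im /sqn ler_norml.
case: (f x) (g x) => [a b] [c e] /=.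
have := sqr_ge0 (b - c); have := sqr_ge0 (a - e).
have := sqr_ge0 (b + c); have := sqr_ge0 (a + e).
have := sqr_ge0 a; have := sqr_ge0 b; have := sqr_ge0 c; have := sqr_ge0 e.
by move=> *; apply/andP; split; nra.
Qed.

Let dotDl f g h : L2_semidot (f + g) h = L2_semidot f h + L2_semidot g h.
Proof.
rewrite /L2_semidot; simpc; congr (_ +i* _); rewrite -RintegralD//;
  do ?[exact: dot_re_integrable|exact: dot_im_integrable];
  apply: eq_Rintegral => x _; rewrite /dot_re /dot_im;
  by rewrite -[(f + g) x]/(f x + g x) !raddfD /=; ring.
Qed.

Let dotZl a f g : L2_semidot (a *: f) g = a * L2_semidot f g.
Proof.
have ri := integrableZl measurableT _ (dot_re_integrable f g).
have ii := integrableZl measurableT _ (dot_im_integrable f g).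
case: a => a b; rewrite /L2_semidot; simpc; congr (_ +i* _).
  rewrite -!RintegralZl//; do ?[exact: dot_re_integrable|exact: dot_im_integrable].
  rewrite -RintegralB//; [|exact: ri|exact: ii].
  apply: eq_Rintegral => x _; rewrite /dot_re /dot_im.
  rewrite -[(_ *: f) x]/((a +i* b) * f x).
  by case: (f x) => c e /=; ring.
rewrite -!RintegralZl//; do ?[exact: dot_re_integrable|exact: dot_im_integrable].
rewrite -RintegralD//; [|exact: ii|exact: ri].
apply: eq_Rintegral => x _; rewrite /dot_re /dot_im.
rewrite -[(_ *: f) x]/((a +i* b) * f x).
by case: (f x) => c e /=; ring.
Qed.

Let dotC f g : L2_semidot g f = (L2_semidot f g)^*%R.
Proof.
rewrite /L2_semidot -[RHS]/(_ +i* - _); congr (_ +i* _).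
  by apply: eq_Rintegral => x _; rewrite /dot_re; ring.
rewrite -[RHS]mulN1r -RintegralZl//; last exact: dot_im_integrable.
by apply: eq_Rintegral => x _; rewrite /dot_im; ring.
Qed.

Lemma L2_semidotE (f : L2_function) : L2_semidot f f = (\int[m]_x (sqn (f x)))%:C.
Proof.
rewrite /L2_semidot; congr (_ +i* _).
rewrite (@eq_Rintegral _ _ _ _ _ (cst 0)); last first.
  by move=> x _; rewrite /dot_im mulrC subrr.
by rewrite /Rintegral integral0.
Qed.

Lemma L2_semidotEFin (f : L2_function) :
  (\int[m]_x (sqn (f x))%:E = (complex.Re (L2_semidot f f))%:E)%E.
Proof.
rewrite L2_semidotE /= fineK//.
exact: (integrable_fin_num measurableT (L2_pred_integrable (L2_functionP f))).
Qed.

Let dot_ge0 f : 0 <= L2_semidot f f.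
Proof. by rewrite L2_semidotE lecR Rintegral_ge0// => x _; rewrite sqn_ge0. Qed.

Lemma L2_semidot_le f (e : R) :
  (L2_semidot f f <= e%:C) = (\int[m]_x (sqn (f x))%:E <= e%:E)%E.
Proof. by rewrite L2_semidotEFin lee_fin L2_semidotE lecR. Qed.

(** Riesz-Fischer. Along a subsequence with increments of integral at most
    [eps k] the weighted sum [D] of the squared increments is integrable, hence
    finite on a set [A] of full measure, where it bounds every increment and
    makes the subsequence converge. Fatou's lemma passes the Cauchy estimate
    to the limit. *)
Let L2_complete (u : nat -> L2_function) :
  (forall e : R, 0 < e -> exists N : nat, forall p n : nat,
     (N <= p)%N -> (N <= n)%N -> L2_semidot (u p - u n) (u p - u n) <= e%:C) ->
  exists l : L2_function, forall e : R, 0 < e -> exists N : nat, forall n : nat,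
     (N <= n)%N -> L2_semidot (u n - l) (u n - l) <= e%:C.
Proof.
move=> uc.
have uc' (e : R) : 0 < e -> exists N : nat, forall p n : nat,
    (N <= p)%N -> (N <= n)%N -> (\int[m]_x (sqn (u p x - u n x))%:E <= e%:E)%E.
  by move=> /uc[N NP]; exists N => p n Np Nn; have := NP p n Np Nn; rewrite L2_semidot_le.
(* The factor [4^k] leaves room for the weights in [D], and turns into the
   increments [2^-k] after taking square roots. *)
pose eps k : R := 1 / 2 ^+ k.+1 / 4 ^+ k.
have [K0 K0P] : exists K0 : nat -> nat, forall k p n, (K0 k <= p)%N -> (K0 k <= n)%N ->
    (\int[m]_x (sqn (u p x - u n x))%:E <= (eps k)%:E)%E.
  have /choice[K0 K0P] k : exists N : nat, forall p n, (N <= p)%N -> (N <= n)%N ->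
      (\int[m]_x (sqn (u p x - u n x))%:E <= (eps k)%:E)%E.
    by apply: uc'; rewrite !divr_gt0 ?exprn_gt0.
  by exists K0.
pose K k := (k + \sum_(i < k.+1) K0 i)%N.
have K_ge k : (K0 k <= K k)%N by rewrite /K big_ord_recr /= addnA leq_addl.
have K_geS k : (K0 k <= K k.+1)%N.
  by rewrite /K big_ord_recr big_ord_recr /= addnAC addnA leq_addl.
have K_id k : (k <= K k)%N by rewrite leq_addr.
pose v k := u (K k).
have mL (f : L2_function) : cmeasurable f by exact: L2_function_measurable.
have mdiff (f g : L2_function) : cmeasurable (fun x => f x - g x) := mL (f - g).
pose D x := (\sum_(k <oo) (4 ^+ k * sqn (v k.+1 x - v k x))%:E)%E.
have D_term_ge0 k x : (0 <= (4 ^+ k * sqn (v k.+1 x - v k x))%:E)%E.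
  by rewrite lee_fin mulr_ge0 ?sqn_ge0 ?exprn_ge0.
have mD_term k : measurable_fun setT (fun x => (4 ^+ k * sqn (v k.+1 x - v k x))%:E).
  apply/measurable_EFinP; apply: measurable_funM => //.
  exact: (cmeasurable_sqn (mdiff _ _)).
have mD : measurable_fun setT D by apply: ge0_emeasurable_sum.
have D_ge0 x : (0 <= D x)%E by apply: nneseries_ge0.
have intD : (\int[m]_x D x <= 1)%E.
  rewrite integral_nneseries//.
  apply: le_trans (_ : (\sum_(k <oo) (1 / (2 ^ k.+1)%:R)%:E <= 1)%E); last first.
    exact: (@epsilon_trick0 R 1 xpredT ler01).
  apply: lee_nneseries => [k *|k *]; first by apply: integral_ge0 => x _; exact: D_term_ge0.
  under eq_integral do rewrite EFinM.
  rewrite ge0_integralZl//; last 2 first.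
  - by apply/measurable_EFinP; exact: (cmeasurable_sqn (mdiff _ _)).
  - by move=> x _; rewrite lee_fin sqn_ge0.
  apply: (@le_trans _ _ ((4 ^+ k)%:E * (eps k)%:E)%E).
    by rewrite lee_wpmul2l ?lee_fin ?exprn_ge0// K0P.
  by rewrite -EFinM lee_fin /eps mulrC divfK ?natrX.
pose A := [set x | (D x < +oo)%E].
have mA : measurable A.
  have := emeasurable_fun_infty_o measurableT mD +oo%E; rewrite setTI; exact.
have nA : m (~` A) = 0%E.
  apply: measure_negligible; first exact: measurableC.
  have Di : m.-integrable setT D.
    apply/integrableP; split=> //; under eq_integral do rewrite gee0_abs//.
    by apply: le_lt_trans intD _; rewrite ltry.
  apply: (negligibleS _ (integrable_ae measurableT Di)) => x /= nAx.
  by move=> /(_ Logic.I); rewrite fin_numElt => /andP[_].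
have intA (f : T -> \bar R) : measurable_fun setT f -> (forall x, 0 <= f x)%E ->
    (\int[m]_x f x = \int[m]_(x in A) f x)%E.
  move=> mf f0; rewrite (@ge0_negligible_integral _ _ _ m setT (~` A))//.
    by rewrite setTD setCK.
  exact: measurableC.
(* Multiplication by the indicator of [A] makes the sequence converge
   everywhere, hence to a measurable limit. *)
pose w k x := (\1_A x : R)%:C * v k x.
have wA k x : A x -> w k x = v k x by move=> Ax; rewrite /w indicE mem_set// mul1r.
have wnA k x : ~ A x -> w k x = 0 by move=> nAx; rewrite /w indicE memNset// mul0r.
have mw k : cmeasurable (w k) by apply: cmeasurableM_real => //; exact: measurable_indic.
have w_cvg (part : {additive R[i] -> R}) : (forall z, part z ^+ 2 <= sqn z) ->
    forall x, cvgn (fun k => part (w k x)).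
  move=> part_le x; have [Ax|nAx] := pselect (A x); last first.
    under eq_fun do rewrite wnA//.
    exact: is_cvg_cst.
  under eq_fun do rewrite wA//.
  have Dfin : D x \is a fin_num by rewrite ge0_fin_numE.
  apply: (@cvg_geometric_increments _ (fun k => part (v k x)) (Num.sqrt (fine (D x)))) => k.
  rewrite -(@ler_pXn2r _ 2)// ?nnegrE ?divr_ge0 ?sqrtr_ge0 ?exprn_ge0//.
  rewrite real_normK ?num_real// -raddfB /= expr_div_n sqr_sqrtr ?fine_ge0//.
  apply: le_trans (part_le _) _.
  rewrite -exprM mulnC exprM (_ : 2 ^+ 2 = 4 :> R); last by ring.
  rewrite ler_pdivlMr ?exprn_gt0// mulrC -lee_fin fineK//.
  rewrite /D (@nneseriesD1 _ _ k)//.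
  by rewrite leeDl// nneseries_ge0.
have re_cvg x : cvgn (fun k => complex.Re (w k x)).
  by apply: (w_cvg (@complex.Re R)) => z; rewrite lerDl sqr_ge0.
have im_cvg x : cvgn (fun k => complex.Im (w k x)).
  by apply: (w_cvg (@complex.Im R)) => z; rewrite lerDr sqr_ge0.
pose l x := limn (fun k => complex.Re (w k x)) +i* limn (fun k => complex.Im (w k x)).
have ml : cmeasurable l.
  split.
  - apply: (@measurable_fun_cvg _ _ _ _ (fun k x => complex.Re (w k x))).
      by move=> k; case: (mw k).
    by move=> x _; exact: re_cvg.
  - apply: (@measurable_fun_cvg _ _ _ _ (fun k x => complex.Im (w k x))).
      by move=> k; case: (mw k).
    by move=> x _; exact: im_cvg.
have main e : 0 < e -> exists N : nat, forall n : nat, (N <= n)%N ->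
    (\int[m]_x (sqn (u n x - l x))%:E <= e%:E)%E.
  move=> e0; have [N NP] := uc' _ e0; exists N => n Nn.
  have mul : cmeasurable (fun x => u n x - l x).
    have := cmeasurableD (mL (u n)) (cmeasurableZ (-1) ml).
    by rewrite scaleN1r.
  rewrite intA; last 2 first.
  - by apply/measurable_EFinP; exact: cmeasurable_sqn.
  - by move=> x; rewrite lee_fin sqn_ge0.
  have ul x : A x -> (fun k => (sqn (u n x - v k x))%:E) @ \oo --> (sqn (u n x - l x))%:E.
    move=> Ax; apply: cvg_EFin; first exact: nearW.
    rewrite (_ : fine \o _ = fun k =>
        (complex.Re (u n x) - complex.Re (w k x)) ^+ 2
        + (complex.Im (u n x) - complex.Im (w k x)) ^+ 2); last first.
      by apply/funext => k /=; rewrite /sqn !raddfB wA.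
    rewrite /sqn !raddfB /=.
    apply: cvgD; rewrite expr2; under eq_fun do rewrite expr2;
      by apply: cvgM; apply: cvgB => //; exact: cvg_cst.
  rewrite (eq_integral (fun x => limn_einf (fun k => (sqn (u n x - v k x))%:E))); last first.
    by move=> x; rewrite inE => Ax; rewrite (cvg_limn_einf_sup (ul x Ax)).1.
  apply: (le_trans (fatou m mA _ _)).
  - move=> k; apply/measurable_EFinP; apply: measurable_funTS.
    exact: (cmeasurable_sqn (mdiff _ _)).
  - by move=> k x _; rewrite lee_fin sqn_ge0.
  rewrite limn_einf_lim; apply: lime_le; first exact: is_cvg_einfs.
  apply: nearW => k.
  apply: (@le_trans _ _ (\int[m]_(x in A) (sqn (u n x - v (maxn k N) x))%:E)%E).
    by apply: ereal_inf_lbound; exists (maxn k N) => //=; exact: leq_maxl.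
  rewrite -intA; last 2 first.
  - by apply/measurable_EFinP; exact: (cmeasurable_sqn (mdiff _ _)).
  - by move=> x; rewrite lee_fin sqn_ge0.
  by apply: NP => //; apply: leq_trans (K_id _); exact: leq_maxr.
have lL : l \in L2_pred.
  have [N NP] := main 1 ltr01.
  have dL : (u N : T -> R[i]) - l \in L2_pred.
    apply/L2_predP; split.
      by have := cmeasurableD (mL (u N)) (cmeasurableZ (-1) ml); rewrite scaleN1r.
    by apply: le_lt_trans (NP N (leqnn N)) _; rewrite ltry.
  by rewrite -(subKr (u N : T -> R[i]) l) rpredB// L2_functionP.
exists (L2Function lL) => e e0; have [N NP] := main e e0.
by exists N => n /NP; rewrite L2_semidot_le.
Qed.

Definition L2_semi_inner : semi_inner_product L2_function :=
  SemiInnerProduct dotDl dotZl dotC dot_ge0 L2_complete.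

End L2_semi_inner_product.


(** * Normality of weighted composition operators *)

Section hilbert_topology.
Context (R : realType) (H : hilbertType R).

Lemma dotv_CauchySchwarz (x y : H) : `|dotv x y| <= `|x| * `|y|.
Proof.
have dge0 (z : H) : 0 <= dotv z z by rewrite -sqr_normv exprn_ge0.
have deq0 (z : H) : dotv z z = 0 -> z = 0.
  by move/eqP; rewrite -sqr_normv sqrf_eq0 normr_eq0 => /eqP.
have := inner_product_CauchySchwarz (@dotvDl R H) (@dotvZl R H) (@dotvC R H) dge0 deq0 x y.
by rewrite -!sqr_normv !sqrCK.
Qed.

Lemma dense_dotvP (S : set H) :
  (forall x (e : R), 0 < e -> exists2 y, S y & dotv (x - y) (x - y) <= e%:C) ->
  dense S.
Proof.
move=> hS O [x Ox] Oo.
have /nbhs_ballP[e /= e0 eO] : nbhs x O by exact: open_nbhs_nbhs.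
have eE : e = (complex.Re e)%:C.
  by move: e0; case: (e) => a b; rewrite ltcE /= => /andP[/eqP -> _].
have r0 : 0 < complex.Re e by rewrite -ltcR -eE.
have [y Sy xy] := hS x _ (exprn_gt0 2 (divr_gt0 r0 (ltr0Sn R 1))).
exists y; split=> //; apply: eO; rewrite -ball_normE /=.
rewrite eE; apply: (@le_lt_trans _ _ (complex.Re e / 2)%:C).
  by rewrite -(@ler_pXn2r _ 2)// ?nnegrE ?lecR ?divr_ge0 ?(ltW r0)// sqr_normv -rmorphXn.
by rewrite ltcR ltr_pdivrMr// ltr_pMr// ltr1n.
Qed.

(** Both sides of the equation that defines the adjoint are continuous in the
    pair, by the Cauchy-Schwarz inequality. *)
Lemma adjoint_closed (A : set (H * H)) : closed (adjoint A).
Proof.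
move=> p pA q Aq.
apply/eqP; rewrite -subr_eq0 -normr_le0; apply/ler_addgt0Pr => /= e e0.
rewrite add0r; pose K := `|q.1| + `|q.2| + 1.
have K0 : 0 < K by rewrite ltr_wpDl// addr_ge0.
have [p' [p'A [/= b1 b2]]] := pA _ (nbhsx_ballx p _ (divr_gt0 e0 K0)).
have := p'A q Aq => p'q.
have Bdist (u v z : H) : dotv u v - dotv u z = dotv u (v - z).
  rewrite [RHS]dotvC dotvDl -(scaleN1r z) dotvZl rmorphD rmorphM /= rmorphN1 -!dotvC.
  by rewrite mulN1r.
have -> : dotv q.2 p.1 - dotv q.1 p.2 = dotv q.2 (p.1 - p'.1) - dotv q.1 (p.2 - p'.2).
  by rewrite -!Bdist p'q; ring.
apply: le_trans (ler_normB _ _) _.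
apply: (@le_trans _ _ (`|q.2| * (e / K) + `|q.1| * (e / K))).
  apply: lerD; apply: le_trans (dotv_CauchySchwarz _ _) _;
    by rewrite ler_wpM2l//; move: b1 b2; rewrite -!ball_normE /= => /ltW + /ltW.
rewrite -mulrDl mulrA ler_pdivrMr// mulrC ler_wpM2l ?(ltW e0)//.
by rewrite /K [X in X + 1]addrC lerDl.
Qed.

End hilbert_topology.

Section weighted_composition.
Context d (T : measurableType d) (R : realType) (m : {measure set T -> \bar R}).

Local Notation H := (quotient_space (L2_semi_inner m)).
Local Notation cl := (class (L2_semi_inner m)).

Lemma L2_class_eq (f g : L2_function m) :
  cl f = cl g <-> (\int[m]_x (sqn (f x - g x))%:E = 0)%E.
Proof.
have -> : (\int[m]_x (sqn (f x - g x))%:E =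
    (complex.Re (L2_semidot (f - g) (f - g)))%:E)%E by rewrite -L2_semidotEFin.
split=> [fg|fg].
  have /class_eq0 : cl (f - g) = 0 by rewrite raddfB /= fg subrr.
  by move=> h; rewrite (h : L2_semidot _ _ = 0).
apply/eqP; rewrite -subr_eq0 -raddfB; apply/eqP/class_eq0 => /=.
by move: fg; rewrite L2_semidotE /= => -[->].
Qed.

Lemma integral_eq0_mul (k f : T -> R) :
  measurable_fun setT k -> measurable_fun setT f ->
  (forall x, 0 <= f x) -> (\int[m]_x (f x)%:E = 0)%E ->
  (\int[m]_x (k x * f x)%:E = 0)%E.
Proof.
move=> mk mf f0 fi.
have mfE : measurable_fun setT (EFin \o f) by exact/measurable_EFinP.
have fae : ae_eq m setT (EFin \o f) (cst 0%E).
  apply/(ae_eq_integral_abs m measurableT mfE).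
  by rewrite -[RHS]fi; apply: eq_integral => x _ /=; rewrite ger0_norm.
rewrite -[RHS](integral0 m setT); apply: ae_eq_integral => //.
  by apply/measurable_EFinP; exact: measurable_funM.
by apply: filterS fae => x /= h /h [->]; rewrite mulr0.
Qed.

Definition bounded_part (c : T -> R) (n : nat) := [set x | c x <= n%:R].

Lemma bounded_part_measurable c n :
  measurable_fun setT c -> measurable (bounded_part c n).
Proof.
move=> mc; rewrite /bounded_part -[X in measurable X]setTI.
rewrite (_ : [set x | _] = c @^-1` `]-oo, n%:R]).
  exact: mc.
by apply/seteqP; split=> x /=; rewrite in_itv.
Qed.

(** Truncation to the set where the unbounded weight [c] is at most [n]: it maps
    L2 into the domain of multiplication by [c]. *)
Definition cutoff (c : T -> R) (n : nat) (f : T -> R[i]) : T -> R[i] :=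
  fun x => (\1_(bounded_part c n) x : R)%:C * f x.

Section cutoffs.
Variable c : T -> R.
Hypothesis c_measurable : measurable_fun setT c.
Hypothesis c_ge0 : forall x, 0 <= c x.
Local Notation cut := (cutoff c).

Lemma cut_in n f x : c x <= n%:R -> cut n f x = f x.
Proof. by move=> cn; rewrite /cutoff indicE mem_set// mul1r. Qed.

Lemma cut_out n f x : n%:R < c x -> cut n f x = 0.
Proof.
by move=> cn; rewrite /cutoff indicE memNset ?mul0r// /bounded_part /= leNgt cn.
Qed.

Lemma cmeasurable_cut n f : cmeasurable f -> cmeasurable (cut n f).
Proof.
move=> mf; apply: cmeasurableM_real => //; apply: measurable_indic.
exact: bounded_part_measurable.
Qed.

Lemma sqn_cut_le n f x : sqn (cut n f x) <= sqn (f x).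
Proof.
have [cn|cn] := leP (c x) n%:R; first by rewrite cut_in.
by rewrite cut_out// {1}/sqn /= expr0n addr0 sqn_ge0.
Qed.

Lemma speed_sqn_cut_le n f x : c x ^+ 2 * sqn (cut n f x) <= n%:R ^+ 2 * sqn (f x).
Proof.
have [cn|cn] := leP (c x) n%:R.
  rewrite cut_in// ler_wpM2r ?sqn_ge0// lerXn2r ?nnegrE//; exact: c_ge0.
by rewrite cut_out// {1}/sqn /= expr0n addr0 mulr0 mulr_ge0 ?sqn_ge0 ?exprn_ge0.
Qed.

Lemma cut_L2 n (f : L2_function m) : cut n f \in L2_pred m.
Proof.
apply: (L2_pred_dominated _ (L2_pred_integrable (L2_functionP f))).
  by apply: cmeasurable_cut; exact: L2_function_measurable.
by move=> x; exact: sqn_cut_le.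
Qed.

Lemma integral_cut_cvg (f : L2_function m) (e : R) : 0 < e ->
  exists n, (\int[m]_x (sqn (f x - cut n f x))%:E <= e%:E)%E.
Proof.
move=> e0; have mf := L2_function_measurable f.
have mcut n : cmeasurable (fun x => f x - cut n f x).
  have := cmeasurableD mf (cmeasurableZ (-1) (cmeasurable_cut n mf)).
  by rewrite scaleN1r.
have : (\int[m]_x (sqn (f x - cut n f x))%:E @[n --> \oo] --> \int[m]_x (cst 0%E x))%E.
  apply: (@dominated_cvg _ _ _ m setT measurableT
    (fun n x => (sqn (f x - cut n f x))%:E) (cst 0%E) (fun x => (sqn (f x))%:E)).
  - by move=> n; apply/measurable_EFinP; exact: cmeasurable_sqn.
  - move=> x _; apply: (@cvg_trans _ ((fun=> 0%E : \bar R) n @[n --> \oo])).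
      apply: near_eq_cvg; exists (Num.bound (c x)) => // n /= cn.
      rewrite cut_in ?subrr; first by rewrite /sqn /= expr0n addr0.
      rewrite (@le_trans _ _ (Num.bound (c x))%:R) ?ler_nat//.
      by rewrite ltW// archi_boundP.
    exact: cvg_cst.
  - by [].
  - exact: (L2_pred_integrable (L2_functionP f)).
  - move=> n x _; rewrite gee0_abs ?lee_fin ?sqn_ge0//.
    have [cn|cn] := leP (c x) n%:R; last by rewrite cut_out// subr0.
    by rewrite cut_in// subrr {1}/sqn /= expr0n addr0 sqn_ge0.
rewrite integral0 => cv0.
have nb : nbhs (0%E : \bar R) [set y | (y < e%:E)%E].
  by apply: open_nbhs_nbhs; split; [exact: open_ereal_lt_ereal|rewrite /= lte_fin].
have [n _ /(_ n (leqnn n)) /= /ltW ne] := cv0 _ nb.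
by exists n.
Qed.

End cutoffs.

(** A measure-preserving bijection [flow] with inverse [coflow], and a
    nonnegative weight that is constant along its orbits. The weighted
    composition operator [f |-> speed * (f \o flow)] is then the product of a
    unitary operator and a commuting nonnegative one. *)
Record invariant_system := InvariantSystem {
  flow : T -> T;
  coflow : T -> T;
  speed : T -> R;
  flow_measurable : measurable_fun setT flow;
  coflow_measurable : measurable_fun setT coflow;
  speed_measurable : measurable_fun setT speed;
  flowK : cancel flow coflow;
  coflowK : cancel coflow flow;
  flow_invariant : forall A, measurable A -> m (flow @^-1` A) = m A;
  speed_ge0 : forall x, 0 <= speed x;
  speed_flow : forall x, speed (flow x) = speed x }.

Lemma coflow_invariant (s : invariant_system) A : measurable A ->
  m (coflow s @^-1` A) = m A.
Proof.
move=> mA; rewrite -(flow_invariant s); last first.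
  by rewrite -[X in measurable X]setTI; exact: coflow_measurable.
by congr (m _); apply/seteqP; split=> x /=; rewrite flowK.
Qed.

Lemma speed_coflow (s : invariant_system) x : speed s (coflow s x) = speed s x.
Proof. by rewrite -[in RHS](coflowK s x) speed_flow. Qed.

Definition reversed (s : invariant_system) : invariant_system :=
  InvariantSystem (coflow_measurable s) (flow_measurable s) (speed_measurable s)
    (coflowK s) (flowK s) (@coflow_invariant s) (speed_ge0 s) (@speed_coflow s).

(** The operator acts on classes, and a pair belongs to its graph as soon as
    some representatives are related pointwise. *)
Definition weighted_graph (s : invariant_system) : set (H * H) :=
  [set p | exists f g : L2_function m, [/\ p.1 = cl f, p.2 = cl g &
    forall x, g x = (speed s x)%:C * f (flow s x)]].

Section one_system.
Variable s : invariant_system.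
Local Notation tau := (flow s).
Local Notation c := (speed s).

Lemma ge0_integral_flow (F : T -> \bar R) : measurable_fun setT F ->
  (forall x, 0 <= F x)%E -> (\int[m]_x F (tau x) = \int[m]_x F x)%E.
Proof.
move=> mF F0.
have := ge0_integral_pushforward (flow_measurable s) m measurableT mF (fun x _ => F0 x).
rewrite preimage_setT /= => <-.
apply: eq_measure_integral => [|mt A mA _]; first exact: flow_measurable.
by rewrite -[RHS](flow_invariant s mA).
Qed.

Lemma Rintegral_flow (F : T -> R) : measurable_fun setT F ->
  m.-integrable setT (EFin \o (F \o tau)) ->
  \int[m]_x F (tau x) = \int[m]_x F x.
Proof.
move=> mF Fi; rewrite /Rintegral; congr fine.
have mFE : measurable_fun setT (EFin \o F) by exact/measurable_EFinP.
have := @integral_pushforward _ _ _ _ _ _ (flow_measurable s) m setT _ mFE.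
rewrite preimage_setT => /(_ Fi measurableT) /= <-.
apply: eq_measure_integral => [|mt A mA _]; first exact: flow_measurable.
by rewrite -[RHS](flow_invariant s mA).
Qed.

Lemma weighted_sqn_integral (f : T -> R[i]) : cmeasurable f ->
  (\int[m]_x (sqn ((c x)%:C * f (tau x)))%:E = \int[m]_x (c x ^+ 2 * sqn (f x))%:E)%E.
Proof.
move=> mf; rewrite -(ge0_integral_flow (F := fun x => (c x ^+ 2 * sqn (f x))%:E)).
- by apply: eq_integral => x _; rewrite sqnM sqn_real speed_flow.
- apply/measurable_EFinP; apply: measurable_funM.
    by apply: measurable_funX; exact: speed_measurable.
  exact: cmeasurable_sqn.
- by move=> x; rewrite lee_fin mulr_ge0 ?sqr_ge0 ?sqn_ge0.
Qed.

Lemma cmeasurable_flow (f : T -> R[i]) : cmeasurable f -> cmeasurable (f \o tau).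
Proof.
move=> [mre mim]; split.
  exact: (measurableT_comp mre (flow_measurable s)).
exact: (measurableT_comp mim (flow_measurable s)).
Qed.

Lemma cmeasurable_weighted (f : T -> R[i]) : cmeasurable f ->
  cmeasurable (fun x => (c x)%:C * f (tau x)).
Proof.
move=> mf; apply: (cmeasurableM_real (speed_measurable s)).
exact: cmeasurable_flow.
Qed.

Lemma weighted_L2 (f : T -> R[i]) : cmeasurable f ->
  (\int[m]_x (c x ^+ 2 * sqn (f x))%:E < +oo)%E ->
  (fun x => (c x)%:C * f (tau x)) \in L2_pred m.
Proof.
move=> mf fi; apply/L2_predP; split; first exact: cmeasurable_weighted.
by rewrite weighted_sqn_integral.
Qed.

Lemma weighted_functional (f g f' g' : L2_function m) :
  (forall x, g x = (c x)%:C * f (tau x)) ->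
  (forall x, g' x = (c x)%:C * f' (tau x)) -> cl f = cl f' -> cl g = cl g'.
Proof.
move=> gE g'E /L2_class_eq ff'; apply/L2_class_eq.
have mff' : cmeasurable (fun x => f x - f' x) := L2_function_measurable (f - f').
rewrite (eq_integral (fun x => (sqn ((c x)%:C * (f (tau x) - f' (tau x))))%:E)); last first.
  by move=> x _; rewrite gE g'E mulrBr.
rewrite (weighted_sqn_integral mff') integral_eq0_mul//.
- by apply: measurable_funX; exact: speed_measurable.
- exact: cmeasurable_sqn.
- by move=> x; exact: sqn_ge0.
Qed.

Let weighted_graph0 : weighted_graph s (0, 0).
Proof.
exists 0, 0; rewrite !raddf0; split=> // x.
by rewrite -[L2_val 0 x]/(0 : R[i]) -[L2_val 0 (tau x)]/(0 : R[i]) mulr0.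
Qed.

Let weighted_graph_linear (a : R[i]) (p q : H * H) :
  weighted_graph s p -> weighted_graph s q ->
  weighted_graph s (a *: p.1 + q.1, a *: p.2 + q.2).
Proof.
move=> [f [g [-> -> gE]]] [f' [g' [-> -> g'E]]].
exists (a *: f + f'), (a *: g + g'); rewrite !linearP; split=> // x.
rewrite -[LHS]/(a * g x + g' x) -[L2_val _ (tau x)]/(a * f (tau x) + f' (tau x)).
by rewrite gE g'E; ring.
Qed.

Let weighted_graph_functional (f g h : H) :
  weighted_graph s (f, g) -> weighted_graph s (f, h) -> g = h.
Proof.
move=> [f1 [g1 [/= -> -> g1E]]] [f2 [g2 [/= f12 -> g2E]]].
exact: (weighted_functional g1E g2E).
Qed.

Definition weighted_op : linop H :=
  LinOp weighted_graph0 weighted_graph_linear weighted_graph_functional.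

End one_system.

Lemma Re_semidot (f g : L2_function m) :
  complex.Re (L2_semidot f g) = \int[m]_x dot_re (f x) (g x).
Proof. by []. Qed.

Section weighted_cutoff.
Variable s : invariant_system.
Local Notation tau := (flow s).
Local Notation c := (speed s).
Local Notation cut := (cutoff c).

Lemma weighted_cut_L2 n (f : T -> R[i]) : f \in L2_pred m ->
  (fun x => (c x)%:C * cut n f (tau x)) \in L2_pred m.
Proof.
move=> fL; have /L2_predP[mf fi] := fL.
apply: weighted_L2; first by apply: cmeasurable_cut => //; exact: speed_measurable.
apply: (@le_lt_trans _ _ (\int[m]_x ((n%:R ^+ 2)%:E * (sqn (f x))%:E))%E).
  apply: ge0_le_integral => //.
  - by move=> x _; rewrite lee_fin mulr_ge0 ?sqr_ge0 ?sqn_ge0.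
  - apply/measurable_EFinP; apply: measurable_funM.
      by apply: measurable_funX; exact: speed_measurable.
    by apply: cmeasurable_sqn; by apply: cmeasurable_cut => //; exact: speed_measurable.
  - by apply: measurable_funeM; apply/measurable_EFinP; exact: cmeasurable_sqn.
  - by move=> x _; rewrite -EFinM lee_fin; exact: (speed_sqn_cut_le (speed_ge0 s)).
rewrite ge0_integralZl//; last 2 first.
- by apply/measurable_EFinP; exact: cmeasurable_sqn.
- by move=> x _; rewrite lee_fin sqn_ge0.
by rewrite lte_mul_pinfty ?lee_fin ?exprn_ge0.
Qed.

End weighted_cutoff.

Section adjoint.
Variable s : invariant_system.
Local Notation tau := (flow s).
Local Notation sigma := (coflow s).
Local Notation c := (speed s).
Local Notation cut := (cutoff c).

Lemma weighted_dom_dense : dense (dom (weighted_graph s)).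
Proof.
apply: dense_dotvP => F e e0; have -> : F = cl (representative F) by rewrite representativeK.
set f := representative F; have [n fn] := integral_cut_cvg (speed_measurable s) (speed_ge0 s) f e0.
exists (cl (L2Function (cut_L2 (speed_measurable s) n f))).
  exists (cl (L2Function (@weighted_cut_L2 s n _ (L2_functionP f)))).
  by exists (L2Function (cut_L2 (speed_measurable s) n f)), (L2Function (@weighted_cut_L2 s n _ (L2_functionP f))).
by rewrite -raddfB dotv_class L2_semidot_le.
Qed.

(** Change of variables along the flow. *)
Lemma adjoint_weighted_sup : weighted_graph (reversed s) `<=` adjoint (weighted_graph s).
Proof.
move=> p [g [k [p1 p2 kE]]] q [f [h [q1 q2 hE]]]; rewrite p1 p2 q1 q2 !dotv_class /=.
have inv (F : T -> R) : measurable_fun setT F -> 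
    m.-integrable setT (EFin \o (F \o tau)) -> \int[m]_x F (tau x) = \int[m]_x F x.
  exact: Rintegral_flow.
have [fre fim] := L2_function_measurable f; have [kre kim] := L2_function_measurable k.
have kflow x : k (tau x) = (c x)%:C * g x by rewrite kE /= flowK speed_flow.
rewrite /L2_semidot; congr (_ +i* _).
- rewrite -(inv (fun x => dot_re (f x) (k x))).
  + apply: eq_Rintegral => x _; rewrite kflow hE /dot_re.
    by case: (f (tau x)) (g x) => a b [a' b'] /=; ring.
  + by apply: measurable_funD; apply: measurable_funM.
  + rewrite (_ : _ \o _ = EFin \o (fun x => dot_re (h x) (g x))).
      exact: dot_re_integrable.
    apply/funext => x /=; rewrite kflow hE /dot_re; congr _%:E.
    by case: (f (tau x)) (g x) => a b [a' b'] /=; ring.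
- rewrite -(inv (fun x => dot_im (f x) (k x))).
  + apply: eq_Rintegral => x _; rewrite kflow hE /dot_im.
    by case: (f (tau x)) (g x) => a b [a' b'] /=; ring.
  + by apply: measurable_funB; apply: measurable_funM.
  + rewrite (_ : _ \o _ = EFin \o (fun x => dot_im (h x) (g x))).
      exact: dot_im_integrable.
    apply/funext => x /=; rewrite kflow hE /dot_im; congr _%:E.
    by case: (f (tau x)) (g x) => a b [a' b'] /=; ring.
Qed.

(** Let [(g, k)] be in the adjoint and [k' = speed * (g \o coflow)]. The defect
    [e = k - k'] is not known to be square-integrable, but its truncations
    are; tested against the truncation of [e], which lies in the domain, the
    equation of the adjoint says that this truncation has norm 0. So [e] is
    almost everywhere 0, and [k'] is square-integrable because [k] is. *)
Lemma adjoint_weighted_sub : adjoint (weighted_graph s) `<=` weighted_graph (reversed s).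
Proof.
move=> p padj; pose g := representative p.1; pose k := representative p.2.
have p1 : p.1 = cl g by rewrite representativeK.
have p2 : p.2 = cl k by rewrite representativeK.
have mg := L2_function_measurable g; have mk := L2_function_measurable k.
pose k' x := (c x)%:C * g (sigma x).
have mk' : cmeasurable k' := @cmeasurable_weighted (reversed s) _ mg.
pose e x := k x - k' x.
have me : cmeasurable e.
  by have := cmeasurableD mk (cmeasurableZ (-1) mk'); rewrite scaleN1r.
have cutk'L n : cut n k' \in L2_pred m.
  rewrite (_ : cut n k' = fun x => (c x)%:C * cut n g (sigma x)).
    exact: (@weighted_cut_L2 (reversed s) n g (L2_functionP g)).
  apply/funext => x; rewrite /k'; have [cn|cn] := leP (c x) n%:R.
    by rewrite !cut_in ?speed_coflow.
  by rewrite !cut_out ?speed_coflow ?mulr0.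
have cute n : cut n e = cut n k - cut n k'.
  apply/funext => x; rewrite -[RHS]/(cut n k x - cut n k' x) /e.
  have [cn|cn] := leP (c x) n%:R; first by rewrite !cut_in.
  by rewrite !cut_out ?subrr.
have cuteL n : cut n e \in L2_pred m.
  by rewrite cute rpredB//; apply: cut_L2; exact: speed_measurable.
have cut0 n : (\int[m]_x (sqn (cut n e x))%:E = 0)%E.
  pose f := L2Function (cuteL n).
  pose h := L2Function (@weighted_cut_L2 s n _ (cuteL n)).
  have hE x : h x = (c x)%:C * f (tau x).
    rewrite /= ; have [cn|cn] := leP (c x) n%:R; first by rewrite cut_in ?speed_flow.
    by rewrite !cut_out ?speed_flow.
  have := padj (cl f, cl h) (ex_intro _ f (ex_intro _ h (And3 erefl erefl hE))).
  rewrite p1 p2 !dotv_class => /(congr1 (@complex.Re R)); rewrite !Re_semidot => hgfk.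
  have fk' : \int[m]_x dot_re (h x) (g x) = \int[m]_x dot_re (f x) (L2Function (cutk'L n) x).
    have reE x : dot_re (h x) (g x) =
        dot_re (f (tau x)) (L2Function (cutk'L n) (tau x)).
      rewrite hE /=; have [cn|cn] := leP (c x) n%:R; last first.
        by rewrite !cut_out ?speed_flow// mulr0 /dot_re /= !mul0r.
      rewrite !cut_in ?speed_flow// /k' speed_flow flowK /dot_re.
      by case: (e (tau x)) (g x) => a b [a' b'] /=; ring.
    rewrite -(@Rintegral_flow s (fun x => dot_re (f x) (L2Function (cutk'L n) x))).
    - by apply: eq_Rintegral => x _; exact: reE.
    - have [fre fim] := L2_function_measurable f.
      have [kre kim] := L2_function_measurable (L2Function (cutk'L n)).
      by apply: measurable_funD; apply: measurable_funM.
    - rewrite (_ : _ \o _ = EFin \o (fun x => dot_re (h x) (g x))).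
        exact: dot_re_integrable.
      by apply/funext => x /=; rewrite -reE.
  have : L2_semidot f f = 0.
    rewrite L2_semidotE; congr (_%:C).
    rewrite (@eq_Rintegral _ _ _ _ _ (fun x =>
      dot_re (f x) (k x) - dot_re (f x) (L2Function (cutk'L n) x))).
      rewrite RintegralB//; [|exact: dot_re_integrable|exact: dot_re_integrable].
      by rewrite -hgfk fk' subrr.
    move=> x _ /=; have [cn|cn] := leP (c x) n%:R; last first.
      by rewrite !cut_out// /dot_re /sqn /= expr0n !mul0r !addr0 subrr.
    rewrite !cut_in// /e /dot_re /sqn.
    by case: (k x) (k' x) => a b [a' b'] /=; ring.
  by move=> f0; have := L2_semidotEFin f; rewrite f0.
have e0 : (\int[m]_x (sqn (e x))%:E = 0)%E.
  have mse : measurable_fun setT (fun x => (sqn (e x))%:E).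
    by apply/measurable_EFinP; exact: cmeasurable_sqn.
  have eae : ae_eq m setT (fun x => (sqn (e x))%:E) (cst 0%E).
    have /ae_foralln : forall n, {ae m, forall x, sqn (cut n e x) = 0}.
      move=> n; have msn : measurable_fun setT (fun x => (sqn (cut n e x))%:E).
        by apply/measurable_EFinP; apply: cmeasurable_sqn; apply: cmeasurable_cut => //; exact: speed_measurable.
      have /(ae_eq_integral_abs m measurableT msn) :
          (\int[m]_x `|(sqn (cut n e x))%:E| = 0)%E.
        rewrite -[RHS](cut0 n); apply: eq_integral => x _.
        by rewrite gee0_abs// lee_fin sqn_ge0.
      by apply: filterS => x /= /(_ Logic.I) [].
    apply: filterS => x hx _ /=; congr _%:E.
    rewrite -(hx (Num.bound (c x))) cut_in//.
    by rewrite ltW// archi_boundP// speed_ge0.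
  by rewrite -(integral0 m setT); apply: ae_eq_integral.
have k'L : k' \in L2_pred m.
  apply: (@L2_pred_dominated _ _ _ m k' (fun x => 2 * (sqn (k x) + sqn (e x)))) => //.
    have ei : m.-integrable setT (fun x => (sqn (e x))%:E).
      by apply: L2_pred_integrable; apply/L2_predP; rewrite e0 ltry.
    have := integrableZl measurableT 2
      (integrableD measurableT (L2_pred_integrable (L2_functionP k)) ei).
    by [].
  move=> x; have -> : k' x = k x + - e x by rewrite /e opprB addrC subrK.
  by apply: le_trans (sqnD_le _ _) _; rewrite sqnN.
exists g, (L2Function k'L); split=> //.
by rewrite p2; apply/L2_class_eq.
Qed.

Lemma adjoint_weighted : adjoint (weighted_graph s) = weighted_graph (reversed s).
Proof. by apply/seteqP; split; [exact: adjoint_weighted_sub|exact: adjoint_weighted_sup]. Qed.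

Lemma integral_mul_class (k : T -> R) (g g' : L2_function m) :
  measurable_fun setT k -> cl g = cl g' ->
  (\int[m]_x (k x * sqn (g x))%:E = \int[m]_x (k x * sqn (g' x))%:E)%E.
Proof.
move=> mk /L2_class_eq gg'.
have mgg' : cmeasurable (fun x => g x - g' x) := L2_function_measurable (g - g').
have ms : measurable_fun setT (fun x => (sqn (g x - g' x))%:E).
  by apply/measurable_EFinP; exact: cmeasurable_sqn.
have /(ae_eq_integral_abs m measurableT ms) gae :
    (\int[m]_x `|(sqn (g x - g' x))%:E| = 0)%E.
  rewrite -[RHS]gg'; apply: eq_integral => x _.
  by rewrite gee0_abs// lee_fin sqn_ge0.
apply: ae_eq_integral => //.
- apply/measurable_EFinP; apply: measurable_funM => //.
  by apply: cmeasurable_sqn; exact: L2_function_measurable.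
- apply/measurable_EFinP; apply: measurable_funM => //.
  by apply: cmeasurable_sqn; exact: L2_function_measurable.
apply: filterS gae => x /= /(_ Logic.I) [/sqn_eq0/eqP].
by rewrite subr_eq0 => /eqP -> _.
Qed.

(** Both products multiply by the square of the speed. What has to be checked is
    that the intermediate function of the other order is square-integrable,
    and its norm is that of the given intermediate function because the
    speed is invariant. *)
Lemma weighted_commute : ((weighted_graph (reversed s) \; weighted_graph s) `<=`
  (weighted_graph s \; weighted_graph (reversed s)))%relation.
Proof.
move=> p [q [f [g [/= p1 q1 gE]]] [g' [h [/= q2 p2 hE]]]].
have mf := L2_function_measurable f; have mg := L2_function_measurable g.
have mc2 : measurable_fun setT (fun x => c x ^+ 2).
  by apply: measurable_funX; exact: speed_measurable.
have h'L : (fun x => (c x)%:C * g (sigma x)) \in L2_pred m.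
  apply: (@weighted_L2 (reversed s)) => //.
  rewrite (integral_mul_class mc2 (etrans (esym q1) q2)).
  rewrite -(@weighted_sqn_integral (reversed s) _ (L2_function_measurable g')).
  have := L2_function_lt h; congr (_ < _)%E; apply: eq_integral => x _.
  by rewrite hE.
have kL : (fun x => (c x)%:C * f (sigma x)) \in L2_pred m.
  apply: (@weighted_L2 (reversed s)) => //.
  rewrite -(@weighted_sqn_integral s _ mf).
  have := L2_function_lt g; congr (_ < _)%E; apply: eq_integral => x _.
  by rewrite gE.
exists (cl (L2Function kL)); first by exists f, (L2Function kL).
exists (L2Function kL), (L2Function h'L); split=> //=.
  rewrite p2; apply: (@weighted_functional (reversed s) g' h g (L2Function h'L)) => //.
  by rewrite -q1 -q2.
by move=> x; rewrite gE coflowK flowK speed_coflow speed_flow.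
Qed.

End adjoint.

(** Since reversing the system twice gives it back, the operator is itself an
    adjoint, hence closed. *)
Theorem weighted_op_normal (s : invariant_system) : normal_op (weighted_op s).
Proof.
have adj : adjoint (graph (weighted_op s)) = weighted_graph (reversed s).
  exact: adjoint_weighted.
split.
- exact: weighted_dom_dense.
- rewrite (_ : graph _ = adjoint (weighted_graph (reversed s))).
    exact: adjoint_closed.
  by rewrite adjoint_weighted; case: (s).
- rewrite adj; apply/seteqP; split; first exact: weighted_commute.
  exact: (@weighted_commute (reversed s)).
Qed.

End weighted_composition.

Lemma dotv_L2E d (X : measurableType d) (R : realType) (mu : discrete_measure X R)
  (f : L2 mu) : dotv f f = (\int[mu]_x sqn (f x))%:C.
Proof.
rewrite -[dotv f f]/(L2_dot f f) /L2_dot; congr (_ +i* _).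
  apply: eq_Rintegral => x _; case: (f x) => a b.
  by rewrite -[_^*%R]/(a -i* b) /sqn /= mulrN opprK !expr2.
rewrite (@eq_Rintegral _ _ _ _ _ (cst 0)); last first.
  move=> x _; case: (f x) => a b.
  by rewrite -[_^*%R]/(a -i* b) /= mulrN addrC mulrC subrr.
by rewrite /Rintegral integral0.
Qed.

(** A composition operator is subnormal when it has a weighted composition
    operator as a dilation: the symbol [phi] is a factor of the flow through
    [pi], and [f |-> w * (f \o pi)] is an isometry that intertwines the two
    operators thanks to the cocycle equation for [w]. *)
Section subnormality_criterion.
Context d (X : measurableType d) (R : realType) (mu : discrete_measure X R) (phi : X -> X).
Context d' (T : measurableType d') (m : {measure set T -> \bar R}) (s : invariant_system m).
Context (pi : T -> X) (w : T -> R).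
Hypothesis pi_measurable : measurable_fun setT pi.
Hypothesis w_measurable : measurable_fun setT w.
Hypothesis pi_flow : forall x, pi (flow s x) = phi (pi x).
Hypothesis w_flow : forall x, w x = speed s x * w (flow s x).
Hypothesis pi_integral : forall F : X -> R, (forall x, 0 <= F x) ->
  (\int[m]_x (w x ^+ 2 * F (pi x))%:E = \int[mu]_x (F x)%:E)%E.

Let measurable_any d1 (T1 : measurableType d1) (g : X -> T1) : measurable_fun setT g.
Proof. by move=> _ Y _; exact: discrete_measure_all mu _. Qed.

Let lift_val (f : L2 mu) : T -> R[i] := fun x => (w x)%:C * f (pi x).

Let lift_integral (f : L2 mu) :
  (\int[m]_x (sqn (lift_val f x))%:E = \int[mu]_x (Normc.normc (f x) ^+ 2)%:E)%E.
Proof.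
rewrite -pi_integral; last by move=> x; exact: sqr_ge0.
by apply: eq_integral => x _; rewrite sqnM sqn_real sqn_normc.
Qed.

Let lift_L2 (f : L2 mu) : lift_val f \in L2_pred m.
Proof.
apply/L2_predP; split.
  apply: cmeasurableM_real => //.
  by split; [apply: (measurableT_comp (measurable_any (fun x => complex.Re (f x)))) |
             apply: (measurableT_comp (measurable_any (fun x => complex.Im (f x))))].
by rewrite lift_integral; have := valP f; rewrite inE.
Qed.

Let lift (f : L2 mu) : quotient_space (L2_semi_inner m) :=
  class (L2_semi_inner m) (L2Function (lift_L2 f)).

Let lift_linear : linear lift.
Proof.
move=> a f g; rewrite /lift -linearP; congr class; apply/val_inj/funext => x /=.
rewrite -[RHS]/(a * lift_val f x + lift_val g x) /lift_val.
by rewrite -[L2_fun _ (pi x)]/(a * f (pi x) + g (pi x)); ring.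
Qed.

HB.instance Definition _ := GRing.isLinear.Build R[i] (L2 mu)
  (quotient_space (L2_semi_inner m)) _ lift lift_linear.

Let lift_norm (f : L2 mu) : `|lift f| = `|f|.
Proof.
apply/eqP; rewrite -(@eqrXn2 _ 2)// !sqr_normv dotv_class /= L2_semidotE.
rewrite dotv_L2E /Rintegral lift_integral; apply/eqP; congr ((fine _)%:C).
by apply: eq_integral => x _; rewrite sqn_normc.
Qed.

Theorem subnormal_composition : dense (dom (graph (composition_op mu phi))) ->
  subnormal (composition_op mu phi).
Proof.
move=> dC; split=> //.
exists (quotient_space (L2_semi_inner m)), lift, (weighted_op s); split.
- exact: lift_norm.
- exact: weighted_op_normal.
- move=> f g fg; exists (L2Function (lift_L2 f)), (L2Function (lift_L2 g)).
  split=> // x /=; rewrite /lift_val.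
  have -> : L2_fun g = L2_fun f \o phi by exact: fg.
  by rewrite /= pi_flow {1}w_flow rmorphM /= mulrA.
Qed.

End subnormality_criterion.


(** * Density of the smooth vectors *)

Section finite_support.
Context d (X : measurableType d) (R : realType) (mu : discrete_measure X R).

Lemma discrete_measurable_fun d' (Y : sigmaRingType d') (D : set X) (g : X -> Y) :
  measurable_fun D g.
Proof. by move=> _ A _; exact: discrete_measure_all mu _. Qed.

Lemma discrete_mass_lty x : (mu [set x] < +oo)%E.
Proof.
have [F FT Ffin] := sigma_finiteT mu.
have [n Fx] : exists n, F n x.
  have : [set: X] x by [].
  by rewrite FT => -[n _ Fx]; exists n.
have [mF Flt] := Ffin n.
apply: le_lt_trans Flt; apply: le_measure; rewrite ?inE //.
- exact: (discrete_measure_all mu).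
- by move=> _ ->.
Qed.

Definition mass x : R := fine (mu [set x]).

Lemma mass_gt0 x : 0 < mass x.
Proof. by rewrite fine_gt0// discrete_measure_gt0 discrete_mass_lty. Qed.

Lemma massE x : mu [set x] = (mass x)%:E.
Proof. by rewrite fineK// ge0_fin_numE// discrete_mass_lty. Qed.

Lemma finite_set_measure_lty (S : set X) : finite_set S -> (mu S < +oo)%E.
Proof.
move=> /finite_seqP[s ->]; elim: s => [|x s IH].
  by rewrite set_nil measure0 ltry.
have -> : [set` x :: s] = [set x] `|` [set` s].
  by apply/seteqP; split=> y /=; rewrite inE; [move=> /orP[/eqP|]; [left|right]|
    move=> [->|ys]; apply/orP; [left|right]].
apply: le_lt_trans (measureU2 _ _ _) _; try exact: (discrete_measure_all mu).
by rewrite lte_add_pinfty// discrete_mass_lty.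
Qed.

Lemma finite_support_L2 (g : X -> R[i]) (S : set X) : finite_set S ->
  (forall x, g x != 0 -> S x) -> g \in square_integrable mu.
Proof.
move=> Sfin gS; have /finite_seqP[s Ss] := Sfin.
pose C := \sum_(y <- s) Normc.normc (g y) ^+ 2.
have gC x : Normc.normc (g x) ^+ 2 <= C * \1_S x.
  have [gx0|gx] := eqVneq (g x) 0.
    rewrite gx0 Normc.normc0 expr0n /= mulr_ge0 ?indicE//.
    by rewrite sumr_ge0// => y _; rewrite sqr_ge0.
  have Sx := gS x gx; rewrite indicE mem_set// mulr1.
  have xs : x \in s by move: Sx; rewrite Ss.
  rewrite /C (big_rem x)//= lerDl sumr_ge0// => y _; exact: sqr_ge0.
rewrite inE; apply: (@le_lt_trans _ _ (\int[mu]_x (C%:E * (\1_S x)%:E))%E).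
  apply: ge0_le_integral => //.
  - by move=> x _; rewrite lee_fin sqr_ge0.
  - exact: discrete_measurable_fun.
  - exact: discrete_measurable_fun.
  - by move=> x _; rewrite -EFinM lee_fin gC.
have C0 : 0 <= C by rewrite sumr_ge0// => y _; rewrite sqr_ge0.
have mS : measurable S by exact: (discrete_measure_all mu).
rewrite ge0_integralZl//; last exact: discrete_measurable_fun.
rewrite integral_indic// setIT.
by rewrite lte_mul_pinfty ?lee_fin// finite_set_measure_lty.
Qed.

End finite_support.

(** [rank] is any enumeration of the set by finite levels, used to truncate a
    function to finite support. *)
Section dense_domain.
Context d (X : measurableType d) (R : realType) (mu : discrete_measure X R) (phi : X -> X).
Context (rank : X -> nat).
Hypothesis rank_finite : forall n, finite_set [set x | (rank x <= n)%N].
Hypothesis phi_finite : forall S, finite_set S -> finite_set (phi @^-1` S).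

Lemma iter_preimage_finite n S : finite_set S -> finite_set (iter n phi @^-1` S).
Proof.
elim: n S => [|n IH] S Sfin //; have := IH _ (phi_finite Sfin).
by congr (finite_set _).
Qed.

(** Finite fibres keep the support finite under every power of the operator. *)
Lemma finite_support_dom_infty (g : L2 mu) (S : set X) : finite_set S ->
  (forall x, g x != 0 -> S x) -> dom_infty (graph (composition_op mu phi)) g.
Proof.
move=> Sfin gS n _.
have L2n k : (g : X -> R[i]) \o iter k phi \in square_integrable mu.
  apply: (finite_support_L2 mu (iter_preimage_finite k Sfin)) => x; exact: gS.
exists (MkL2 (L2n n)); elim: n => [|n IH]; first exact/val_inj.
by exists (MkL2 (L2n n)) => //; apply/funext => x /=; rewrite -iterSr.
Qed.

Theorem composition_dom_infty_dense : dense (dom_infty (graph (composition_op mu phi))).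
Proof.
have mr : measurable_fun setT (fun x => (rank x)%:R : R) by exact: (discrete_measurable_fun mu).
apply: dense_dotvP => f e e0.
have fL : (f : X -> R[i]) \in L2_pred mu.
  apply/L2_predP; split; first by split; exact: (discrete_measurable_fun mu).
  have := valP f; rewrite inE; congr (_ < _)%E.
  by apply: eq_integral => x _; rewrite sqn_normc.
have [n fn] := integral_cut_cvg mr (fun x => ler0n _ (rank x)) (L2Function fL) e0.
pose g := cutoff (fun x => (rank x)%:R : R) n f.
have gS x : g x != 0 -> [set x | (rank x <= n)%N] x.
  apply: contra_neqP => /negP; rewrite -ltnNge => nx.
  by rewrite /g cut_out// ltr_nat.
have gL := finite_support_L2 mu (rank_finite n) gS.
exists (MkL2 gL); first by apply: (finite_support_dom_infty (rank_finite n)) => x; exact: gS.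
rewrite dotv_L2E lecR /Rintegral -lee_fin fineK//.
by rewrite ge0_fin_numE ?(le_lt_trans fn) ?ltry// integral_ge0// => x _; rewrite lee_fin sqn_ge0.
Qed.

End dense_domain.


(** * Measures with densities and finite sums of measures *)

Section density.
Context d (T : measurableType d) (R : realType).
Import HBNNSimple.

(** The density is only known on the measurable subsets of [D], which is the form
    in which the consistency condition provides it. *)
Lemma ge0_integral_density (nu Q : {measure set T -> \bar R}) (D : set T)
    (k : T -> R) (f : T -> \bar R) :
  measurable D -> measurable_fun D k -> (forall x, D x -> 0 <= k x) ->
  (forall A, measurable A -> A `<=` D -> Q A = \int[nu]_(x in A) (k x)%:E)%E ->
  measurable_fun D f -> (forall x, D x -> 0 <= f x)%E ->
  (\int[Q]_(x in D) f x = \int[nu]_(x in D) (f x * (k x)%:E))%E.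
Proof.
move=> mD mk k0 QE mf f0; pose h := nnsfun_approx mD mf.
have mkE : measurable_fun D (fun x => (k x)%:E) by exact/measurable_EFinP.
have -> : (\int[Q]_(x in D) f x = limn (fun n => \int[Q]_(x in D) (h n x)%:E))%E.
  rewrite -monotone_convergence//=.
  - apply: eq_integral => x /[!inE] xD; apply/esym/cvg_lim => //=.
    exact: cvg_nnsfun_approx.
  - by move=> n; exact/measurable_EFinP/measurable_funTS.
  - by move=> n x _; rewrite lee_fin.
  - by move=> x _ a b ab; rewrite lee_fin//; exact/lefP/nd_nnsfun_approx.
have -> : (\int[nu]_(x in D) (f x * (k x)%:E) =
    limn (fun n => \int[nu]_(x in D) ((h n x)%:E * (k x)%:E)))%E.
  rewrite -monotone_convergence//=.
  - apply: eq_integral => x /[!inE] xD; apply/esym/cvg_lim => //=.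
    by apply: cvgeZr => //; exact: cvg_nnsfun_approx.
  - by move=> n; apply: emeasurable_funM => //; exact/measurable_EFinP/measurable_funTS.
  - by move=> n x Dx; rewrite mule_ge0// lee_fin ?k0.
  - move=> x Dx a b ab; rewrite lee_wpmul2r ?lee_fin ?k0//.
    exact/lefP/nd_nnsfun_approx.
congr (limn _); apply/funext => n.
have mind r : measurable (h n @^-1` [set r]) by [].
have mindf r : measurable_fun D (fun x => (\1_(h n @^-1` [set r]) x)%:E : \bar R).
  by apply/measurable_EFinP/measurable_funTS; exact: measurable_indic.
transitivity (\sum_(r \in range (h n)) (r%:E * Q (h n @^-1` [set r] `&` D)))%E.
  under eq_integral do rewrite fimfunE -fsumEFin//.
  rewrite ge0_integral_fsum//; last 2 first.
  - by move=> r; apply/measurable_EFinP/measurable_funTS; exact: measurable_funM.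
  - by move=> r x _; rewrite nnfun_muleindic_ge0.
  by apply: eq_fsbigr => r _; rewrite integralZl_indic_nnsfun// integral_indic.
under eq_integral => x xD.
  rewrite fimfunE -fsumEFin// ge0_mule_fsuml; last first.
    by move=> r; rewrite nnfun_muleindic_ge0.
  over.
rewrite ge0_integral_fsum//; last 2 first.
- move=> r; apply: emeasurable_funM => //.
  by apply/measurable_EFinP/measurable_funTS; exact: measurable_funM.
- by move=> r x Dx; rewrite mule_ge0 ?nnfun_muleindic_ge0// lee_fin k0.
apply: eq_fsbigr => r /[!inE] -[x _ xr].
have r0 : 0 <= r by rewrite -xr.
under [RHS]eq_integral do rewrite EFinM -muleA.
rewrite ge0_integralZl//; last 2 first.
- exact: emeasurable_funM.
- by move=> y Dy; rewrite mule_ge0// ?lee_fin ?k0// indicE.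
congr (_ * _)%E; rewrite QE; last 2 first.
- exact: measurableI.
- exact: subIsetr.
rewrite integral_mkcondl; apply: eq_integral => y _.
rewrite /patch indicE; case: ifPn => _; first by rewrite mul1e.
by rewrite mul0e.
Qed.

Lemma density_measure (nu : {measure set T -> \bar R}) (k : T -> R) :
  measurable_fun setT k -> (forall x, 0 <= k x) ->
  exists Q : {measure set T -> \bar R},
    forall A, measurable A -> (Q A = \int[nu]_(x in A) (k x)%:E)%E.
Proof.
move=> mk k0; pose q A := (\int[nu]_(x in A) (k x)%:E)%E.
have mkE D : measurable_fun D (fun x => (k x)%:E).
  by apply/measurable_EFinP; exact: measurable_funTS.
have q0 : q set0 = 0%E by rewrite /q integral_set0.
have qge0 A : (0 <= q A)%E by apply: integral_ge0 => x _; rewrite lee_fin.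
have qadd : semi_sigma_additive q.
  move=> F mF tF mUF; rewrite /q ge0_integral_bigcup//.
  - by apply: is_cvg_ereal_nneg_natsum_cond => n _ _; exact: qge0.
  - by move=> x _; rewrite lee_fin.
pose Q : {measure set T -> \bar R} := HB.pack q (isMeasure.Build _ _ _ q q0 qge0 qadd).
by exists Q.
Qed.

Lemma density_probability (nu : {measure set T -> \bar R}) (k : T -> R) :
  measurable_fun setT k -> (forall x, 0 <= k x) -> (\int[nu]_x (k x)%:E = 1)%E ->
  exists Q : probability T R,
    forall A, measurable A -> (Q A = \int[nu]_(x in A) (k x)%:E)%E.
Proof.
move=> mk k0 k1; have [Q QE] := density_measure nu mk k0.
have Q1 : Q setT = 1%E by rewrite QE.
exists (mnormalize Q (dirac (point : T))) => A mA.
by rewrite -QE// /= /mnormalize Q1 onee_eq0 /= invr1 mule1.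
Qed.

Lemma weighted_sum_measure (I : eqType) (s : seq I) (a : I -> R)
    (P : I -> {measure set T -> \bar R}) : (forall i, 0 <= a i) ->
  exists Q : {measure set T -> \bar R},
    (forall A, measurable A -> Q A = \sum_(i <- s) (a i)%:E * P i A)%E /\
    forall D f, measurable D -> measurable_fun D f -> (forall x, D x -> 0 <= f x)%E ->
      (\int[Q]_(x in D) f x = \sum_(i <- s) (a i)%:E * \int[P i]_(x in D) f x)%E.
Proof.
move=> a0; elim: s => [|i s [Q [QA Qf]]].
  exists mzero; split=> [A mA|D f mD mf f0]; first by rewrite big_nil.
  by rewrite big_nil integral_measure_zero.
pose ai : {nonneg R} := NngNum (a0 i).
exists (measure_add (mscale ai (P i)) Q); split=> [A mA|D f mD mf f0].
  by rewrite big_cons -QA//; apply: etrans (measure_addE _ _ _) _.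
rewrite big_cons -Qf// ge0_integral_measure_add//.
by rewrite ge0_integral_mscale.
Qed.

End density.

(** * The symbol and its iterated fibres *)

Section trunk_and_branch.
Context (kappa : nat).
Local Notation X := (X1 kappa).
Local Notation phi := (@phi1 kappa).
Local Notation root := (xtrunk ord0 : X).

(** On the trunk the symbol is a cyclic permutation of [kappa + 1] points; the
    branch is attached to the cycle at its last point. *)
Lemma phi1_trunk (r : 'I_kappa.+1) : phi (xtrunk r) = xtrunk (ord_pred r).
Proof.
rewrite /phi1; case: eqP => [->|/eqP r0]; congr xtrunk; apply/val_inj => /=.
  by rewrite modn_small.
have rpos : (0 < r)%N by rewrite lt0n.
rewrite inordK; last by rewrite (leq_ltn_trans (leq_pred _)).
by rewrite -(prednK rpos) addSn /= modnDr modn_small// (leq_ltn_trans (leq_pred _)).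
Qed.

Definition preimages (x : X) : seq X :=
  match x with
  | xtrunk r => xtrunk (ordS r) :: (if r == ord_max then [:: xbranch 0] else [::])
  | xbranch j => [:: xbranch j.+1]
  end.

Lemma mem_preimages x y : (y \in preimages x) = (phi y == x).
Proof.
have trunk_eq (p q : 'I_kappa.+1) : (xtrunk p == xtrunk q :> X) = (p == q).
  by apply/eqP/eqP => [[]|->].
have branch_eq (p q : nat) : (xbranch p == xbranch q :> X) = (p == q).
  by apply/eqP/eqP => [[]|->].
have tb (p : 'I_kappa.+1) (q : nat) : (xtrunk p == xbranch q :> X) = false.
  by apply/eqP.
have bt (p : 'I_kappa.+1) (q : nat) : (xbranch q == xtrunk p :> X) = false.
  by apply/eqP.
case: y => [q|j].
  rewrite phi1_trunk; case: x => [r|i] /=; last by rewrite inE !tb.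
  rewrite in_cons !trunk_eq (_ : _ \in _ = false) ?orbF; last first.
    by case: ifP => _; rewrite // inE tb.
  by apply/eqP/eqP => [->|<-]; rewrite ?ordSK ?ord_predK.
case: j => [|j]; case: x => [r|i] /=; rewrite inE ?tb ?bt ?trunk_eq ?branch_eq//=.
- by rewrite eq_sym; case: ifP; rewrite ?inE ?eqxx.
- by case: ifP; rewrite ?inE ?branch_eq.
Qed.

Lemma preimages_uniq x : uniq (preimages x).
Proof. by case: x => [r|j] //=; case: ifP => //= _; rewrite inE andbT; apply/eqP. Qed.

Lemma phi1_preimage x : phi @^-1` [set x] = [set` preimages x].
Proof. by apply/seteqP; split=> y /=; rewrite mem_preimages => /eqP. Qed.

Lemma phi1_preimage_finite (S : set X) : finite_set S -> finite_set (phi @^-1` S).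
Proof.
move=> /finite_seqP[s ->]; apply/finite_seqP.
exists (flatten (map preimages s)); apply/seteqP; split=> y /=.
  move=> ys; apply/flattenP; exists (preimages (phi y)); first exact: map_f.
  by rewrite mem_preimages.
by move=> /flattenP[_ /mapP[x xs ->]]; rewrite mem_preimages => /eqP ->.
Qed.

Lemma pickle_le_finite n : finite_set [set x : X | (pickle x <= n)%N].
Proof.
apply: (@sub_finite_set _ _ [set` pmap unpickle (iota 0 n.+1)]); last exact: finite_seq.
move=> x xn; suff : x \in pmap unpickle (iota 0 n.+1) by [].
by rewrite mem_pmap; apply/mapP; exists (pickle x); rewrite ?mem_iota ?pickleK.
Qed.

Lemma phi1_range x : range phi x.
Proof.
have : head x (preimages x) \in preimages x by case: x => [r|j] /=; rewrite inE eqxx.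
by rewrite mem_preimages => /eqP <-; exists (head x (preimages x)).
Qed.

Lemma iter_phi1_surj n x : exists y, iter n phi y = x.
Proof.
elim: n x => [|n IH] x; first by exists x.
have [y _ <-] := phi1_range x; have [z <-] := IH y.
by exists z; rewrite iterS.
Qed.

Section masses.
Context (R : realType) (mu : discrete_measure X R).
Local Notation mass := (mass mu).

Lemma esum_preimage x (g : X -> \bar R) : (forall y, 0 <= g y)%E ->
  (\esum_(y in phi @^-1` [set x]) g y = \sum_(y <- preimages x) g y)%E.
Proof.
move=> g0; rewrite phi1_preimage esum_fset//; last exact: finite_seq.
by rewrite -fsbig_seq// preimages_uniq.
Qed.

(** The mass of the [n]-th generation above [x], which is the value at [x] of the
    [n]-th Radon-Nikodym derivative times the mass of [x]. *)
Definition level n x : R := fine (mu (iter n phi @^-1` [set x])).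

Lemma level_lty n x : (mu (iter n phi @^-1` [set x]) < +oo)%E.
Proof.
apply: finite_set_measure_lty; apply: iter_preimage_finite => //.
exact: phi1_preimage_finite.
Qed.

Lemma levelE n x : mu (iter n phi @^-1` [set x]) = (level n x)%:E.
Proof. by rewrite fineK// ge0_fin_numE// level_lty. Qed.

Lemma level_gt0 n x : 0 < level n x.
Proof.
have [y yx] := iter_phi1_surj n x.
apply: lt_le_trans (mass_gt0 mu y) _; rewrite -lee_fin -massE -levelE.
by apply: le_measure; rewrite ?inE; do ?[exact: (discrete_measure_all mu)]; move=> _ ->.
Qed.

Lemma level0 x : level 0 x = mass x.
Proof. by []. Qed.

Lemma levelS n x : level n.+1 x = \sum_(y <- preimages x) level n y.
Proof.
apply: EFin_inj; rewrite -levelE -sumEFin.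
have -> : iter n.+1 phi @^-1` [set x] = iter n phi @^-1` [set` preimages x].
  by rewrite -phi1_preimage; apply/seteqP; split=> y.
have := preimages_uniq x; elim: (preimages x) => [_|y s IH /= /andP[ys us]].
  by rewrite big_nil set_nil preimage_set0 measure0.
rewrite big_cons -IH// -levelE -measureU; do ?[exact: (discrete_measure_all mu)].
  congr (mu _); apply/seteqP; split=> z /=; rewrite inE.
    by move=> /orP[/eqP|]; [left|right].
  by move=> [->|zs]; apply/orP; [left|right].
by rewrite -subset0 => z [/= -> ]; apply/negP.
Qed.

Lemma radon_nikodym_level n x :
  radon_nikodym_pow mu phi n x = (level n x / mass x)%:E.
Proof.
rewrite /radon_nikodym_pow levelE massE inver gt_eqF ?mass_gt0//.
Qed.

Lemma level_branch n j : level n (xbranch j) = mass (xbranch (j + n)).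
Proof.
elim: n j => [|n IH] j; first by rewrite addn0.
by rewrite levelS /= big_seq1 IH addSnnS.
Qed.

(** Going back [r] steps from the root there is a single point, because the
    branch is attached further along the cycle. *)
Lemma level_trunk n r : (r <= kappa)%N ->
  level (n + r) root = level n (xtrunk (inord r)).
Proof.
elim: r n => [|r IH] n rk.
  by rewrite addn0; congr (level _ (xtrunk _)); apply/val_inj; rewrite /= inordK.
rewrite -addSnnS IH ?(ltnW rk)// levelS /=.
have rS : (inord r : 'I_kappa.+1) != ord_max.
  by apply/eqP => /(congr1 val) /=; rewrite inordK ?(leqW rk)// => rE; rewrite rE ltnn in rk.
rewrite (negbTE rS) big_seq1; congr (level _ (xtrunk _)); apply/val_inj => /=.
by rewrite !inordK ?modn_small// leqW.
Qed.

(** After a full turn of the cycle the generations of the root return to the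
    root and enter the branch. *)
Lemma level_period n : level (n + kappa.+1) root = level n root + mass (xbranch n).
Proof.
rewrite -addSnnS level_trunk// levelS /=.
have -> : (inord kappa : 'I_kappa.+1) = ord_max by apply/val_inj; rewrite /= inordK.
rewrite eqxx big_cons big_seq1 level_branch add0n; congr (level _ (xtrunk _) + _).
by apply/val_inj; rewrite /= modnn.
Qed.

End masses.
End trunk_and_branch.



(** * Consistent families and representing measures *)

Lemma integral_mul_indic d (T : measurableType d) (R : realType)
    (m : {measure set T -> \bar R}) (D A : set T) (f : T -> \bar R) :
  (\int[m]_(x in D) (f x * (\1_A x)%:E) = \int[m]_(x in D `&` A) f x)%E.
Proof. by rewrite integral_mkcondr epatch_indic. Qed.

Section consistent_families.
Context (kappa : nat) (R : realType) (mu : discrete_measure (X1 kappa) R).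
Local Notation X := (X1 kappa).
Local Notation phi := (@phi1 kappa).
Local Notation root := (xtrunk ord0 : X).
Local Notation mass := (mass mu).
Local Notation level := (level mu).
Local Notation D := (`[0%R, +oo[%classic : set R).

Let mass_ge0 x : 0 <= mass x. Proof. exact/ltW/mass_gt0. Qed.

Let measurable_power (A : set R) n : measurable_fun A (fun t : R => t ^+ n).
Proof. exact/measurable_funX/measurable_id. Qed.

Let Dge0 (t : R) : D t -> 0 <= t.
Proof. by rewrite /= in_itv /= andbT. Qed.

Section from_consistency.
Context (P : X -> probability R R).
Hypothesis P_halfline : forall x, P x D = 1%E.
Hypothesis P_consistent : consistency_condition mu phi P.

Let transfer_set (x : X) (s : set R) : measurable s -> s `<=` D ->
  (\sum_(y <- preimages x) (mass y)%:E * P y s = (mass x)%:E * \int[P x]_(t in s) t%:E)%E.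
Proof.
move=> ms sD; rewrite -(P_consistent (phi1_range x) ms sD).
rewrite esum_preimage; last by move=> y; rewrite mule_ge0.
rewrite massE inver gt_eqF ?mass_gt0// muleCA -EFinM divff ?gt_eqF ?mass_gt0// mule1.
by apply: eq_bigr => y _; rewrite massE.
Qed.

(** The consistency condition says that the weighted sum of the measures over the
    fibre of [x] has the density [mass x * t] with respect to [P x]. *)
Lemma consistency_integral (x : X) (f : R -> \bar R) : measurable_fun D f ->
  (forall t, D t -> 0 <= f t)%E ->
  (\sum_(y <- preimages x) (mass y)%:E * \int[P y]_(t in D) f t
   = (mass x)%:E * \int[P x]_(t in D) (f t * t%:E))%E.
Proof.
move=> mf f0.
have [Q [QA Qf]] := weighted_sum_measure (preimages x) P mass_ge0.
rewrite -Qf// (@ge0_integral_density _ _ _ (P x) Q D (fun t => mass x * t))//.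
- under eq_integral do rewrite EFinM muleCA.
  rewrite ge0_integralZl//.
  + by apply: emeasurable_funM => //; exact/measurable_EFinP/measurable_id.
  + by move=> t Dt; rewrite mule_ge0 ?f0// lee_fin Dge0.
  + by rewrite lee_fin.
- by apply: measurable_funM => //; exact: measurable_cst.
- by move=> t Dt; rewrite mulr_ge0// Dge0.
- move=> A mA AD; rewrite QA// transfer_set//.
  under [RHS]eq_integral do rewrite EFinM.
  rewrite ge0_integralZl//; last by rewrite lee_fin.
  by move=> t /AD Dt; rewrite lee_fin Dge0.
Qed.

Lemma consistency_moment n (x : X) :
  (\int[P x]_(t in D) (t ^+ n)%:E = (level n x / mass x)%:E)%E.
Proof.
elim: n x => [|n IH] x.
  rewrite level0 divff ?gt_eqF ?mass_gt0//.
  under eq_integral do rewrite expr0.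
  by rewrite integral_cst//; apply: etrans (mul1e _) (P_halfline x).
have mx := mass_gt0 mu x.
have := @consistency_integral (x : X) (fun t => (t ^+ n)%:E).
have -> : (\int[P x]_(t in D) ((t ^+ n)%:E * t%:E) = \int[P x]_(t in D) (t ^+ n.+1)%:E)%E.
  by apply: eq_integral => t _; rewrite -EFinM -exprSr.
move=> /(_ _ _)/esym E.
have {}E : ((mass x)%:E * \int[P x]_(t in D) (t ^+ n.+1)%:E = (level n.+1 x)%:E)%E.
  rewrite E; last 2 first.
  - exact/measurable_EFinP.
  - by move=> t Dt; rewrite lee_fin exprn_ge0// Dge0.
  rewrite levelS -sumEFin; apply: eq_bigr => y _.
  by rewrite IH -EFinM mulrCA divff ?mulr1// gt_eqF ?mass_gt0.
rewrite mulrC EFinM -E muleA -EFinM mulVf ?mul1e// gt_eqF//.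
Qed.

Lemma consistency_trunk r (f : R -> \bar R) : (r <= kappa)%N ->
  measurable_fun D f -> (forall t, D t -> 0 <= f t)%E ->
  ((mass root)%:E * \int[P root]_(t in D) (f t * (t ^+ r)%:E)
   = (mass (xtrunk (inord r)))%:E * \int[P (xtrunk (inord r))]_(t in D) f t)%E.
Proof.
elim: r f => [|r IH] f rk mf f0.
  have -> : inord 0 = ord0 :> 'I_kappa.+1 by apply/val_inj; rewrite /= inordK.
  by under eq_integral do rewrite expr0 mule1.
under eq_integral do rewrite exprS EFinM muleA.
rewrite (IH (fun t => f t * t%:E)%E (ltnW rk)); last 2 first.
- by apply: emeasurable_funM => //; exact/measurable_EFinP/measurable_id.
- by move=> t Dt; rewrite mule_ge0 ?f0// lee_fin Dge0.
have rmax : (inord r : 'I_kappa.+1) == ord_max = false.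
  by apply/eqP => /(congr1 val) /=; rewrite inordK ?(leqW rk)// => rE; rewrite rE ltnn in rk.
rewrite -consistency_integral//= rmax big_seq1.
have -> // : ordS (inord r) = inord r.+1 :> 'I_kappa.+1.
by apply/val_inj; rewrite /= !inordK ?modn_small// leqW.
Qed.

(** Transporting along the whole cycle multiplies by [t^(kappa+1)] and leads back
    to the root, up to the nonnegative contribution of the branch. *)
Lemma consistency_cycle (f : R -> \bar R) :
  measurable_fun D f -> (forall t, D t -> 0 <= f t)%E ->
  (\int[P root]_(t in D) f t <= \int[P root]_(t in D) (f t * (t ^+ kappa.+1)%:E))%E.
Proof.
move=> mf f0.
under [leRHS]eq_integral do rewrite exprS EFinM muleA.
rewrite -(@lee_pmul2l _ (mass root)%:E)// ?lte_fin ?mass_gt0//.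
rewrite (@consistency_trunk kappa (fun t => f t * t%:E)%E)//; last 2 first.
- by apply: emeasurable_funM => //; exact/measurable_EFinP/measurable_id.
- by move=> t Dt; rewrite mule_ge0 ?f0// lee_fin Dge0.
rewrite -consistency_integral//=.
have -> : inord kappa = ord_max :> 'I_kappa.+1 by apply/val_inj; rewrite /= inordK.
have -> : ordS ord_max = ord0 :> 'I_kappa.+1 by apply/val_inj; rewrite /= modnn.
by rewrite eqxx big_cons big_seq1 leeDl// mule_ge0// ?lee_fin//; exact: integral_ge0.
Qed.

(** For the indicator function of [A = [0, 1[] the transport along the cycle reads
    [P A <= \int_A t^(kappa+1)], which a nonzero mass of [A] would violate since
    [t^(kappa+1) < 1] on [A]. *)
Lemma consistency_vanish : P root `[0, 1[%classic = 0%E.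
Proof.
pose A : set R := `[0, 1[%classic; rewrite -/A.
have AD : A `<=` D by move=> t /=; rewrite !in_itv /= andbT => /andP[].
have mA : measurable A by exact: measurable_itv.
have Pfin B : measurable B -> (P root B < +oo)%E.
  by move=> mB; apply: le_lt_trans (probability_le1 _ mB) _; rewrite ltry.
have I1 : (P root A <= \int[P root]_(t in A) (t ^+ kappa.+1)%:E)%E.
  have := @consistency_cycle (fun t => (\1_A t)%:E).
  rewrite integral_indic// setIidl// => /(_ _ _)/le_trans; apply.
  - exact/measurable_EFinP/measurable_indic.
  - by move=> t _; rewrite lee_fin.
  under eq_integral do rewrite muleC.
  by rewrite integral_mul_indic setIidr.
have g0 (t : R) : A t -> (0 <= (1 - t ^+ kappa.+1)%:E)%E.
  rewrite /A /= in_itv /= => /andP[t0 t1].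
  by rewrite lee_fin subr_ge0 exprn_ile1// ltW.
have p0 (t : R) : A t -> (0 <= (t ^+ kappa.+1)%:E)%E.
  by move=> /AD /Dge0 t0; rewrite lee_fin exprn_ge0.
have mg : measurable_fun A (fun t => (1 - t ^+ kappa.+1)%:E).
  by apply/measurable_EFinP/measurable_funB => //; exact: measurable_cst.
have Isum : (P root A = \int[P root]_(t in A) (t ^+ kappa.+1)%:E +
    \int[P root]_(t in A) (1 - t ^+ kappa.+1)%:E)%E.
  rewrite -ge0_integralD//; last exact/measurable_EFinP.
  under eq_integral do rewrite -EFinD addrC subrK.
  by rewrite integral_cst// mul1e.
have I0 : (\int[P root]_(t in A) (1 - t ^+ kappa.+1)%:E = 0)%E.
  apply/le_anti; rewrite integral_ge0// andbT.
  have fin : (\int[P root]_(t in A) (t ^+ kappa.+1)%:E \is a fin_num)%E.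
    rewrite ge0_fin_numE ?integral_ge0//.
    apply: le_lt_trans (Pfin _ mA); rewrite [leRHS]Isum leeDl// integral_ge0//.
  by move: I1; rewrite Isum -[leRHS]adde0 leeD2lE.
have := (ae_eq_integral_abs (P root) mA mg).1.
rewrite (eq_integral (fun t : R => (1 - t ^+ kappa.+1)%:E)) => [/(_ I0)|]; last first.
  by move=> t /[!inE] /g0 /gee0_abs.
move=> [N [mN N0 AN]]; apply: (subset_measure0 mA mN _ N0) => t At; apply: AN => /= /(_ At).
move: At; rewrite /A /= in_itv /= => /andP[t0 t1] [] /eqP; rewrite subr_eq0 => /eqP tE.
by have := exprn_ilt1 kappa.+1 t0 t1; rewrite -tE ltxx.
Qed.

Lemma consistency_representing (x : X) : S_representing (P x) (fun n => level n x / mass x).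
Proof.
split=> [|n].
  rewrite -setCitvr; apply: etrans (probability_setC (P x) (measurable_itv _)) _.
  by rewrite [X in (1 - X)%E]P_halfline subee.
split; last exact: consistency_moment.
apply/integrableP; split; first exact/measurable_EFinP.
rewrite (eq_integral (fun t : R => (t ^+ n)%:E)); last first.
  by move=> t /[!inE] Dt; rewrite gee0_abs// lee_fin exprn_ge0// Dge0.
by rewrite consistency_moment ltry.
Qed.

End from_consistency.

(** The density, up to normalization, that the measure at [x] must have with
    respect to the measure at the root: [t^r] along the trunk by transport, and
    along the branch what is left by the equation at the last point of the
    cycle, [t * t^kappa = 1 + (t^(kappa+1) - 1)]. It is nonnegative precisely on
    [1, +oo[. *)
Definition weight (x : X) (t : R) : R := \1_(`[1, +oo[%classic) t *
  match x with
  | xtrunk r => t ^+ r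
  | xbranch j => t ^+ j * (t ^+ kappa.+1 - 1)
  end.

Lemma weight_ge0 x t : 0 <= weight x t.
Proof.
rewrite /weight indicE; case: (boolP (t \in _)) => [|_]; last by rewrite mul0r.
rewrite inE /= in_itv /= andbT mul1r => t1.
have t0 : 0 <= t by rewrite (le_trans _ t1).
by case: x => [r|j]; rewrite ?mulr_ge0 ?exprn_ge0// subr_ge0 exprn_ege1.
Qed.

Lemma measurable_weight x A : measurable_fun A (weight x).
Proof.
apply: measurable_funM; first exact: measurable_indic.
case: x => [r|j] //; apply: measurable_funM => //.
by apply: measurable_funB => //; exact: measurable_cst.
Qed.

(** The pointwise form of the consistency condition. *)
Lemma weight_preimages x t : \sum_(y <- preimages x) weight y t = t * weight x t.
Proof.
case: x => [r|j] /=; rewrite /weight; last by rewrite big_seq1 exprS; ring.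
have [->|rmax] := eqVneq r ord_max.
  by rewrite big_cons big_seq1 /= modnn -mulrDr expr0 exprS; ring.
have rk : (r.+1 < kappa.+1)%N by rewrite ltn_neqAle ltn_ord andbT.
by rewrite big_seq1 /= modn_small// exprS; ring.
Qed.

Section from_measure.
Context (rho : {measure set R -> \bar R}).
Hypothesis rho_representing : S_representing rho (fun n => level n root / mass root).
Hypothesis rho_vanish : rho `[0, 1[%classic = 0%E.

Let moment n : (\int[rho]_(t in D) (t ^+ n)%:E = (level n root / mass root)%:E)%E.
Proof. exact: (rho_representing.2 n).2. Qed.

Lemma moment_from1 n :
  (\int[rho]_(t in `[1%R, +oo[) (t ^+ n)%:E = (level n root / mass root)%:E)%E.
Proof.
rewrite -moment [RHS](ge0_negligible_integral (N := (`[0, 1[%classic : set R)))//.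
- congr (integral _ _ _); apply/seteqP; split=> t /=; rewrite !in_itv /= !andbT.
    by move=> t1; split; [rewrite (le_trans _ t1)|rewrite ltNge t1 andbF].
  by move=> [t0 /negP]; rewrite t0 /= -leNgt.
- exact/measurable_EFinP.
- by move=> t Dt; rewrite lee_fin exprn_ge0// Dge0.
Qed.

(** The moments of the root measure at the exponents [r], [j] and [j+kappa+1] are
    known, and the last two differ by the mass of a point of the branch. *)
Lemma weight_integral (x : X) :
  (\int[rho]_t (weight x t)%:E = (mass x / mass root)%:E)%E.
Proof.
have mM := mass_gt0 mu root.
pose g (t : R) := match x with
  | xtrunk r => t ^+ r
  | xbranch j => t ^+ j * (t ^+ kappa.+1 - 1) end.
rewrite (eq_integral (fun t => (g t)%:E * (\1_(`[1, +oo[%classic) t)%:E)%E); last first.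
  by move=> t _; rewrite -EFinM mulrC.
rewrite integral_mul_indic setTI /g; case: x {g} => [r|j].
  rewrite moment_from1; congr ((_ / _)%:E).
  have := @level_trunk kappa R mu 0 r; rewrite add0n level0 -ltnS ltn_ord => -> //.
  by rewrite inord_val.
have ge1 (t : R) : `[1%R, +oo[%classic t -> 1 <= t by rewrite /= in_itv /= andbT.
have E : (\int[rho]_(t in `[1%R, +oo[) (t ^+ j * (t ^+ kappa.+1 - 1))%:E +
    \int[rho]_(t in `[1%R, +oo[) (t ^+ j)%:E =
    \int[rho]_(t in `[1%R, +oo[) (t ^+ (j + kappa.+1))%:E)%E.
  rewrite -ge0_integralD//; last 4 first.
  - move=> t /ge1 t1; have t0 : 0 <= t by rewrite (le_trans _ t1).
    by rewrite lee_fin mulr_ge0 ?exprn_ge0// subr_ge0 exprn_ege1.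
  - apply/measurable_EFinP/measurable_funM => //.
    by apply: measurable_funB => //; exact: measurable_cst.
  - by move=> t /ge1 t1; rewrite lee_fin exprn_ge0// (le_trans _ t1).
  - exact/measurable_EFinP.
  by apply: eq_integral => t _; rewrite -EFinD exprD; congr (_%:E); ring.
move: E; rewrite !moment_from1 level_period mulrDl addeC.
by case: (integral _ _ _) => [r| |] // [] /addrI ->.
Qed.

Lemma measure_consistency : exists P : X -> probability R R,
  (forall x, P x D = 1%E) /\ consistency_condition mu phi P.
Proof.
have mM := mass_gt0 mu root.
have c0 x : 0 <= mass root / mass x by rewrite divr_ge0.
have mk x : measurable_fun setT (fun t => mass root / mass x * weight x t).
  by apply: measurable_funM; [exact: measurable_cst|exact: measurable_weight].
have k0 x t : 0 <= mass root / mass x * weight x t by rewrite mulr_ge0 ?weight_ge0.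
have int_k x (A : set R) : measurable A ->
    (\int[rho]_(t in A) (mass root / mass x * weight x t)%:E =
     (mass root / mass x)%:E * \int[rho]_(t in A) (weight x t)%:E)%E.
  move=> mA; under eq_integral do rewrite EFinM.
  rewrite ge0_integralZl//; last by rewrite lee_fin.
  - by apply/measurable_EFinP; exact: measurable_weight.
  - by move=> t _; rewrite lee_fin weight_ge0.
have k1 x : (\int[rho]_t (mass root / mass x * weight x t)%:E = 1)%E.
  rewrite int_k// weight_integral -EFinM mulrA divfK ?divff ?gt_eqF ?mass_gt0//.
have [P PE] := choice (fun x => density_probability (mk x) (k0 x) (k1 x)).
exists P; split=> [x|x _ s ms sD].
  rewrite PE// -(k1 x) [in RHS]integral_mkcond [in LHS]integral_mkcond.
  apply: eq_integral => t _; rewrite /patch in_setT; case: ifPn => // /negP tD.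
  rewrite /weight indicE (_ : t \in _ = false) ?mul0r ?mulr0//.
  apply/negP; rewrite inE /= in_itv /= andbT => t1; apply: tD.
  by rewrite inE /= in_itv /= andbT (le_trans _ t1).
rewrite esum_preimage; last by move=> y; rewrite mule_ge0.
rewrite massE inver gt_eqF ?mass_gt0//.
rewrite (@ge0_integral_density _ _ _ rho (P x) s (fun t => mass root / mass x * weight x t));
  [| by [] | exact: measurable_funTS | by move=> t _; exact: k0 | by move=> A mA _; exact: PE
   | exact: EFin_measurable | by move=> t /sD /Dge0; rewrite lee_fin].
under [RHS]eq_integral do rewrite -EFinM mulrCA EFinM.
rewrite ge0_integralZl//; last 3 first.
- by apply/measurable_EFinP/measurable_funM; [exact: measurable_id|exact: measurable_weight].
- by move=> t /sD /Dge0 t0; rewrite lee_fin mulr_ge0 ?weight_ge0.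
- by rewrite lee_fin.
under [in RHS]eq_integral do rewrite -weight_preimages -sumEFin.
rewrite ge0_integral_sum//; last 2 first.
- by move=> y; apply/measurable_EFinP; exact: measurable_weight.
- by move=> y t _; rewrite lee_fin weight_ge0.
rewrite muleC mulrC EFinM -muleA; congr (_ * _)%E.
rewrite ge0_sume_distrr; last first.
  by move=> y _; apply: integral_ge0 => t _; rewrite lee_fin weight_ge0.
apply: eq_bigr => y _; rewrite massE PE// int_k// muleA -EFinM.
by rewrite mulrCA divff ?mulr1// gt_eqF ?mass_gt0.
Qed.

End from_measure.
End consistent_families.



(** * Moments and quadratic forms *)

(** Packs the image measure as a measure, with the change of variables. *)
Lemma pushforward_measure d1 d2 (T1 : measurableType d1) (T2 : measurableType d2)
    (R : realType) (m : {measure set T1 -> \bar R}) (f : T1 -> T2) :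
  measurable_fun setT f ->
  exists Q : {measure set T2 -> \bar R}, (forall A, Q A = m (f @^-1` A)) /\
    forall D (F : T2 -> \bar R), measurable D -> measurable_fun D F ->
      (forall y, D y -> 0 <= F y)%E ->
      (\int[Q]_(y in D) F y = \int[m]_(x in f @^-1` D) F (f x))%E.
Proof.
move=> mf; unshelve eexists (pushforward m f : {measure set T2 -> \bar R}); first exact: mf.
split=> // D F mD mF F0; apply: (ge0_integral_pushforward mf) => // y; rewrite inE; exact: F0.
Qed.

Section moment_functional.
Context (R : realType) (gamma : nat -> R).
Local Notation D := (`[0%R, +oo[%classic : set R).

Definition moment_functional (p : {poly R}) : R := \sum_(i < size p) p`_i * gamma i.

Lemma moment_functional_widen n (p : {poly R}) : (size p <= n)%N ->
  moment_functional p = \sum_(i < n) p`_i * gamma i.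
Proof.
move=> pn; rewrite /moment_functional (big_ord_widen n (fun i => p`_i * gamma i) pn).
rewrite big_mkcond /=; apply: eq_bigr => i _; case: ltnP => // pi.
by rewrite nth_default ?mul0r.
Qed.

Let moment_functional_linear : linear_for *%R moment_functional.
Proof.
move=> c p q; pose n := maxn (size (c *: p + q)) (maxn (size p) (size q)).
rewrite !(@moment_functional_widen n) ?leq_max ?leqnn ?orbT// mulr_sumr -big_split /=.
by apply: eq_bigr => i _; rewrite coefD coefZ; ring.
Qed.

HB.instance Definition _ := GRing.isLinear.Build R {poly R} R _ moment_functional
  moment_functional_linear.

Local Notation L := moment_functional.

Lemma moment_functionalXn n : L 'X^n = gamma n.
Proof.
rewrite (@moment_functional_widen n.+1) ?size_polyXn// big_ord_recr /= coefXn eqxx mul1r.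
by rewrite big1 ?add0r// => i _; rewrite coefXn ltn_eqF ?mul0r// ltn_ord.
Qed.

Lemma moment_functional_bilinear k n (a b : 'I_n -> R) :
  L ('X^k * (\sum_(i < n) a i *: 'X^i) * (\sum_(j < n) b j *: 'X^j)) =
  \sum_(i < n) \sum_(j < n) gamma (i + j + k)%N * a i * b j.
Proof.
rewrite -mulrA big_distrlr /= mulr_sumr linear_sum; apply: eq_bigr => i _.
rewrite mulr_sumr linear_sum; apply: eq_bigr => j _.
rewrite -scalerAl -!scalerAr !linearZ /= -!exprD moment_functionalXn.
by rewrite (addnC k); ring.
Qed.

(** The imaginary part of the Hermitian form vanishes by antisymmetry, and its
    real part splits into the forms of the real and of the imaginary parts of
    the coefficients. *)
Lemma moment_form k n (l : 'I_n -> R[i]) :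
  \sum_(i < n) \sum_(j < n) (gamma (i + j + k)%N)%:C * l i * (l j)^*%R =
  (L ('X^k * (\sum_(i < n) complex.Re (l i) *: 'X^i) ^+ 2) +
   L ('X^k * (\sum_(i < n) complex.Im (l i) *: 'X^i) ^+ 2))%:C.
Proof.
rewrite !expr2 !mulrA !moment_functional_bilinear -big_split /=.
have prodE (c : R) (z w : R[i]) : c%:C * z * w^*%R =
    (c * complex.Re z * complex.Re w + c * complex.Im z * complex.Im w)
    +i* (c * complex.Im z * complex.Re w - c * complex.Im w * complex.Re z).
  by case: z w => x y [u v]; rewrite -[_^*%R]/(u -i* v); apply/eqP; rewrite eq_complex /=; apply/andP; split; apply/eqP; ring.
apply/eqP; rewrite eq_complex; apply/andP; split; apply/eqP => /=.
  rewrite raddf_sum; apply: eq_bigr => i _; rewrite raddf_sum -big_split /=.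
  by apply: eq_bigr => j _; rewrite prodE.
rewrite raddf_sum.
transitivity (\sum_(i < n) \sum_(j < n) (gamma (i + j + k)%N * complex.Im (l i) * complex.Re (l j)
   - gamma (i + j + k)%N * complex.Im (l j) * complex.Re (l i))).
  apply: eq_bigr => i _; rewrite raddf_sum.
  by apply: eq_bigr => j _; rewrite prodE.
rewrite (eq_bigr _ (fun i _ => sumrB _ _ _ _)) sumrB; apply/eqP; rewrite subr_eq0; apply/eqP.
rewrite exchange_big /=; apply: eq_bigr => i _; apply: eq_bigr => j _.
by rewrite (addnC i).
Qed.

Section representing_measure.
Context (nu : {measure set R -> \bar R}).
Hypothesis nu_representing : S_representing nu gamma.

Lemma moment_functional_integral (p : {poly R}) :
  (\int[nu]_(t in D) (p.[t])%:E = (L p)%:E)%E.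
Proof.
have int_mono (i : nat) : nu.-integrable D (fun t => (p`_i)%:E * (t ^+ i)%:E)%E.
  by apply: integrableZl => //; exact: (nu_representing.2 i).1.
under eq_integral do rewrite horner_coef -sumEFin.
rewrite integral_sum//; last by move=> i; exact: int_mono.
rewrite /L -sumEFin; apply: eq_bigr => i _.
under eq_integral do rewrite EFinM.
rewrite integralZl//; last exact: (nu_representing.2 i).1.
by rewrite (nu_representing.2 i).2 -EFinM.
Qed.

(** The integral of [p] only sees [1, +oo[. *)
Lemma moment_functional_ge0 (p : {poly R}) : nu `[0, 1[%classic = 0%E ->
  (forall t, 1 <= t -> 0 <= p.[t]) -> 0 <= L p.
Proof.
move=> nu01 p0; rewrite -lee_fin -moment_functional_integral.
have mp (A : set R) : measurable_fun A (fun t => (p.[t])%:E).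
  apply/measurable_EFinP; apply: measurable_funTS.
  by apply: continuous_measurable_fun; exact: continuous_horner.
have ip : nu.-integrable D (fun t => (p.[t])%:E).
  have -> : (fun t => (p.[t])%:E) = (fun t => \sum_(i < size p) (p`_i)%:E * (t ^+ i)%:E)%E.
    by apply/funext => t; rewrite horner_coef -sumEFin.
  apply: integrable_sum => // i _; apply: integrableZl => //.
  exact: (nu_representing.2 i).1.
rewrite (@negligible_integral _ _ _ nu D `[0, 1[%classic)//.
apply: integral_ge0 => t [/=]; rewrite !in_itv /= andbT => t0 /negP.
by rewrite t0 /= -leNgt lee_fin => /p0.
Qed.

End representing_measure.

(** In the pre-Hilbert space of polynomials defined by the moments, multiplication
    by [X] is symmetric with lower bound 1. *)
Definition bounded_below_form := forall a : {poly R}, 0 <= L (a ^+ 2) <= L ('X * a ^+ 2).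

Lemma bounded_below_formP : bounded_below_form <->
  (forall (n : nat) (l : 'I_n.+1 -> R[i]),
      0 <= \sum_(i < n.+1) \sum_(j < n.+1) (gamma (i + j)%N)%:C * l i * (l j)^*
        <= \sum_(i < n.+1) \sum_(j < n.+1) (gamma (i + j + 1)%N)%:C * l i * (l j)^*).
Proof.
have form0 n (l : 'I_n.+1 -> R[i]) :
    \sum_(i < n.+1) \sum_(j < n.+1) (gamma (i + j)%N)%:C * l i * (l j)^* =
    (L ((\sum_i complex.Re (l i) *: 'X^i) ^+ 2) +
     L ((\sum_i complex.Im (l i) *: 'X^i) ^+ 2))%:C.
  have := moment_form 0 l; rewrite expr0 !mul1r => <-.
  by apply: eq_bigr => i _; apply: eq_bigr => j _; rewrite addn0.
split=> [pos n l|form a].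
  rewrite form0 (moment_form 1) expr1 !lecR.
  have /andP[a1 a2] := pos (\sum_i complex.Re (l i) *: 'X^i).
  have /andP[b1 b2] := pos (\sum_i complex.Im (l i) *: 'X^i).
  by rewrite addr_ge0//= lerD.
have := form (size a) (fun i => (a`_i)%:C).
rewrite form0 (moment_form 1) expr1 /=.
have -> : \sum_(i < (size a).+1) 0 *: 'X^i = 0 :> {poly R}.
  by rewrite big1// => i _; rewrite scale0r.
have -> : \sum_(i < (size a).+1) a`_i *: 'X^i = a.
  rewrite -poly_def; apply/polyP => i; rewrite coef_poly ltnS.
  by case: leqP => // ai; rewrite nth_default// ltnW.
by rewrite expr0n mulr0 linear0 !addr0 !lecR.
Qed.

Lemma representing_bounded_below (nu : {measure set R -> \bar R}) :
  S_representing nu gamma -> nu `[0, 1[%classic = 0%E -> bounded_below_form.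
Proof.
move=> nuS nu01 a; apply/andP; split.
  by apply: (moment_functional_ge0 nuS nu01) => t t1; rewrite horner_exp sqr_ge0.
rewrite -subr_ge0 -linearB /=; apply: (moment_functional_ge0 nuS nu01) => t t1.
rewrite hornerD hornerN hornerM hornerX horner_exp.
by rewrite -[X in _ - X]mul1r -mulrBl mulr_ge0 ?sqr_ge0// subr_ge0.
Qed.

(** The moment functional read in the variable [X - 1]: a measure carried by
    [1, +oo[ is the translate of one carried by [0, +oo[. *)
Definition shifted_functional (p : {poly R}) : R := L (p \Po ('X - 1%:P)).

Let shifted_linear : linear_for *%R shifted_functional.
Proof. by move=> c p q; rewrite /shifted_functional linearP /= linearP. Qed.

HB.instance Definition _ := GRing.isLinear.Build R {poly R} R _ shifted_functional
  shifted_linear.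

(** By the description of the polynomials that are nonnegative on the half-line it
    is enough to test [q^2] and [X q^2], and the second one shifts to
    [(X - 1) q^2]. *)
Lemma shifted_functional_ge0 : bounded_below_form ->
  forall p : {poly R}, (forall t, 0 <= t -> 0 <= p.[t]) -> 0 <= shifted_functional p.
Proof.
move=> pos p /sos_halflineP; elim=> {p} [q|q|p q _ IHp _ IHq].
- by rewrite /shifted_functional rmorphXn /=; have /andP[] := pos (q \Po ('X - 1%:P)).
- rewrite /shifted_functional rmorphM rmorphXn /= comp_polyX mulrBl mul1r linearB subr_ge0.
  by have /andP[] := pos (q \Po ('X - 1%:P)).
- by rewrite linearD /= addr_ge0.
Qed.

End moment_functional.

Lemma scalar_moment_functional (R : realType) (M : {scalar {poly R}}) (p : {poly R}) :
  moment_functional (fun n => M 'X^n) p = M p.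
Proof.
rewrite -[in RHS](coefK p) poly_def linear_sum; apply: eq_bigr => i _.
by rewrite linearZ.
Qed.

(** The representing measure of the shifted functional, translated by 1. *)
Theorem bounded_below_representing (R : realType) (gamma : nat -> R) :
  gamma 0 = 1 -> bounded_below_form gamma ->
  exists2 rho : {measure set R -> \bar R},
    S_representing rho gamma & rho `[0, 1[%classic = 0%E.
Proof.
move=> gamma0 pos; pose M := shifted_functional gamma.
have M1 : M 1 = 1 by rewrite /M /shifted_functional rmorph1 -(expr0 'X) moment_functionalXn.
have [nu nuS] := Stieltjes_existence (shifted_functional_ge0 pos) M1.
have moment n : (\int[nu]_(t in `[0%R, +oo[) ((t + 1) ^+ n)%:E = (gamma n)%:E)%E.
  have := moment_functional_integral nuS (('X + 1%:P) ^+ n).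
  rewrite scalar_moment_functional /= /shifted_functional rmorphXn /= comp_polyD comp_polyX.
  rewrite comp_polyC subrK moment_functionalXn => <-.
  by apply: eq_integral => t _; rewrite horner_exp hornerD hornerX hornerC.
have mshift : measurable_fun setT (fun t : R => t + 1).
  by apply: measurable_funD => //; exact: measurable_cst.
have [rho [rhoE rho_integral]] := pushforward_measure nu mshift.
have below (A : set R) : measurable A -> A `<=` `]-oo, 0[%classic -> nu A = 0%E.
  by move=> mA AN; exact: (subset_measure0 _ _ AN nuS.1).
have mpow (A : set R) n : measurable_fun A (fun t : R => (t ^+ n)%:E).
  exact/measurable_EFinP/measurable_funX/measurable_id.
have mpow1 (A : set R) n : measurable_fun A (fun t : R => ((t + 1) ^+ n)%:E).
  by apply/measurable_EFinP/measurable_funX; exact: measurable_funTS.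
have preim (i : interval R) : measurable ((fun t : R => t + 1) @^-1` [set` i]).
  by rewrite -[X in measurable X]setTI; exact: mshift.
have rho_moment n : (\int[rho]_(t in `[0%R, +oo[) (t ^+ n)%:E = (gamma n)%:E)%E.
  rewrite rho_integral//; last first.
    by move=> t /=; rewrite in_itv /= andbT => t0; rewrite lee_fin exprn_ge0.
  rewrite -moment [LHS](@ge0_negligible_integral _ _ _ nu _ `[(-1)%R, 0%R[%classic)//.
  - congr (integral _ _ _); apply/seteqP; split=> t /=; rewrite !in_itv /= !andbT.
      by move=> [t1 /negP]; rewrite negb_and -leNgt -ltNge => /orP[|//]; lra.
    by move=> t0; split; [lra|rewrite [X in _ && X]ltNge t0 andbF].
  - by move=> t /=; rewrite in_itv /= andbT => t0; rewrite lee_fin exprn_ge0.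
  - by apply: below => // t /=; rewrite !in_itv /= => /andP[].
exists rho; last first.
  rewrite rhoE; apply: below => // t /=; rewrite !in_itv /= => /andP[]; lra.
split=> [|n].
  rewrite rhoE; apply: below => // t /=; rewrite !in_itv /=; lra.
split=> //; apply/integrableP; split=> //.
rewrite (eq_integral (fun t : R => (t ^+ n)%:E)) ?rho_moment ?ltry//.
by move=> t; rewrite inE /= in_itv /= andbT => t0; rewrite ger0_norm// exprn_ge0.
Qed.



(** * Sums over countable types *)

Lemma nneseries_pickle_inv (R : realType) (Y : countType) (a : Y -> \bar R) :
  (forall y, 0 <= a y)%E ->
  (\sum_(n <oo) oapp a 0 (pickle_inv n) = \esum_(y in [set: Y]) a y)%E.
Proof.
move=> a0; rewrite nneseries_esumT; last by move=> n; case: pickle_inv => /=.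
transitivity (\esum_(n in pickle @` [set: Y]) oapp a 0%E (pickle_inv n))%E.
  rewrite [RHS]esum_mkcond; apply: eq_esum => n _; case: ifPn => // nY.
  case E : (pickle_inv n) => [y|] //=; case/negP: nY; rewrite inE; exists y => //.
  by have := @pickle_invK Y n; rewrite E.
rewrite esum_image; last by move=> y z _ _; exact: (pcan_inj (@pickleK Y)).
by apply: eq_esum => y _; rewrite pickleK_inv.
Qed.

Lemma esum_fibers (R : realType) (T K : choiceType) (f : T -> K) (a : T -> \bar R) :
  (forall y, 0 <= a y)%E ->
  (\esum_(y in [set: T]) a y = \esum_(x in [set: K]) \esum_(y in f @^-1` [set x]) a y)%E.
Proof.
move=> a0; rewrite esum_esum//.
rewrite [RHS](reindex_esum [set: T] _ (fun y => (f y, y)))//; split=> //.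
- by move=> y z _ _ [].
- by move=> [x y] [_ /= <-]; exists y.
Qed.

Lemma integral_discrete (R : realType) kappa (mu : discrete_measure (X1 kappa) R)
    (F : X1 kappa -> R) : (forall x, 0 <= F x) ->
  (\int[mu]_x (F x)%:E = \esum_(x in [set: X1 kappa]) (mass mu x * F x)%:E)%E.
Proof.
move=> F0; pose A n : set (X1 kappa) := [set x | pickle x = n].
have AT : [set: X1 kappa] = \bigcup_n A n.
  by apply/seteqP; split=> x // _; exists (pickle x).
rewrite [in LHS]AT ge0_integral_bigcup//; last 2 first.
- by move=> x _; rewrite lee_fin.
- by move=> i j _ _ [x [<- <-]].
rewrite -nneseries_pickle_inv; last first.
  by move=> x; rewrite lee_fin mulr_ge0 ?F0// ltW// mass_gt0.
apply: eq_eseriesr => n _; case E : (pickle_inv n) => [x|] /=.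
  have -> : A n = [set x].
    have := @pickle_invK (X1 kappa) n; rewrite E /= => xn.
    apply/seteqP; split=> y /=; last by move=> ->.
    by rewrite /A /= -xn => /(pcan_inj (@pickleK _)).
  rewrite (eq_integral (cst (F x)%:E)); last by move=> y; rewrite inE => ->.
  by rewrite integral_cst// [X in (_ * X)%E](massE mu x) -EFinM mulrC.
rewrite (_ : A n = set0) ?integral_set0//; rewrite -subset0 => y yn.
by move: E; rewrite -yn pickleK_inv.
Qed.

(** * The dilation of the composition operator *)

(** The backward orbits of the symbol fall into two kinds. Those that turn
    around the cycle for ever give the trunk sheet of index 0. All others come
    down the branch, and such an orbit reaches the cycle and turns around it:
    [trunk_sheet r q.+1] is the passage at [x_r] in its turn number [q]. So
    the sheets form a cycle and a two-sided infinite line, on which the symbol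
    lifts to a bijection. *)
Inductive sheet (kappa : nat) : Type :=
  trunk_sheet of 'I_kappa.+1 & nat | branch_sheet of nat.
Arguments trunk_sheet {kappa}.
Arguments branch_sheet {kappa}.

Section sheet_instances.
Context (kappa : nat).

Definition sheet_sum (y : sheet kappa) : 'I_kappa.+1 * nat + nat :=
  match y with trunk_sheet r q => inl (r, q) | branch_sheet j => inr j end.

Definition sum_sheet (s : 'I_kappa.+1 * nat + nat) : sheet kappa :=
  match s with inl rq => trunk_sheet rq.1 rq.2 | inr j => branch_sheet j end.

Lemma sheet_sumK : cancel sheet_sum sum_sheet. Proof. by case. Qed.

HB.instance Definition _ := Countable.copy (sheet kappa) (can_type sheet_sumK).
HB.instance Definition _ := isPointed.Build (sheet kappa) (branch_sheet 0).
HB.instance Definition _ := @isMeasurable.Build default_measure_display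
  (sheet kappa) discrete_measurable discrete_measurable0
  discrete_measurableC discrete_measurableU.

End sheet_instances.

Lemma measurable_invr (R : realType) : measurable_fun setT (fun t : R => t^-1).
Proof.
have m0 : measurable ([set 0] : set R) by exact: measurable_set1.
rewrite -(setUv [set 0]); apply/measurable_funU => //; first exact: measurableC.
split.
  by apply: (eq_measurable_fun (cst (0 : R))) => // t /[!inE] ->; rewrite invr0.
apply: subspace_continuous_measurable_fun; first exact: measurableC.
by apply: continuous_in_subspaceT => t /[!inE] /eqP; exact: inv_continuous.
Qed.

Section dilation.
Context (kappa : nat) (R : realType) (mu : discrete_measure (X1 kappa) R).
Local Notation X := (X1 kappa).
Local Notation phi := (@phi1 kappa).
Local Notation root := (xtrunk ord0 : X).
Local Notation mass := (mass mu).
Local Notation level := (level mu).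
Local Notation Y := (sheet kappa).

(** The product with the line is a countable disjoint union of lines. *)
Lemma measurable_fun_sheets d (Z : measurableType d) (f : Y * R -> Z) :
  (forall y, measurable_fun setT (fun t => f (y, t))) -> measurable_fun setT f.
Proof.
move=> mf _ B mB; rewrite setTI.
have -> : f @^-1` B = \bigcup_n
    oapp (fun y => [set y] `*` ((fun t => f (y, t)) @^-1` B)) set0 (pickle_inv n).
  apply/seteqP; split=> [[y t] fB|[y t] [n _]].
    by exists (pickle y); [exact: I|rewrite pickleK_inv; split].
  by case: pickle_inv => //= z [/= -> ].
apply: bigcupT_measurable => n; case: pickle_inv => [y|] //=.
by apply: measurableX => //; rewrite -[X in measurable X]setTI; exact: mf.
Qed.

(** One copy of [rho] on each sheet. *)
Lemma sheet_measure (rho : {measure set R -> \bar R}) :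
  exists m : {measure set (Y * R) -> \bar R}, forall F : Y * R -> \bar R,
    measurable_fun setT F -> (forall p, 0 <= F p)%E ->
    (\int[m]_p F p = \esum_(y in [set: Y]) \int[rho]_t F (y, t))%E.
Proof.
have mpair (y : Y) : measurable_fun setT (fun t : R => (y, t)).
  by apply/measurable_fun_pairP; split; [exact: measurable_cst|exact: measurable_id].
have [Q QE] := choice (fun y => pushforward_measure rho (mpair y)).
pose m n : {measure set (Y * R) -> \bar R} := oapp Q mzero (pickle_inv n).
exists (mseries m 0) => F mF F0.
rewrite ge0_integral_measure_series//.
rewrite -nneseries_pickle_inv; last by move=> y; apply: integral_ge0 => t _; exact: F0.
apply: eq_eseriesr => n _; rewrite /m; case: pickle_inv => [y|] /=.
  by rewrite (QE y).2.
by rewrite integral_measure_zero.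
Qed.

Definition sheet_flow (y : Y) : Y :=
  match y with
  | trunk_sheet r q =>
      if r == ord0 then trunk_sheet ord_max (if q is m.+1 then m.+2 else 0)
      else trunk_sheet (ord_pred r) q
  | branch_sheet 0 => trunk_sheet ord_max 1
  | branch_sheet j.+1 => branch_sheet j
  end.

Definition sheet_coflow (y : Y) : Y :=
  match y with
  | trunk_sheet r q =>
      if r == ord_max then
        match q with
        | 0 => trunk_sheet ord0 0
        | 1 => branch_sheet 0
        | m.+2 => trunk_sheet ord0 m.+1
        end
      else trunk_sheet (ordS r) q
  | branch_sheet j => branch_sheet j.+1
  end.

Lemma sheet_flowK : cancel sheet_flow sheet_coflow.
Proof.
case=> [r q|[|j]] //=; last by rewrite eqxx.
have [->|r0] := eqVneq r ord0; first by rewrite /= eqxx; case: q.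
rewrite /= (_ : ord_pred r == ord_max = false) ?ord_predK//.
apply/negP => /eqP /(congr1 (@ordS _)); rewrite ord_predK => rE.
by case/eqP: r0; rewrite rE; apply/val_inj; rewrite /= modnn.
Qed.

Lemma sheet_coflowK : cancel sheet_coflow sheet_flow.
Proof.
case=> [r q|j] //=.
have [->|rmax] := eqVneq r ord_max; first by case: q => [|[|q]].
rewrite /= (_ : ordS r == ord0 = false) ?ordSK//.
apply/negP => /eqP /(congr1 (@ord_pred _)); rewrite ordSK => rE.
by case/eqP: rmax; rewrite rE; apply/val_inj; rewrite /= modn_small.
Qed.

Definition sheet_point (y : Y) : X :=
  match y with trunk_sheet r _ => xtrunk r | branch_sheet j => xbranch j end.

Lemma sheet_point_flow y : sheet_point (sheet_flow y) = phi (sheet_point y).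
Proof.
case: y => [r q|[|j]] //; rewrite [sheet_flow _]/= [sheet_point (trunk_sheet _ _)]/= phi1_trunk.
case: eqP => [->|//] /=; congr xtrunk; apply/val_inj => /=.
by rewrite modn_small.
Qed.

Section system.
Context (m : {measure set (Y * R) -> \bar R}) (rho : {measure set R -> \bar R}).
Hypothesis mE : forall F : Y * R -> \bar R,
    measurable_fun setT F -> (forall p, 0 <= F p)%E ->
    (\int[m]_p F p = \esum_(y in [set: Y]) \int[rho]_t F (y, t))%E.

Let measurable_base (g : Y -> Y) : measurable_fun setT (fun p : Y * R => (g p.1, p.2)).
Proof.
apply: measurable_fun_sheets => y /=.
by apply/measurable_fun_pairP; split; [exact: measurable_cst|exact: measurable_id].
Qed.

Let base_invariant (A : set (Y * R)) : measurable A ->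
  m ((fun p : Y * R => (sheet_flow p.1, p.2)) @^-1` A) = m A.
Proof.
move=> mA; set s := fun p : Y * R => _.
have ms : measurable (s @^-1` A).
  by rewrite -[X in measurable X]setTI; exact: measurable_base.
have ind (B : set (Y * R)) : measurable B ->
    m B = (\esum_(y in [set: Y]) \int[rho]_t (\1_B (y, t))%:E)%E.
  move=> mB; rewrite -(mE (F := fun p => (\1_B p)%:E)).
  - by rewrite integral_indic// setIT.
  - exact/measurable_EFinP/measurable_indic.
  - by move=> p; rewrite lee_fin.
rewrite !ind// [RHS](reindex_esum [set: Y] [set: Y] sheet_flow)//.
split=> // [y z _ _ /(can_inj sheet_flowK)//|y _].
by exists (sheet_coflow y); rewrite ?sheet_coflowK.
Qed.

Lemma sheet_system : exists s : invariant_system m,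
  (forall p, flow s p = (sheet_flow p.1, p.2)) /\
  (forall p, speed s p = Num.sqrt p.2).
Proof.
have msqrt : measurable_fun setT (fun p : Y * R => Num.sqrt p.2).
  apply: measurable_fun_sheets => y /=.
  exact: (continuous_measurable_fun (@sqrt_continuous R)).
have fK : cancel (fun p : Y * R => (sheet_flow p.1, p.2)) (fun p => (sheet_coflow p.1, p.2)).
  by move=> [y t] /=; rewrite sheet_flowK.
have cK : cancel (fun p : Y * R => (sheet_coflow p.1, p.2)) (fun p => (sheet_flow p.1, p.2)).
  by move=> [y t] /=; rewrite sheet_coflowK.
by unshelve eexists (@InvariantSystem _ _ _ m _ _ _ (measurable_base sheet_flow)
  (measurable_base sheet_coflow) msqrt fK cK base_invariant _ _).
Qed.

End system.

(** The squared modulus of the embedding on each sheet. Along an orbit it must be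
    divided by [t] at each step of the flow. On the line this determines it
    from the density of the branch, and gives [t^r t^(-(m+1)(kappa+1))
    (t^(kappa+1) - 1)] on the turn number [m]. The cyclic sheet can only carry a
    function supported on [t = 1], and it carries the atom of [rho] at 1, which
    the line misses because its weights vanish there. *)
Definition sheet_weight (y : Y) (t : R) : R :=
  match y with
  | trunk_sheet r 0 => \1_[set 1] t
  | trunk_sheet r m.+1 => \1_(`[1, +oo[%classic) t *
      (t ^+ r * (t^-1 ^+ kappa.+1) ^+ m * (1 - t^-1 ^+ kappa.+1))
  | branch_sheet j => weight (xbranch j : X) t
  end.

Lemma sheet_weight_small y t : t < 1 -> sheet_weight y t = 0.
Proof.
move=> t1; have out : t \in `[1, +oo[%classic = false.
  by apply/negP; rewrite inE /= in_itv /= andbT leNgt t1.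
case: y => [r [|m]|j] /=; rewrite /weight !indicE ?out ?mul0r//.
by rewrite (_ : t \in _ = false)//; apply/negP; rewrite inE /= => t1E; rewrite t1E ltxx in t1.
Qed.

Lemma sheet_weight_ge0 y t : 0 <= sheet_weight y t.
Proof.
have [t1|t1] := ltP t 1; first by rewrite sheet_weight_small.
have t0 : 0 <= t by rewrite (le_trans _ t1).
case: y => [r [|m]|j] /=; [by [] | | exact: weight_ge0].
rewrite !mulr_ge0 ?exprn_ge0 ?invr_ge0//.
by rewrite subr_ge0 exprn_ile1 ?invr_ge0// invf_le1// (lt_le_trans _ t1).
Qed.

Lemma measurable_sheet_weight y : measurable_fun setT (sheet_weight y).
Proof.
have mindic (A : set R) : measurable A -> measurable_fun setT (\1_A : R -> R).
  by move=> mA; exact: measurable_indic.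
have mpow (f : R -> R) n : measurable_fun setT f -> measurable_fun setT (fun t => f t ^+ n).
  by move=> mf; exact: measurable_funX.
have minv := @measurable_invr R.
case: y => [r [|m]|j] /=; [exact: mindic| |exact: measurable_weight].
apply: measurable_funM; first exact: mindic.
apply: measurable_funM; last by apply: measurable_funB; [exact: measurable_cst|exact: mpow].
apply: measurable_funM; first exact: (mpow _ _ (@measurable_id _ _ setT)).
exact: (mpow _ _ (mpow _ _ minv)).
Qed.

Lemma sheet_weight_flow y t : sheet_weight y t = t * sheet_weight (sheet_flow y) t.
Proof.
have [t1|t1] := ltP t 1; first by rewrite !sheet_weight_small// mulr0.
have t0 : t != 0 by rewrite gt_eqF// (lt_le_trans _ t1).
have one : \1_(`[1, +oo[%classic) t = 1 :> R.
  by rewrite indicE mem_set//= in_itv /= andbT.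
have pred_exp (r : 'I_kappa.+1) : r != ord0 -> t ^+ r = t * t ^+ (ord_pred r).
  move=> r0; have rpos : (0 < r)%N by rewrite lt0n.
  rewrite -exprS /= -{2}(prednK rpos) addSn /= modnDr modn_small ?prednK//; exact: ltnW.
have period : t * t ^+ kappa * t^-1 ^+ kappa.+1 = 1.
  by rewrite -exprS exprVn divff// expf_neq0.
case: y => [r q|[|j]] /=; last first.
- by rewrite /weight one exprS; ring.
- transitivity (t * t ^+ kappa - t * t ^+ kappa * t^-1 ^+ kappa.+1).
    by rewrite period /weight one expr0 exprS !mul1r.
  by rewrite one expr0; ring.
have [->|r0] := eqVneq r ord0; case: q => [|m] /=; rewrite ?one ?mul1r.
- rewrite indicE; case: (boolP (t \in _)); last by rewrite mulr0.
  by rewrite inE => ->; rewrite mulr1.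
- rewrite [in RHS]exprS -[LHS]mul1r -[X in X * _ = _]period; ring.
- rewrite indicE; case: (boolP (t \in _)); last by rewrite mulr0.
  by rewrite inE => ->; rewrite mulr1.
- by rewrite pred_exp// !mulrA.
Qed.

(** A telescoping geometric series of ratio [t^(-(kappa+1))] when [t > 1]; for
    [t = 1] only the cyclic sheet contributes. *)
Lemma trunk_weight_series (r : 'I_kappa.+1) t :
  (\sum_(q <oo) (sheet_weight (trunk_sheet r q) t)%:E = (weight (xtrunk r : X) t)%:E)%E.
Proof.
have [t1|t1] := ltP t 1.
  rewrite eseries0//; last by move=> q _ _; rewrite sheet_weight_small.
  rewrite /weight indicE (_ : t \in _ = false) ?mul0r//.
  by apply/negP; rewrite inE /= in_itv /= andbT leNgt t1.
have one : \1_(`[1, +oo[%classic) t = 1 :> R.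
  by rewrite indicE mem_set//= in_itv /= andbT.
have t0 : 0 < t by rewrite (lt_le_trans _ t1).
pose u := t^-1 ^+ kappa.+1.
have partial n : \sum_(0 <= q < n.+1) sheet_weight (trunk_sheet r q) t =
    \1_[set 1] t + t ^+ r * (1 - u ^+ n).
  elim: n => [|n IH]; first by rewrite big_nat1 /= expr0 subrr mulr0 addr0.
  by rewrite big_nat_recr//= IH one -/u exprS; ring.
apply/cvg_lim => //.
rewrite -cvg_shiftS; apply: cvg_trans.
  apply: near_eq_cvg; apply: nearW => n /=; rewrite sumEFin partial; exact: erefl.
apply: cvg_EFin; first exact: nearW.
rewrite /comp /= /weight one mul1r.
have [t1E|tn1] := eqVneq t 1.
  rewrite /u t1E invr1 !expr1n.
  under eq_cvg do rewrite expr1n subrr mulr0 addr0.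
  by rewrite indicE mem_set//; exact: cvg_cst.
have u1 : `|u| < 1.
  rewrite /u normrX exprn_ilt1// ger0_norm ?invr_ge0 ?(ltW t0)//.
  by rewrite invf_lt1// lt_def tn1.
rewrite indicE (_ : t \in _ = false); last first.
  by apply/negP; rewrite inE /= => tE; rewrite tE eqxx in tn1.
rewrite -[X in _ --> X](_ : 0 + t ^+ r * (1 - 0) = _); last by rewrite subr0 mulr1 add0r.
apply: cvgD; first exact: cvg_cst.
apply: cvgM; first exact: cvg_cst.
by apply: cvgB; [exact: cvg_cst|exact: cvg_expr].
Qed.

Section subnormality.
Context (rho : {measure set R -> \bar R}).
Hypothesis rho_representing : S_representing rho (fun n => level n root / mass root).
Hypothesis rho_vanish : rho `[0, 1[%classic = 0%E.

Let EFin_weight y (c : R) : measurable_fun setT (fun t => (c * sheet_weight y t)%:E).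
Proof.
apply/measurable_EFinP/measurable_funM; first exact: measurable_cst.
exact: measurable_sheet_weight.
Qed.

(** The sheets above a point share out its density. *)
Lemma sheet_fiber_integral x (c : R) : 0 <= c ->
  (\esum_(y in sheet_point @^-1` [set x]) \int[rho]_t (c * sheet_weight y t)%:E
   = (c * (mass x / mass root))%:E)%E.
Proof.
move=> c0.
have I0 y : (0 <= \int[rho]_t (c * sheet_weight y t)%:E)%E.
  by apply: integral_ge0 => t _; rewrite lee_fin mulr_ge0 ?sheet_weight_ge0.
rewrite EFinM -(weight_integral rho_representing rho_vanish).
rewrite -ge0_integralZl//; last 2 first.
- by apply/measurable_EFinP; exact: measurable_weight.
- by move=> t _; rewrite lee_fin weight_ge0.
case: x => [r|j]; last first.
  rewrite (_ : _ @^-1` _ = [set branch_sheet j]) ?esum_set1//.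
  apply/seteqP; split=> [[r q|i] /=|_ ->//]; first by [].
  by case=> ->.
rewrite (_ : _ @^-1` _ = trunk_sheet r @` [set: nat]); last first.
  apply/seteqP; split=> [[s q|i] //= [<-]|_ [q _ <-]//].
  by exists q.
rewrite esum_image; last by move=> p q _ _ [].
rewrite -nneseries_esumT// -integral_nneseries//.
- apply: eq_integral => t _; rewrite -trunk_weight_series -nneseriesZl//.
  by move=> q _; rewrite lee_fin sheet_weight_ge0.
- by move=> q t _; rewrite lee_fin mulr_ge0 ?sheet_weight_ge0.
Qed.

(** The flow preserves the product measure as a permutation of the sheets, and the
    speed [sqrt t] is invariant as it does not depend on the sheet. *)
Lemma trunk_and_branch_subnormal :
  dense (dom (graph (composition_op mu phi))) -> subnormal (composition_op mu phi).
Proof.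
have [m mE] := sheet_measure rho.
have [s [flowE speedE]] := sheet_system mE.
have M0 := mass_gt0 mu root.
have W0 p : 0 <= mass root * sheet_weight p.1 p.2.
  by rewrite mulr_ge0 ?sheet_weight_ge0// ltW.
pose w (p : Y * R) := Num.sqrt (mass root * sheet_weight p.1 p.2).
apply: (@subnormal_composition _ X R mu phi _ _ m s (fun p => sheet_point p.1) w).
- by apply: measurable_fun_sheets => y; exact: measurable_cst.
- apply: measurable_fun_sheets => y; rewrite /w /=.
  apply: (measurableT_comp (continuous_measurable_fun (@sqrt_continuous R))).
  by apply: measurable_funM; [exact: measurable_cst|exact: measurable_sheet_weight].
- by move=> p; rewrite flowE sheet_point_flow.
- move=> [y t]; rewrite flowE speedE /w /=.
  have [t0|t0] := ltP t 0.
    have t1 : t < 1 by rewrite (lt_trans t0).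
    by rewrite !sheet_weight_small// !mulr0 sqrtr0 mulr0.
  by rewrite -sqrtrM// sheet_weight_flow mulrCA.
- move=> F F0.
  rewrite integral_discrete// mE; last 2 first.
  + apply: measurable_fun_sheets => y; apply/measurable_EFinP/measurable_funM.
      apply: measurable_funX.
      apply: (measurableT_comp (continuous_measurable_fun (@sqrt_continuous R))).
      by apply: measurable_funM; [exact: measurable_cst|exact: measurable_sheet_weight].
    exact: (measurable_cst (F (sheet_point y))).
  + by move=> p; rewrite lee_fin mulr_ge0// sqr_ge0.
  rewrite (esum_fibers sheet_point); last first.
    by move=> y; apply: integral_ge0 => t _; rewrite lee_fin mulr_ge0// sqr_ge0.
  apply: eq_esum => x _.
  rewrite -[RHS](_ : (mass root * F x * (mass x / mass root))%:E = _); last first.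
    by congr (_%:E); field; rewrite gt_eqF.
  rewrite -sheet_fiber_integral ?mulr_ge0 ?(ltW M0)//.
  apply: eq_esum => y /= <-; apply: eq_integral => t _.
  by rewrite /w sqr_sqrtr// mulrAC.
Qed.

End subnormality.
End dilation.



(** * The equivalence and subnormality *)

Theorem proposition4p3p4 (R : realType) (kappa : nat)
    (mu : discrete_measure (X1 kappa) R) :
  let phi := @phi1 kappa in
  let C := composition_op mu phi in
  let h := radon_nikodym_pow mu phi in
  let h0 := fun n : nat => fine (h n (xtrunk ord0)) in
  let cond_i :=
    exists P : X1 kappa -> probability R R,
      (forall x, P x `[0, +oo[%classic = 1%E) /\ consistency_condition mu phi P in
  let cond_ii :=
    Stieltjes_moment_sequence h0 /\
    exists rho : {measure set R -> \bar R},
      S_representing rho h0 /\ rho `[0, 1[%classic = 0%E in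
  let cond_iii :=
    forall (n : nat) (l : 'I_n.+1 -> R[i]),
      0 <= \sum_(i < n.+1) \sum_(j < n.+1) (h0 (i + j)%N)%:C * l i * (l j)^*
        <= \sum_(i < n.+1) \sum_(j < n.+1) (h0 (i + j + 1)%N)%:C * l i * (l j)^* in
  [/\ dense (dom_infty (graph C)),
      forall x n, (0 < h n x < +oo)%E,
      (cond_i <-> cond_ii) /\ (cond_ii <-> cond_iii) &
      (cond_i \/ cond_ii \/ cond_iii -> subnormal C)].
Proof.
move=> phi C h h0 cond_i cond_ii cond_iii.
have dense_infty : dense (dom_infty (graph C)).
  exact: (composition_dom_infty_dense (@pickle_le_finite kappa) (@phi1_preimage_finite kappa)).
have h0E : h0 = fun n => level mu n (xtrunk ord0) / mass mu (xtrunk ord0).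
  by apply/funext => n; rewrite /h0 /h radon_nikodym_level.
have i_ii : cond_i -> cond_ii.
  move=> [P [PD PC]]; have rep := consistency_representing PD PC (xtrunk ord0).
  rewrite -h0E in rep; split; first by exists (P (xtrunk ord0)).
  have van := consistency_vanish PC.
  by exists (P (xtrunk ord0)); split.
have ii_i : cond_ii -> cond_i.
  by rewrite /cond_ii h0E => -[_ [rho [rep van]]]; exact: measure_consistency rep van.
have h00 : h0 0%N = 1 by rewrite h0E level0 divff// gt_eqF// mass_gt0.
have ii_iii : cond_ii -> cond_iii.
  by move=> [_ [rho [rep van]]]; apply/bounded_below_formP; exact: representing_bounded_below rep van.
have iii_ii : cond_iii -> cond_ii.
  move=> /bounded_below_formP /(bounded_below_representing h00) [rho rep van].
  by split; [exists rho|exists rho].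
have ii_subnormal : cond_ii -> subnormal C.
  rewrite /cond_ii h0E => -[_ [rho [rep van]]].
  apply: (trunk_and_branch_subnormal rep van) => O O0 Oo.
  have [f [Of /(_ 1%N I) [g [f' ff' f'g]]]] := dense_infty O O0 Oo.
  by exists f; split=> //; exists g; move: ff' => /= ->.
split=> //.
- move=> x n; rewrite /h radon_nikodym_level lte_fin divr_gt0 ?level_gt0 ?mass_gt0//=.
  by rewrite ltry.
- by move=> [/i_ii|[|/iii_ii]]; exact: ii_subnormal.
Qed.
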